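(* Let $\mathfrak g=\mathfrak{sp}(\infty)$, $\mu\in\mathbb C^{\mathbb Z_{>0}}$, and let $\prec$ be an admissible $\mathbb Z_2$-linear partial order on $\mathbb Z$. Then $X_{\mathfrak{sp}}(\mu)$ is $\mathfrak p(\prec)$-aligned if and only if one of the following statements holds: (a) $\{[i]:[i]\prec[0]\}$ does not admit a maximal element, $\{[i]:[i]\succ[0]\}$ does not admit a minimal element, and $\mu\sim_{\mathfrak{sp}}\omega$ for some $\omega\in R_\mu(\prec)$. (b) $\{[i]:[i]\prec[0]\}$ admits a maximal element $[i']$, $\{[i]:[i]\succ[0]\}$ does not admit a minimal element, and either $\mu\sim_{\mathfrak{sp}}\omega(+)-\varepsilon_{i_0}$ for some $i_0\in[i']\cap\mathbb Z_{>0}$, or $\mu\sim_{\mathfrak{sp}}\omega$ for some $\omega\in R_\mu(\prec)$. (c) $\{[i]:[i]\succ[0]\}$ admits a minimal element $[i']$, $\{[i]:[i]\prec[0]\}$ does not admit a maximal element, and either $\mu\sim_{\mathfrak{sp}}\omega(-)+\varepsilon_{i_0}$ for some $i_0\in[i']\cap\mathbb Z_{>0}$, or $\mu\sim_{\mathfrak{sp}}\omega$ for some $\omega\in R_\mu(\prec)$. (d) $\{[i]:[i]\prec[0]\}$ admits a maximal element $[i_1]$, $\{[i]:[i]\succ[0]\}$ admits a minimal element $[i_2]$, and either $\mu\sim_{\mathfrak{sp}}\omega(+)-\varepsilon_{i_0}$ for some $i_0\in[i_1]\cap\mathbb Z_{>0}$, or $\mu\sim_{\mathfrak{sp}}\omega(-)+\varepsilon_{i_0}$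 for some $i_0\in[i_2]\cap\mathbb Z_{>0}$, or $\mu\sim_{\mathfrak{sp}}\omega$ for some $\omega\in R_\mu(\prec)$.
   Context: The ground field is $\mathbb C$. $\mathfrak g=\mathfrak{sp}(\infty)=\varinjlim_n\mathfrak{sp}(2n)$ with its Cartan subalgebra $\mathfrak h$ (direct limit of the standard Cartan subalgebras) and roots $\pm2\varepsilon_i$, $\pm\varepsilon_i\pm\varepsilon_j$ ($i\ne j$ in $\mathbb Z_{>0}$); $\mathfrak g_\alpha$ is the root space of $\alpha$. Modules are weight modules with respect to $\mathfrak h$ with finite-dimensional weight spaces. The root lattice $Q_{\mathfrak g}$ is identified with the finitely supported integer sequences $(\lambda_i)_{i\ge1}$ with $\sum\lambda_i$ even; $\varepsilon_i$ is identified with the sequence with $1$ in position $i$ and $0$ elsewhere. Orders: for a (strict) partial order $\prec$ on a set $F$ put $[i]=\{i\}\cup\{j\in F: i,j\text{ not comparable}\}$. It is admissible if $[i]\ne[j]$ implies $[i]\cap[j]=\emptyset$; then the classes $[i]$ partition $F$ and $\prec$ induces a linear order on them. A partial order on $\mathbb Z$ is $\mathbb Z_2$-linear if multiplication by $-1$ reverses it. Parabolic subalgebras: for an admissible $\mathbb Z_2$-linear partial order $\prec$ on $\mathbb Z$, $\mathfrak p(\prec)=\mathfrak l(\prec)\oplus\mathfrak u(\prec)$, where $\mathfrak u(\prec)=\bigoplus_{\alpha\in P^+}\mathfrak g_\alpha$ with (for $i,j\in\mathbb Z_{>0}$, $i\ne j$) $$P^+=\{2\varepsilon_i: i\prec0\}\cup\{-2\varepsilon_i:-i\prec0\}\cup\{\varepsilon_i-\varepsilon_j:i\prec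 j\}\cup\{\varepsilon_i+\varepsilon_j:i\prec-j\}\cup\{-\varepsilon_i-\varepsilon_j:-i\prec j\},$$ and $\mathfrak l(\prec)$ is the sum of $\mathfrak h$ and the root spaces $\mathfrak g_\alpha$ with neither $\alpha$ nor $-\alpha$ in $P^+$. Aligned modules: for a parabolic subalgebra $\mathfrak p=\mathfrak l\oplus\mathfrak u$ and a simple weight $\mathfrak l$-module $S$ on which $\mathfrak u$ is made to act by zero, let $M_{\mathfrak p}(S)=\mathbf U(\mathfrak g)\otimes_{\mathbf U(\mathfrak p)}S$. A simple weight $\mathfrak g$-module is $\mathfrak p$-aligned if it is isomorphic to the unique simple quotient of $M_{\mathfrak p}(S)$ for some simple weight $\mathfrak l$-module $S$. The modules $X_{\mathfrak{sp}}(\mu)$: for $\mu\in\mathbb C^{\mathbb Z_{>0}}$ let $\mathbf x^\mu=\prod_{i\ge1}x_i^{\mu_i}$ (formal monomial) and $\mathcal F_{\mathfrak{sp}}(\mu)=\mathrm{span}\{\mathbf x^\lambda:\lambda-\mu\in Q_{\mathfrak g}\}$. For appropriate nonzero root vectors $g_\alpha\in\mathfrak g_\alpha$, $\mathfrak g$ acts on it by $g_{\varepsilon_i-\varepsilon_j}\mapsto x_i\partial_j$, $g_{\varepsilon_i+\varepsilon_j}\mapsto x_ix_j$, $g_{2\varepsilon_i}\mapsto\frac12x_i^2$, $g_{-\varepsilon_i-\varepsilon_j}\mapsto-\partial_i\partial_j$, $g_{-2\varepsilon_i}\mapsto-\frac12\partial_i^2$. Let $\mathrm{Int}^+(\mu)$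 and $\mathrm{Int}^-(\mu)$ be the sets of $i$ with $\mu_i\in\mathbb Z_{\ge0}$, resp. $\mathbb Z_{<0}$. Put $V_{\mathfrak{sp}}(\mu)=\mathrm{span}\{\mathbf x^\lambda:\lambda-\mu\in Q_{\mathfrak g},\ \mathrm{Int}^+(\mu)\subseteq\mathrm{Int}^+(\lambda)\}$, $V_{\mathfrak{sp}}(\mu)^+=0$ if $\mathrm{Int}^-(\mu)=\emptyset$ and otherwise $V_{\mathfrak{sp}}(\mu)^+=\sum V_{\mathfrak{sp}}(\mu')$ over all $\mu'$ with $\mu-\mu'\in Q_{\mathfrak g}$ and $\mathrm{Int}^+(\mu)\subsetneq\mathrm{Int}^+(\mu')$; $X_{\mathfrak{sp}}(\mu)=V_{\mathfrak{sp}}(\mu)/V_{\mathfrak{sp}}(\mu)^+$, a simple weight module. The class of $\mathbf x^\lambda$ has weight $\lambda+(\frac12,\frac12,\ldots)$. Notation: $\lambda\sim_{\mathfrak{sp}}\mu$ means $\lambda-\mu\in Q_{\mathfrak g}$ and $\mathrm{Int}^+(\lambda)=\mathrm{Int}^+(\mu)$. For $J\subseteq\mathbb Z_{>0}$, $\omega_J=(\omega_j)_{j\in J}$; $\mathbf 0$, $-\mathbf 1$ are constant tuples. $R(\prec)$ is the set of $\omega\in\mathbb C^{\mathbb Z_{>0}}$ with $\omega_{[i]\cap\mathbb Z_{>0}}=-\mathbf 1$ for all $[i]\prec[0]$ and $\omega_{[i]\cap\mathbb Z_{>0}}=\mathbf 0$ for all $[i]\succ[0]$; $R_\mu(\prec)=\{\omega\in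 R(\prec):\omega\sim_{\mathfrak{sp}}\mu\}$. If $\{[i]:[i]\prec[0]\}$ has a maximal element, $\omega(+)\in R(\prec)$ is the element with $\omega(+)_{[0]\cap\mathbb Z_{>0}}=\mathbf 0$; if $\{[i]:[i]\succ[0]\}$ has a minimal element, $\omega(-)\in R(\prec)$ is the element with $\omega(-)_{[0]\cap\mathbb Z_{>0}}=-\mathbf 1$ (if $[0]=\{0\}$ these conditions are vacuous and $\omega(\pm)$ is the unique element of $R(\prec)$). *)

(* Defs.v *)
From HB Require Import structures.
From mathcomp Require Import all_boot all_order all_algebra.
From mathcomp Require Import finmap.
From mathcomp.multinomials Require Import monalg.
From mathcomp Require Import boolp classical_sets functions reals.
From mathcomp.real_closed Require Import complex.
From mathcomp Require Import ring zify.

Set Implicit Arguments.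
Unset Strict Implicit.
Unset Printing Implicit Defensive.

Import GRing.Theory.

Local Open Scope classical_set_scope.
Local Open Scope ring_scope.
Local Open Scope quotient_scope.

Section LinearExtension.
Variables (K : fieldType) (X : choiceType) (V : lmodType K).

(* {malg K[X]} is the free K-module with basis the << x >>, x : X. *)
Definition lext (f : X -> V) (a : {malg K[X]}) : V :=
  \sum_(x <- msupp a) a@_x *: f x.

Lemma lextE f a : lext f a = \sum_(x <- msupp a) a@_x *: f x.
Proof. by []. Qed.

Lemma lextEw f (d : {fset X}) a :
  (msupp a `<=` d)%fset -> lext f a = \sum_(x <- d) a@_x *: f x.
Proof.
move=> ad; rewrite /lext (big_fset_incl _ ad)//= => x _ xa.
by rewrite mcoeff_outdom// scale0r.
Qed.

Lemma lext_is_linear f : linear (lext f).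
Proof.
move=> c a b; pose d := (msupp a `|` msupp b `|` msupp (c *: a + b))%fset.
rewrite (@lextEw f d) ?(@lextEw f d a) ?(@lextEw f d b).
- rewrite scaler_sumr -big_split/=; apply: eq_bigr => x _.
  by rewrite mcoeffD mcoeffZ scalerDl scalerA.
- by apply/fsubsetP => x xb; rewrite !inE xb !orbT.
- by apply/fsubsetP => x xb; rewrite !inE xb.
- by apply/fsubsetP => x xb; rewrite !inE xb !orbT.
Qed.

HB.instance Definition _ f :=
  GRing.isLinear.Build K {malg K[X]} V _ (lext f) (lext_is_linear f).

Lemma lextU f x : lext f << x >> = f x.
Proof.
rewrite (@lextEw f [fset x]%fset) ?msuppU_le// big_seq_fset1.
by rewrite mcoeffUU scale1r.
Qed.

Lemma malg_ind (P : {malg K[X]} -> Prop) :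
  P 0 -> (forall c a b, P a -> P b -> P (c *: a + b)) -> (forall x, P << x >>) ->
  forall a, P a.
Proof.
move=> P0 PD PU a; rewrite (monalgE a).
elim/big_rec: _ => // x b _ Pb.
suff -> : << a@_x *g x >> = a@_x *: << x >> :> {malg K[X]} by apply: PD.
by apply/malgP => y; rewrite mcoeffZ !mcoeffU mulr_natr.
Qed.

End LinearExtension.

Section Span.
Variables (K : fieldType) (V : lmodType K).

Definition span (A : set V) : {pred V} :=
  [pred v | `[< forall N : submodClosed V, (forall a, A a -> a \in N) -> v \in N >]].

Lemma spanP A v :
  reflect (forall N : submodClosed V, (forall a, A a -> a \in N) -> v \in N)
          (v \in span A).
Proof. exact: asboolP. Qed.

Lemma span_submod_closed A : submod_closed (span A).
Proof.
split=> [|c u v]; first by apply/spanP => N _; rewrite rpred0.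
move=> /spanP uA /spanP vA; apply/spanP => N AN.
by rewrite rpredD ?rpredZ ?uA ?vA.
Qed.

HB.instance Definition _ A :=
  GRing.isSubmodClosed.Build K V (span A) (span_submod_closed A).

Lemma sub_span A a : A a -> a \in span A.
Proof. by move=> Aa; apply/spanP => N; apply. Qed.

Lemma span_ind (A : set V) (P : V -> Prop) :
  P 0 -> (forall c u v, P u -> P v -> P (c *: u + v)) -> (forall a, A a -> P a) ->
  forall v, v \in span A -> P v.
Proof.
move=> P0 PD PA v /spanP Av; pose p : {pred V} := fun v => `[< P v >].
have pP x : reflect (P x) (x \in p) by exact: asboolP.
have cP : submod_closed p.
  by split=> [|c x y]; [exact/pP|move=> /pP Px /pP Py; exact/pP/PD].
pose N : submodClosed V := HB.pack p (GRing.isSubmodClosed.Build K V p cP).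
by apply/pP/(Av N) => a Aa; apply/pP/PA.
Qed.

End Span.

Section LinearQuotient.
Variables (K : fieldType) (V : lmodType K) (N : submodClosed V).

Fact zmod_closed_submod : zmod_closed N.
Proof. by split=> [|u v uN vN]; rewrite ?rpred0// -scaleN1r rpredD// rpredZ. Qed.

Definition zmod_of_submod : zmodClosed V :=
  HB.pack (GRing.SubmodClosed.sort N)
    (GRing.isZmodClosed.Build V (GRing.SubmodClosed.sort N) zmod_closed_submod).

Definition lquot := Quotient.quot zmod_of_submod.
HB.instance Definition _ := GRing.Zmodule.on lquot.
HB.instance Definition _ := Quotient.on lquot.

Lemma lquot_eq u v : (\pi_lquot u == \pi_lquot v) = (u - v \in N).
Proof. by rewrite -[RHS]/(u - v \in zmod_of_submod) Quotient.idealrBE. Qed.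

Lemma lquot_repr v : repr (\pi_lquot v) - v \in N.
Proof. by rewrite -lquot_eq reprK. Qed.

Lemma lquotD : {morph \pi_lquot : u v / u + v}.
Proof. exact: (raddfD (\pi_(Quotient.quot zmod_of_submod))). Qed.

Definition quot_scale (c : K) : lquot -> lquot := lift_op1 lquot ( *:%R c).

Lemma lquotZ c v : quot_scale c (\pi_lquot v) = \pi_lquot (c *: v).
Proof.
apply/eqP; rewrite /quot_scale; unlock; rewrite lquot_eq -scalerBr rpredZ//.
by rewrite -lquot_eq reprK.
Qed.

Fact quot_scaleA a b (v : lquot) :
  quot_scale a (quot_scale b v) = quot_scale (a * b) v.
Proof. by rewrite -[v]reprK !lquotZ scalerA. Qed.
Fact quot_scale1 : left_id 1 quot_scale.
Proof. by move=> v; rewrite -[v]reprK !lquotZ scale1r. Qed.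
Fact quot_scaleDr : right_distributive quot_scale +%R.
Proof.
by move=> c u v; rewrite -[u]reprK -[v]reprK -raddfD !lquotZ scalerDr raddfD.
Qed.
Fact quot_scaleDl v : {morph quot_scale^~ v : a b / a + b}.
Proof. by move=> a b; rewrite -[v]reprK !lquotZ scalerDl lquotD. Qed.

HB.instance Definition _ := GRing.Zmodule_isLmodule.Build K lquot
  quot_scaleA quot_scale1 quot_scaleDr quot_scaleDl.

(* Only meaningful for a linear f preserving N. *)
Definition quot_map (f : V -> V) : lquot -> lquot := lift_op1 lquot f.

End LinearQuotient.

HB.mixin Record Lmodule_isLie (K : fieldType) L of GRing.Lmodule K L := {
  bracket : L -> L -> L;
  bracket_linearl : forall y, linear (bracket^~ y);
  bracket_linearr : forall x, linear (bracket x);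
  bracketxx : forall x, bracket x x = 0;
  bracket_jacobi : forall x y z,
    bracket x (bracket y z) + bracket y (bracket z x) + bracket z (bracket x y) = 0
}.

#[short(type="lieAlgType")]
HB.structure Definition LieAlgebra (K : fieldType) :=
  { L of GRing.Lmodule K L & Lmodule_isLie K L }.

Section LieModules.
Variables (K : fieldType) (L : lieAlgType K).

(* A module over a Lie subalgebra a of L is given by a map L -> V -> V of which
   only the values on a matter. L-modules are the case a = setT. *)
Definition is_rep (a : set L) (V : lmodType K) (act : L -> V -> V) : Prop :=
  [/\ forall x, a x -> linear (act x),
      forall c x y v, a x -> a y -> act (c *: x + y) v = c *: act x v + act y v
    & forall x y v, a x -> a y ->
        act (bracket x y) v = act x (act y v) - act y (act x v)].

Definition submodule (a : set L) (V : lmodType K) (act : L -> V -> V)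
    (N : submodClosed V) : Prop :=
  forall x v, a x -> v \in N -> act x v \in N.

Definition simple (a : set L) (V : lmodType K) (act : L -> V -> V) : Prop :=
  (exists v : V, v <> 0) /\
  forall N : submodClosed V, submodule a act N ->
    (forall v, v \in N -> v = 0) \/ (forall v, v \in N).

Definition module_iso (V W : lmodType K)
    (actV : L -> V -> V) (actW : L -> W -> W) : Prop :=
  exists f : {linear V -> W},
    bijective f /\ forall x v, f (actV x v) = actW x (f v).

(* X is isomorphic to the unique simple quotient of M. *)
Definition unique_simple_quotient (M X : lmodType K)
    (actM : L -> M -> M) (actX : L -> X -> X) : Prop :=
  let simple_quotient (N : submodClosed M) :=
    submodule setT actM N /\
    simple setT (fun x => quot_map (N := N) (actM x)) in
  exists N : submodClosed M,
    [/\ simple_quotient N,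
        forall N' : submodClosed M, simple_quotient N' -> N' =i N
      & module_iso (fun x => quot_map (N := N) (actM x)) actX].

End LieModules.

Section AlgebraQuotient.
Variables (K : fieldType) (T : algType K) (A : set T).

Definition ideal : {pred T} :=
  span [set p | exists x a y, A a /\ p = x * a * y].

HB.instance Definition _ := GRing.SubmodClosed.on ideal.

Lemma ideal_mull t p : p \in ideal -> t * p \in ideal.
Proof.
move: p; apply: span_ind => [|c u v ui vi|_ [x [a [y [Aa ->]]]]].
- by rewrite mulr0 rpred0.
- by rewrite mulrDr -scalerAr rpredD// rpredZ.
- by apply: sub_span; exists (t * x), a, y; rewrite !mulrA.
Qed.

Lemma ideal_mulr t p : p \in ideal -> p * t \in ideal.
Proof.
move: p; apply: span_ind => [|c u v ui vi|_ [x [a [y [Aa ->]]]]].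
- by rewrite mul0r rpred0.
- by rewrite mulrDl -scalerAl rpredD// rpredZ.
- by apply: sub_span; exists x, a, (y * t); rewrite !mulrA.
Qed.

Definition alg_quot := lquot ideal.
HB.instance Definition _ := Quotient.on alg_quot.
HB.instance Definition _ := GRing.Lmodule.on alg_quot.

Definition alg_quot_mul : alg_quot -> alg_quot -> alg_quot :=
  lift_op2 alg_quot *%R.

Lemma pi_mul p q :
  alg_quot_mul (\pi_alg_quot p) (\pi_alg_quot q) = \pi_alg_quot (p * q).
Proof.
apply/eqP; rewrite /alg_quot_mul; unlock; rewrite lquot_eq.
set p' := repr _; set q' := repr _.
have -> : p' * q' - p * q = (p' - p) * q + p' * (q' - q).
  by rewrite mulrBl mulrBr [RHS]addrC addrA addrNK.
by apply: rpredD; [apply: ideal_mulr|apply: ideal_mull]; apply: lquot_repr.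
Qed.

Fact alg_quot_mulA : associative alg_quot_mul.
Proof.
by move=> x y z; rewrite -[x]reprK -[y]reprK -[z]reprK !pi_mul mulrA.
Qed.
Fact alg_quot_mul1 : left_id (\pi_alg_quot 1) alg_quot_mul.
Proof. by move=> x; rewrite -[x]reprK !pi_mul mul1r. Qed.
Fact alg_quot_mulr1 : right_id (\pi_alg_quot 1) alg_quot_mul.
Proof. by move=> x; rewrite -[x]reprK !pi_mul mulr1. Qed.
Fact alg_quot_mulDl : left_distributive alg_quot_mul +%R.
Proof.
move=> x y z; rewrite -[x]reprK -[y]reprK -[z]reprK.
by rewrite -[in LHS]lquotD !pi_mul -lquotD mulrDl.
Qed.
Fact alg_quot_mulDr : right_distributive alg_quot_mul +%R.
Proof.
move=> x y z; rewrite -[x]reprK -[y]reprK -[z]reprK.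
by rewrite -[in LHS]lquotD !pi_mul -lquotD mulrDr.
Qed.

(* Rings with 1 = 0 are allowed, so that no ideal has to be shown proper. *)
HB.instance Definition _ := GRing.Zmodule_isPzRing.Build alg_quot
  alg_quot_mulA alg_quot_mul1 alg_quot_mulr1 alg_quot_mulDl alg_quot_mulDr.

End AlgebraQuotient.

Section Enveloping.
Variables (K : fieldType) (L : lieAlgType K).

(* The free associative algebra on the set L. *)
Definition free_alg := {malg K[{fmonom L}]}.
HB.instance Definition _ := GRing.Lalgebra.on free_alg.
Fact free_alg_scaleAr c (p q : free_alg) : c *: (p * q) = p * (c *: q).
Proof.
apply/malgP => k.
rewrite mcoeffZ mcoeffMl (mcoeffMlw k (fsubset_refl _) (msuppZ_le c q)).
rewrite mulr_sumr; apply: eq_bigr => x _; rewrite mulr_sumr.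
by apply: eq_bigr => y _; rewrite mcoeffZ mulrnAr mulrCA.
Qed.
HB.instance Definition _ :=
  GRing.Lalgebra_isAlgebra.Build K free_alg free_alg_scaleAr.

Definition free_gen (x : L) : free_alg := << fmu x >>.

Definition env_rel : set free_alg :=
  [set p | (exists c x y,
              p = free_gen (c *: x + y) - (c *: free_gen x + free_gen y)) \/
           (exists x y, p = free_gen x * free_gen y - free_gen y * free_gen x
                            - free_gen (bracket x y))].

(* U(L): the tensor algebra of L modulo xy - yx - [x,y]. *)
Definition U := alg_quot env_rel.
HB.instance Definition _ := GRing.PzRing.on U.
HB.instance Definition _ := GRing.Lmodule.on U.

Definition iota (x : L) : U := \pi_(alg_quot env_rel) (free_gen x).

End Enveloping.

Section Induced.
Variables (K : fieldType) (L : lieAlgType K) (l u : set L).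
Variables (S : lmodType K) (act : L -> S -> S).

Local Notation tens a s := (<< (a, s) >> : {malg K[(U L * S)%type]}).

(* For the subalgebra p = l + u and the l-module S with u acting by zero,
   x + y in p acts on S as x. Since p generates U(p), the last family of
   relations makes the tensor product balanced over U(p). *)
Definition induced_rel : set {malg K[(U L * S)%type]} :=
  [set t | [\/ exists c a b s,
                 t = tens (c *: a + b) s - (c *: tens a s + tens b s),
               exists c a s s',
                 t = tens a (c *: s + s') - (c *: tens a s + tens a s')
             | exists a x y s, [/\ l x, u y
                 & t = tens (a * iota (x + y)) s - tens a (act x s)]]].

(* M_p(S) = U(L) tensor S over U(p). *)
Definition induced := lquot (span induced_rel).
HB.instance Definition _ := GRing.Lmodule.on induced.

Definition induced_act (x : L) : induced -> induced :=
  quot_map (lext (fun t => tens (iota x * t.1) t.2)).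

End Induced.


(* Finitary I x I matrices; << (a, b) >> is the elementary matrix E_ab and
   A@_(a, b) is the (a, b) entry. *)
Notation finmx K I := {malg K[(I * I)%type]}.

HB.lock Definition mulfmx (K : fieldType) (I : choiceType) (A B : finmx K I) :
    finmx K I :=
  lext (fun x : I * I =>
    lext (fun y : I * I => if x.2 == y.1 then << (x.1, y.2) >> else 0) B) A.
Arguments mulfmx {K I} A B.

Section FinitaryMatrices.
Variables (K : fieldType) (I : choiceType).
Local Notation finmx := (finmx K I).
Implicit Types A B C D E F : finmx.

Definition elmx (a b : I) : finmx := << (a, b) >>.

Definition commfmx (A B : finmx) : finmx := mulfmx A B - mulfmx B A.

Lemma mulfmx_linearl B : linear (@mulfmx K I ^~ B).
Proof. by move=> c A A'; rewrite unlock linearP. Qed.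

Lemma mulfmx_linearr A : linear (@mulfmx K I A).
Proof.
move=> c B B'; rewrite unlock ![lext _ A]lextE scaler_sumr -big_split/=.
by apply: eq_bigr => x _; rewrite lext_is_linear scalerDr !scalerA mulrC.
Qed.

Lemma mul0fmx B : mulfmx 0 B = 0.
Proof. by rewrite unlock raddf0. Qed.

Lemma mulfmx0 A : mulfmx A 0 = 0.
Proof.
by have := mulfmx_linearr A (-1) 0 0; rewrite scaler0 addr0 scaleN1r addNr.
Qed.

Lemma mulfmxZl c A B : mulfmx (c *: A) B = c *: mulfmx A B.
Proof. by rewrite -[c *: A]addr0 mulfmx_linearl mul0fmx addr0. Qed.

Lemma mulfmxZr c A B : mulfmx A (c *: B) = c *: mulfmx A B.
Proof. by rewrite -[c *: B]addr0 mulfmx_linearr mulfmx0 addr0. Qed.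

Lemma mul_elmx a b c d :
  mulfmx (elmx a b) (elmx c d) = if b == c then elmx a d else 0.
Proof. by rewrite unlock !lextU. Qed.

Lemma mulfmxA A B C : mulfmx A (mulfmx B C) = mulfmx (mulfmx A B) C.
Proof.
elim/malg_ind: A => [|k A A' IH IH'|[a a']]; first by rewrite !mul0fmx.
  by rewrite !mulfmx_linearl IH IH'.
elim/malg_ind: B => [|k B B' IH IH'|[b b']]; first by rewrite mul0fmx mulfmx0 mul0fmx.
  by rewrite !(mulfmx_linearl, mulfmx_linearr) IH IH'.
elim/malg_ind: C => [|k C C' IH IH'|[c c']]; first by rewrite !mulfmx0.
  by rewrite !mulfmx_linearr IH IH'.
rewrite -!/(elmx _ _) !mul_elmx.
by case: eqP => bc; case: eqP => ab; rewrite ?mul_elmx ?mul0fmx ?mulfmx0 ?bc ?ab ?eqxx//;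
  case: eqP.
Qed.

Lemma commfmx_linearl B : linear (commfmx^~ B).
Proof.
move=> c A A'; rewrite /commfmx mulfmx_linearl mulfmx_linearr.
by apply/malgP => k; rewrite !(mcoeffD, mcoeffN, mcoeffZ); ring.
Qed.

Lemma commfmx_linearr A : linear (commfmx A).
Proof.
move=> c B B'; rewrite /commfmx mulfmx_linearl mulfmx_linearr.
by apply/malgP => k; rewrite !(mcoeffD, mcoeffN, mcoeffZ); ring.
Qed.

Lemma commfmx_jacobi A B C :
  commfmx A (commfmx B C) + commfmx B (commfmx C A) + commfmx C (commfmx A B) = 0.
Proof.
have mulBr D E F : mulfmx D (E - F) = mulfmx D E - mulfmx D F.
  by rewrite addrC -scaleN1r mulfmx_linearr scaleN1r addrC.
have mulBl D E F : mulfmx (E - F) D = mulfmx E D - mulfmx F D.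
  by rewrite addrC -scaleN1r mulfmx_linearl scaleN1r addrC.
rewrite /commfmx !(mulBl, mulBr) !mulfmxA.
by apply/malgP => k; rewrite !(mcoeffD, mcoeffN, mcoeff0); ring.
Qed.

End FinitaryMatrices.

(* The basis e_1, e_2, .. , e_-1, e_-2, .. of the natural module: inl i stands
   for the index i+1 and inr i for the index -(i+1). *)
Definition idx : choiceType := (nat + nat)%type.

Definition opp (a : idx) : idx :=
  match a with inl i => inr i | inr i => inl i end.

Section Symplectic.
Variable K : fieldType.

Definition sgn (a : idx) : K := match a with inl _ => 1 | inr _ => -1 end.

(* J A is symmetric, where J is the Gram matrix of the symplectic form
   J_(i,-i) = 1 = - J_(-i,i). *)
Definition symplectic : {pred finmx K idx} :=
  fun A => `[< forall a b, sgn a * A@_(opp a, b) = sgn b * A@_(opp b, a) >].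

Fact symplectic_closed : submod_closed symplectic.
Proof.
split=> [|c A B /asboolP sA /asboolP sB]; apply/asboolP => a b.
  by rewrite !mcoeff0 !mulr0.
by rewrite !(mcoeffD, mcoeffZ) !mulrDr !(mulrCA _ c) sA sB.
Qed.
HB.instance Definition _ :=
  GRing.isSubmodClosed.Build K (finmx K idx) symplectic symplectic_closed.

Record sp : predArgType := Sp { spmx : finmx K idx; _ : spmx \in symplectic }.
HB.instance Definition _ := [isSub for spmx].
HB.instance Definition _ := [Choice of sp by <:].
HB.instance Definition _ := [SubChoice_isSubLmodule of sp by <:].

Lemma commfmx_sp A B :
  A \in symplectic -> B \in symplectic -> commfmx A B \in symplectic.
Proof.
have oppK : involutive opp by case.
have sgnK a : sgn a * sgn a = 1 by case: a => i /=; rewrite ?mulrNN mul1r.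
have sgnN a : sgn (opp a) = - sgn a by case: a => i /=; rewrite ?opprK.
pose star : finmx K idx -> finmx K idx :=
  lext (fun x : idx * idx => (sgn x.1 * sgn x.2) *: elmx K (opp x.2) (opp x.1)).
have starE C a b : (star C)@_(a, b) = sgn a * sgn b * C@_(opp b, opp a).
  rewrite /star; elim/malg_ind: C => [|c C C' IH IH'|[x y]].
  - by rewrite raddf0 !mcoeff0 mulr0.
  - by rewrite linearP !(mcoeffD, mcoeffZ) IH IH'; ring.
  - rewrite lextU/= mcoeffZ !mcoeffU !xpair_eqE.
    rewrite (inv_eq oppK) (inv_eq oppK) [_ && _]andbC.
    case: eqP => [->|_]; case: eqP => [->|_]; rewrite ?mulr0//.
    by rewrite !sgnN; ring.
have starP C : reflect (star C = - C) (C \in symplectic).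
  apply: (iffP (asboolP _)) => [sC|sC a b].
    apply/malgP => -[a b]; rewrite starE mcoeffN.
    have := sC b (opp a); rewrite oppK sgnN => e.
    by rewrite mulrAC -mulrA (mulrC _ (sgn b)) e mulNr mulrN mulrA sgnK mul1r.
  have := congr1 (fun D : finmx K idx => D@_(opp a, b)) sC.
  rewrite /= starE mcoeffN oppK sgnN => e.
  have -> : C@_(opp a, b) = sgn a * sgn b * C@_(opp b, a).
    by rewrite -[LHS]opprK -e; ring.
  by rewrite !mulrA sgnK mul1r.
have starM C D : star (mulfmx C D) = mulfmx (star D) (star C).
  elim/malg_ind: C => [|c C C' IH IH'|[x y]].
  - by rewrite mul0fmx /star raddf0 mulfmx0.
  - by rewrite mulfmx_linearl /star !linearP/= mulfmx_linearr -!/star IH IH'.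
  elim/malg_ind: D => [|c D D' IH IH'|[z t]].
  - by rewrite mulfmx0 /star raddf0 mul0fmx.
  - by rewrite mulfmx_linearr /star !linearP/= mulfmx_linearl -!/star IH IH'.
  rewrite -!/(elmx K _ _) mul_elmx /star !lextU/= mulfmxZl mulfmxZr mul_elmx.
  rewrite (inv_eq oppK) oppK [z == y]eq_sym; case: eqP => [->|_].
    by rewrite lextU/= scalerA; congr (_ *: _); rewrite -[LHS]mul1r -(sgnK z); ring.
  by rewrite raddf0 !scaler0.
move=> /starP sA /starP sB; apply/starP.
rewrite /commfmx {1}/star linearB/= -!/(star _) !starM sA sB.
by rewrite -!scaleN1r !(mulfmxZl, mulfmxZr) !scalerA; apply/malgP => k;
   rewrite !(mcoeffD, mcoeffN, mcoeffZ); ring.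
Qed.

Definition sp_bracket (x y : sp) : sp := Sp (commfmx_sp (valP x) (valP y)).

Fact sp_bracket_linearl y : linear (sp_bracket^~ y).
Proof. by move=> c x x'; apply: val_inj; rewrite linearP/= commfmx_linearl. Qed.
Fact sp_bracket_linearr x : linear (sp_bracket x).
Proof. by move=> c y y'; apply: val_inj; rewrite linearP/= commfmx_linearr. Qed.
Fact sp_bracketxx x : sp_bracket x x = 0.
Proof. by apply: val_inj; rewrite /= /commfmx subrr. Qed.
Fact sp_bracket_jacobi x y z :
  sp_bracket x (sp_bracket y z) + sp_bracket y (sp_bracket z x)
    + sp_bracket z (sp_bracket x y) = 0.
Proof. by apply: val_inj; rewrite !raddfD/= commfmx_jacobi. Qed.
HB.instance Definition _ := Lmodule_isLie.Build K sp
  sp_bracket_linearl sp_bracket_linearr sp_bracketxx sp_bracket_jacobi.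

(* H_i = E_(i,i) - E_(-i,-i), a basis of the Cartan subalgebra. *)
Definition cartan_mx (i : nat) : finmx K idx :=
  elmx K (inl i) (inl i) - elmx K (inr i) (inr i).

Fact cartan_mx_sp i : cartan_mx i \in symplectic.
Proof.
have EL j k : (inl j == inl k :> idx) = (j == k) by [].
have ER j k : (inr j == inr k :> idx) = (j == k) by [].
have ELR j k : (inl j == inr k :> idx) = false by [].
have ERL j k : (inr j == inl k :> idx) = false by [].
apply/asboolP => -[] a [] b; rewrite /cartan_mx !mcoeffB !mcoeffU !xpair_eqE/=;
  rewrite !(EL, ER, ELR, ERL) ?andbF//.
  by rewrite andbC; ring.
by rewrite [in RHS]andbC; ring.
Qed.

Definition H (i : nat) : sp := Sp (cartan_mx_sp i).

(* The dual basis of the H_i: sequences in C^(Z>0) are weights via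
   lam (H_i) = lam i. *)
Definition eps (i : nat) : nat -> K := fun k => (k == i)%:R.

Definition cartan : {pred sp} := span (range H).

Definition root_space (alpha : nat -> K) : set sp :=
  [set x | forall i, bracket (H i) x = alpha i *: x].

Definition roots : set (nat -> K) :=
  [set alpha | (exists i, alpha = eps i *+ 2 \/ alpha = - (eps i *+ 2)) \/
     (exists i j, i <> j /\
        [\/ alpha = eps i - eps j, alpha = eps i + eps j
          | alpha = - eps i - eps j])].

(* Weight modules over a Lie subalgebra containing the Cartan subalgebra, with
   finite-dimensional weight spaces. *)
Definition weight_space (V : lmodType K) (act : sp -> V -> V)
    (lam : nat -> K) : set V :=
  [set v | forall i, act (H i) v = lam i *: v].

Definition weight_module (V : lmodType K) (act : sp -> V -> V) : Prop :=
  (forall v, v \in span (\bigcup_(lam in setT) weight_space act lam)) /\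
  (forall lam, exists s : seq V,
     forall v, weight_space act lam v -> v \in span [set` s]).

Definition simple_weight_module (a : set sp) (V : lmodType K)
    (act : sp -> V -> V) : Prop :=
  [/\ is_rep a act, weight_module act & simple a act].

Definition aligned (l u : set sp) (X : lmodType K) (actX : sp -> X -> X) : Prop :=
  simple_weight_module setT actX /\
  exists (S : lmodType K) (act : sp -> S -> S),
    simple_weight_module l act /\
    unique_simple_quotient (@induced_act K sp l u S act) actX.

End Symplectic.

Section Orders.
Variable prec : int -> int -> Prop.

Definition strict_order : Prop :=
  (forall i, ~ prec i i) /\ (forall i j k, prec i j -> prec j k -> prec i k).

Definition cls (i : int) : set int :=
  [set j | j = i \/ ~ (prec i j \/ prec j i)].

Definition admissible : Prop :=
  forall i j, cls i <> cls j -> cls i `&` cls j = set0.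

Definition Z2_linear : Prop := forall i j, prec i j -> prec (- j) (- i).

Definition cls_prec (A B : set int) : Prop :=
  exists i j, [/\ A = cls i, B = cls j & prec i j].

Definition below0 : set (set int) :=
  [set A | (exists i, A = cls i) /\ cls_prec A (cls 0)].
Definition above0 : set (set int) :=
  [set A | (exists i, A = cls i) /\ cls_prec (cls 0) A].

Definition maximal_below0 (A : set int) : Prop :=
  below0 A /\ forall B, below0 B -> ~ cls_prec A B.
Definition minimal_above0 (A : set int) : Prop :=
  above0 A /\ forall B, above0 B -> ~ cls_prec B A.

End Orders.

(* The index k : nat of a sequence stands for the positive integer k + 1. *)
Definition pos (k : nat) : int := k.+1%:Z.

Section Parabolic.
Variables (K : fieldType) (prec : int -> int -> Prop).

Definition Pplus : set (nat -> K) :=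
  [set alpha |
     (exists i, alpha = eps K i *+ 2 /\ prec (pos i) 0) \/
     (exists i, alpha = - (eps K i *+ 2) /\ prec (- pos i) 0) \/
     (exists i j, i <> j /\
       [\/ alpha = eps K i - eps K j /\ prec (pos i) (pos j),
           alpha = eps K i + eps K j /\ prec (pos i) (- pos j)
         | alpha = - eps K i - eps K j /\ prec (- pos i) (pos j)])].

Definition nilradical : {pred sp K} :=
  span (\bigcup_(alpha in Pplus) @root_space K alpha).

Definition levi : {pred sp K} :=
  span ([set` @cartan K] `|`
    \bigcup_(alpha in [set alpha | [/\ roots alpha, ~ Pplus alpha
                                   & ~ Pplus (- alpha)]]) @root_space K alpha).

End Parabolic.
Arguments nilradical : clear implicits.
Arguments levi : clear implicits.

Section Oscillator.
Variable K : fieldType.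
Implicit Types lam mu om : nat -> K.

(* The parity of the sum of a finitely supported integer sequence. *)
Definition int_seq_parity (b : bool) lam : Prop :=
  exists (m : nat -> int) (n : nat),
    [/\ forall i, (n <= i)%N -> m i = 0, forall i, lam i = (m i)%:~R
      & odd `|\sum_(i < n) m i| = b].

Definition root_lattice lam : Prop := int_seq_parity false lam.

Definition IntP lam : set nat := [set i | exists n : nat, lam i = n%:R].
Definition IntN lam : set nat := [set i | exists n : nat, lam i = - n.+1%:R].

Definition sim lam mu : Prop := root_lattice (lam - mu) /\ IntP lam = IntP mu.

(* The space with basis all formal monomials x^lam = << lam >>. It is the direct
   sum of the spaces F_sp(mu), of which V_sp(mu) is a subspace. *)
Definition mons := {malg K[nat -> K]}.
HB.instance Definition _ := GRing.Lmodule.on mons.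
Definition mon lam : mons := << lam >>.

Definition x_ (i : nat) : mons -> mons := lext (fun lam => mon (lam + eps K i)).
Definition d_ (i : nat) : mons -> mons :=
  lext (fun lam => lam i *: mon (lam - eps K i)).

(* The (-,-) block of a symplectic matrix is minus the transpose of its (+,+)
   block and is therefore not counted. The summand 1/2 normalises x_i d_i, as
   required by the bracket of x_i^2 / 2 and - d_i^2 / 2. *)
Definition weyl_elmx (ab : idx * idx) (f : mons) : mons :=
  match ab with
  | (inl i, inl j) => x_ i (d_ j f) + (if i == j then 2^-1 *: f else 0)
  | (inl i, inr j) => 2^-1 *: x_ i (x_ j f)
  | (inr i, inl j) => - (2^-1 *: d_ i (d_ j f))
  | (inr _, inr _) => 0
  end.

Definition weyl (A : finmx K idx) (f : mons) : mons :=
  lext (fun ab => weyl_elmx ab f) A.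

(* The root vectors act by x_i d_j, x_i x_j, x_i^2 / 2, - d_i d_j, - d_i^2 / 2, and
   x^lam has weight lam + (1/2, 1/2, ..). *)
Lemma weyl_subr i j f : i != j ->
  weyl (elmx K (inl i) (inl j) - elmx K (inr j) (inr i)) f = x_ i (d_ j f).
Proof.
by move=> /negPf ij; rewrite /weyl linearB/= !lextU/= ij addr0 subr0.
Qed.

Lemma x_C i j f : x_ i (x_ j f) = x_ j (x_ i f).
Proof.
rewrite /x_; elim/malg_ind: f => [|c f g IHf IHg|lam]; first by rewrite !raddf0.
  by rewrite !linearP/= IHf IHg.
by rewrite !lextU addrAC.
Qed.

Lemma d_C i j f : d_ i (d_ j f) = d_ j (d_ i f).
Proof.
have [->//|ij] := eqVneq i j.
rewrite /d_; elim/malg_ind: f => [|c f g IHf IHg|lam]; first by rewrite !raddf0.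
  by rewrite !linearP/= IHf IHg.
rewrite !lextU !linearZ/= !lextU !scalerA addrAC; congr (_ *: _).
rewrite !fctE /eps (negPf ij) eq_sym (negPf ij) !subr0; exact: mulrC.
Qed.

Lemma weyl_addr i j f : (2 : K) != 0 ->
  weyl (elmx K (inl i) (inr j) + elmx K (inl j) (inr i)) f = x_ i (x_ j f).
Proof.
move=> two; rewrite /weyl raddfD/= !lextU/= (x_C j i) -scalerDl.
by rewrite (_ : _ + _ = 1) ?scale1r//; field.
Qed.

Lemma weyl_long i f : weyl (elmx K (inl i) (inr i)) f = 2^-1 *: x_ i (x_ i f).
Proof. by rewrite /weyl lextU. Qed.

Lemma weyl_oppr i j f : (2 : K) != 0 ->
  weyl (elmx K (inr i) (inl j) + elmx K (inr j) (inl i)) f = - d_ i (d_ j f).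
Proof.
move=> two; rewrite /weyl raddfD/= !lextU/= (d_C j i) -opprD -scalerDl.
by rewrite (_ : _ + _ = 1) ?scale1r//; field.
Qed.

Lemma weyl_opp_long i f :
  weyl (elmx K (inr i) (inl i)) f = - (2^-1 *: d_ i (d_ i f)).
Proof. by rewrite /weyl lextU. Qed.

Lemma weyl_H i lam : weyl (spmx (H K i)) (mon lam) = (lam i + 2^-1) *: mon lam.
Proof.
rewrite /weyl /= /cartan_mx linearB/= !lextU/= eqxx subr0 /d_ lextU /x_ linearZ/=.
by rewrite lextU subrK scalerDl.
Qed.

Definition Vsp mu : {pred mons} :=
  span [set mon lam | lam in
    [set lam | root_lattice (lam - mu) /\ IntP mu `<=` IntP lam]].

Definition Vsp_plus mu : {pred mons} :=
  span [set v | IntN mu <> set0 /\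
    exists mu', [/\ root_lattice (mu - mu'), IntP mu `<` IntP mu'
                  & v \in Vsp mu']].

Lemma int_seq_parity_shift b lam lam' i (e : int) : odd `|e| ->
  (forall k, lam' k = lam k + (k == i)%:R * e%:~R) ->
  int_seq_parity b lam -> int_seq_parity (~~ b) lam'.
Proof.
move=> oe lam'E [m [n [m0 lamE odd_m]]].
exists (fun k => m k + (k == i)%:R * e), (maxn n i.+1); split=> [k|k|].
- rewrite geq_max => /andP[nk ik]; by rewrite m0// (gtn_eqF ik) mul0r.
- by rewrite lam'E lamE rmorphD rmorphM/= mulrz_nat.
- rewrite big_split/=.
  have -> : \sum_(k < maxn n i.+1) m k = \sum_(k < n) m k.
    rewrite -!(big_mkord xpredT m) (big_cat_nat _ (leq_maxl n i.+1))//=.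
    by rewrite [X in _ + X]big_nat_cond [X in _ + X]big1 ?addr0// => k /andP[/andP[/m0]].
  have -> : \sum_(k < maxn n i.+1) ((k : nat) == i)%:R * e = e.
    have im : (i < maxn n i.+1)%N by rewrite leq_max leqnn orbT.
    rewrite (bigD1 (Ordinal im))//= eqxx mul1r big1 ?addr0// => k.
    by rewrite -val_eqE/= => /negPf ->; rewrite mul0r.
  by rewrite -odd_m; lia.
Qed.

(* The spans of the x^lam with Int^+(mu) contained in Int^+(lam) and lam - mu of
   parity b; x_i and d_i exchange them. *)
Definition Vpar mu b : {pred mons} :=
  span [set mon lam | lam in
    [set lam | int_seq_parity b (lam - mu) /\ IntP mu `<=` IntP lam]].

Lemma x_Vpar mu b i f : f \in Vpar mu b -> x_ i f \in Vpar mu (~~ b).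
Proof.
move: f; apply: span_ind => [|c f g fV gV|_ [lam [lamQ lamP] <-]].
- by rewrite /x_ raddf0 rpred0.
- by rewrite /x_ linearP rpredD// rpredZ.
rewrite /x_ lextU; apply: sub_span; exists (lam + eps K i) => //; split.
  by apply: (@int_seq_parity_shift b (lam - mu) _ i 1) lamQ => // k;
    rewrite !fctE mulr1 addrAC.
move=> k /lamP[n lamk]; rewrite /IntP/= !fctE lamk /eps.
by exists (n + (k == i))%N; rewrite natrD.
Qed.

Lemma d_Vpar mu b i f : f \in Vpar mu b -> d_ i f \in Vpar mu (~~ b).
Proof.
move: f; apply: span_ind => [|c f g fV gV|_ [lam [lamQ lamP] <-]].
- by rewrite /d_ raddf0 rpred0.
- by rewrite /d_ linearP rpredD// rpredZ.
rewrite /d_ lextU; have [->|lami] := eqVneq (lam i) 0.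
  by rewrite scale0r rpred0.
apply/rpredZ/sub_span; exists (lam - eps K i) => //; split.
  by apply: (@int_seq_parity_shift b (lam - mu) _ i (-1)) lamQ => // k;
    rewrite !fctE mulrN1 addrAC.
move=> k /lamP[n lamk]; rewrite /IntP/= !fctE lamk /eps.
have [ki|_] := eqVneq k i; last by exists n; rewrite subr0.
case: n lamk => [|n] lamk; first by rewrite -ki lamk eqxx in lami.
by exists n; rewrite -natr1 addrK.
Qed.

Lemma weyl_Vsp mu A f : f \in Vsp mu -> weyl A f \in Vsp mu.
Proof.
rewrite -[Vsp mu]/(Vpar mu false) => fV; rewrite /weyl.
elim/malg_ind: A => [|c A B IHA IHB|[[i|i] [j|j]]].
- by rewrite raddf0 rpred0.
- by rewrite linearP rpredD// rpredZ.
all: rewrite lextU/=.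
- rewrite rpredD ?(x_Vpar (b := true)) ?(d_Vpar (b := false))//.
  by case: eqP => _; rewrite ?rpredZ ?rpred0.
- by rewrite rpredZ ?(x_Vpar (b := true)) ?(x_Vpar (b := false)).
- by rewrite -scaleNr rpredZ ?(d_Vpar (b := true)) ?(d_Vpar (b := false)).
- by rewrite rpred0.
Qed.

Section X.
Variable mu : nat -> K.

HB.instance Definition _ := GRing.SubmodClosed.on (Vsp mu).
HB.instance Definition _ := GRing.SubmodClosed.on (Vsp_plus mu).

Record Vmod : predArgType := VMod { vmon : mons; _ : vmon \in Vsp mu }.
HB.instance Definition _ := [isSub for vmon].
HB.instance Definition _ := [Choice of Vmod by <:].
HB.instance Definition _ := [SubChoice_isSubLmodule of Vmod by <:].

Definition Vmod_act (x : sp K) (v : Vmod) : Vmod :=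
  VMod (weyl_Vsp (spmx x) (valP v)).

Definition Vmod_plus : {pred Vmod} := fun v => val v \in Vsp_plus mu.
Fact Vmod_plus_closed : submod_closed Vmod_plus.
Proof.
have VE v : (v \in Vmod_plus) = (val v \in Vsp_plus mu) by [].
split=> [|c u v]; rewrite !VE; first by rewrite raddf0 rpred0.
by move=> uV vV; rewrite linearP rpredD// rpredZ.
Qed.
HB.instance Definition _ :=
  GRing.isSubmodClosed.Build K Vmod Vmod_plus Vmod_plus_closed.

Definition Xsp := lquot Vmod_plus.
HB.instance Definition _ := GRing.Lmodule.on Xsp.

Definition Xsp_act (x : sp K) : Xsp -> Xsp := quot_map (Vmod_act x).

End X.

End Oscillator.

Section Omega.
Variables (K : fieldType) (prec : int -> int -> Prop).
Implicit Types mu om : nat -> K.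

Definition Rset om : Prop :=
  forall A : set int,
    (below0 prec A -> forall k, A (pos k) -> om k = -1) /\
    (above0 prec A -> forall k, A (pos k) -> om k = 0).

Definition Rset_mu mu om : Prop := Rset om /\ sim om mu.

Definition omega_plus om : Prop :=
  Rset om /\ forall k, cls prec 0 (pos k) -> om k = 0.

Definition omega_minus om : Prop :=
  Rset om /\ forall k, cls prec 0 (pos k) -> om k = -1.

End Omega.

(* Main.v *)
From HB Require Import structures.
From mathcomp Require Import all_boot all_order all_algebra.
From mathcomp Require Import finmap.
From mathcomp.multinomials Require Import monalg.
From mathcomp Require Import boolp classical_sets functions reals.
From mathcomp.real_closed Require Import complex.
From mathcomp Require Import ring zify.
Require Import Defs.

(** A simple weight module [X] over sp(infinity) is aligned for the parabolic
subalgebra p = l + u exactly when some nonzero vector of [X] is killed by u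
([aligned_iff_invariant]). If [X] is a quotient of M_p(S), the image of 1 tensor
S is killed by u, and it is not zero because it generates. Conversely, the space
X^u of all such vectors is a simple l-module, and [X] is the unique simple
quotient of M_p(X^u).

The textbook argument for the converse grades everything by an element of the
Cartan subalgebra that commutes with l and is positive on u. With infinitely many
indices no such element need exist. But the classes met by finitely many indices can
be ranked by integers, which gives Cartan elements [height_elt N] that behave
correctly on all root vectors with indices below N; since a vector involves finitely
many indices, its height makes sense for all large N. If a module is generated by an
l-stable space T killed by u, on which the N-th height is chi_N for large N, then
every vector is the sum of an element of T and of vectors obtained by lowering, of
height chi_N - k with k > 0, and a product of operators height - chi_N + k removes
the lowered part ([lowered_has_top]). Applied to [X], this shows that X^u is simple
([Inv_simple]). Applied to M_p(X^u), it shows that a submodule on which the map to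
[X] does not vanish contains 1 tensor s for some s <> 0, hence is everything
([invariant_aligned]).

The module X_sp(mu) has as basis the classes of the x^lam with lam ~ mu, and their
weights are distinct. Index positions by signed integers, a = i or a = -i, and put
nu_i = lam_i and nu_-i = -1 - lam_i. Then raising lam at the signed index a preserves
Int^+ unless nu_a = -1, and a root vector raises lam at two signed indices. Any two
lam ~ mu are joined by such steps ([basis_connected]), so X_sp(mu) is simple; and a
vector killed by u exists if and only if some x^lam is killed by u, which is the
condition [primitive] that no positive root keeps lam in its class.

It remains to solve this condition ([primitive_cases]). For a below 0 the root 2 eps_a
forces nu_a to be -1 or -2. If nu_a = -1 for all a below 0, then lam lies in R. If
nu_a = -2, the roots eps_a - eps_b force a to be in the highest class below 0, all
other nu_b with b below 0 to be -1, and the class of 0 to be trivial: then lam is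
omega(+) - eps_i or omega(-) + eps_i, according to the sign of a. When the class of
0 contains some k > 0, the sequence omega(+) - eps_i is still allowed in the
statement, because it is equivalent to omega(+) + eps_k, which lies in R
([special_exists]). *)

Set Implicit Arguments.
Unset Strict Implicit.
Unset Printing Implicit Defensive.

Import Order.TTheory GRing.Theory Num.Theory.
Local Open Scope classical_set_scope.
Local Open Scope ring_scope.
Local Open Scope quotient_scope.

(** * Subspaces and quotients *)

Section LinearAlgebra.
Variables (K : fieldType).
Implicit Types (V W : lmodType K).

(** Representations, canonical projections and liftings are plain functions with a
proof of linearity, so the rules of linear algebra are restated for those. *)
Section LinearMap.
Variables (V W : lmodType K) (f : V -> W).
Hypothesis lf : linear f.

Definition linpack : {linear V -> W} :=
  HB.pack f (GRing.isLinear.Build K V W _ f lf).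

Lemma lin_zero : f 0 = 0. Proof. exact: (linear0 linpack). Qed.
Lemma lin_sub u v : f (u - v) = f u - f v. Proof. exact: (linearB linpack). Qed.
Lemma lin_add u v : f (u + v) = f u + f v. Proof. exact: (linearD linpack). Qed.
Lemma lin_scale c u : f (c *: u) = c *: f u. 
Proof. by rewrite -[c *: u]addr0 lf lin_zero addr0. Qed.
Lemma lin_sum (I : Type) (r : seq I) (P : pred I) (F : I -> V) :
  f (\sum_(i <- r | P i) F i) = \sum_(i <- r | P i) f (F i).
Proof. exact: (linear_sum linpack). Qed.

End LinearMap.

(** Used with the linear-combination step of inductions over a module. *)
Lemma regroup_lin V c d (p q p' q' : V) :
  d *: (c *: p + q) + (c *: p' + q') = c *: (d *: p + p') + (d *: q + q').
Proof. by rewrite !scalerDr !scalerA (mulrC d) addrACA. Qed.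

Lemma regroup_scale V c d (p q p' q' : V) :
  c *: (p + d *: q) + (p' + d *: q') = c *: p + p' + d *: (c *: q + q').
Proof. by rewrite !scalerDr !scalerA (mulrC d) addrACA. Qed.

Lemma regroup_sub V c (p q p' q' : V) :
  c *: (p - q) + (p' - q') = c *: p + p' - (c *: q + q').
Proof. by rewrite scalerBr opprD addrACA. Qed.

Lemma lext_param_linear V W (I : choiceType) (F : I -> V -> W) (A : {malg K[I]}) :
  (forall i, linear (F i)) -> linear (fun v => lext (F^~ v) A).
Proof.
move=> lF c u v; rewrite !lextE scaler_sumr -big_split /=; apply: eq_bigr => i _.
by rewrite lF scalerDr !scalerA mulrC.
Qed.

(** Subspaces are boolean predicates with a bundled closure proof; this turns any
property closed under linear combinations into one. *)
Lemma submod_of_prop V (P : V -> Prop) :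
  P 0 -> (forall c u v, P u -> P v -> P (c *: u + v)) ->
  exists N : submodClosed V, forall v, v \in N <-> P v.
Proof.
move=> P0 PD; pose p : {pred V} := fun v => `[< P v >].
have pP x : x \in p <-> P x by split=> /asboolP.
have cP : submod_closed p.
  by split=> [|c x y]; [exact/pP|move=> /pP Px /pP Py; exact/pP/PD].
pose N : submodClosed V := HB.pack p (GRing.isSubmodClosed.Build K V p cP).
by exists N.
Qed.

Lemma submod_lin V (N : submodClosed V) c u v :
  u \in N -> v \in N -> c *: u + v \in N.
Proof. by move=> uN vN; rewrite rpredD// rpredZ. Qed.

Lemma submod_sub V (N : submodClosed V) u v : u \in N -> v \in N -> u - v \in N.
Proof. by move=> uN vN; rewrite -scaleN1r addrC; exact: submod_lin. Qed.

Lemma image_submod V W (f : V -> W) (N : submodClosed V) : linear f ->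
  exists Y : submodClosed W, forall w, w \in Y <-> exists2 v, v \in N & f v = w.
Proof.
move=> lf; apply: submod_of_prop.
  by exists 0; [exact: rpred0|exact: lin_zero].
move=> c _ _ [u uN <-] [v vN <-]; exists (c *: u + v); last exact: lf.
exact: submod_lin.
Qed.

Lemma quot_ind V (N : submodClosed V) (P : lquot N -> Prop) :
  (forall v, P (\pi_(lquot N) v)) -> forall q, P q.
Proof. by move=> h q; rewrite -[q]reprK. Qed.

Lemma lquot_eq0 V (N : submodClosed V) v :
  \pi_(lquot N) v = 0 <-> v \in N.
Proof.
have -> : (0 : lquot N) = \pi_(lquot N) 0.
  by apply: (addrI (\pi_(lquot N) 0)); rewrite addr0 -lquotD addr0.
by split=> [/eqP|v0]; [|apply/eqP]; rewrite lquot_eq subr0.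
Qed.

Lemma lquot_pi_linear V (N : submodClosed V) : linear \pi_(lquot N).
Proof. by move=> c u v; rewrite lquotD; congr (_ + _); exact/esym/lquotZ. Qed.

Lemma lquot_lift V W (N : submodClosed V) (f : V -> W) :
  linear f -> (forall v, v \in N -> f v = 0) ->
  exists g : {linear lquot N -> W}, forall v, g (\pi_(lquot N) v) = f v.
Proof.
move=> lf f0; pose g (q : lquot N) := f (repr q).
have gE v : g (\pi_(lquot N) v) = f v.
  have := f0 _ (lquot_repr N v).
  have -> : f (repr (\pi_(lquot N) v) - v) = g (\pi_(lquot N) v) - f v.
    by rewrite (lin_sub lf).
  by move/eqP; rewrite subr_eq0 => /eqP.
have lg : linear g.
  move=> c; elim/quot_ind=> u; elim/quot_ind=> v.
  by rewrite -lquot_pi_linear !gE lf.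
by exists (linpack lg).
Qed.

Lemma quot_mapE V (N : submodClosed V) (f : V -> V) :
  linear f -> (forall v, v \in N -> f v \in N) ->
  forall v, quot_map f (\pi_(lquot N) v) = \pi_(lquot N) (f v).
Proof.
move=> lf fN v; apply/eqP; rewrite /quot_map; unlock; rewrite lquot_eq.
have -> : f (repr (\pi_(lquot N) v)) - f v = f (repr (\pi_(lquot N) v) - v).
  by rewrite (lin_sub lf).
exact/fN/lquot_repr.
Qed.

(** A subspace as a vector space of its own, to serve as the inducing module. *)
Record subm V (N : submodClosed V) : predArgType :=
  Subm { subm_val : V; _ : subm_val \in N }.
HB.instance Definition _ V (N : submodClosed V) :=
  [isSub of subm N for @subm_val V N].
HB.instance Definition _ V (N : submodClosed V) := [Choice of subm N by <:].
HB.instance Definition _ V (N : submodClosed V) :=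
  [SubChoice_isSubLmodule of subm N by <:].

End LinearAlgebra.

(** * Modules over a Lie algebra and its enveloping algebra *)

Section LieModules.
Variables (K : fieldType) (L : lieAlgType K).

Section Rep.
Variables (a : set L) (V : lmodType K) (act : L -> V -> V).
Hypothesis rep : is_rep a act.

Lemma rep_linear x : a x -> linear (act x). Proof. by case: rep => + _ _; apply. Qed.

Lemma rep_actDl c x y v : a x -> a y -> act (c *: x + y) v = c *: act x v + act y v.
Proof. by case: rep => _ + _; apply. Qed.

Lemma rep_bracket x y v : a x -> a y ->
  act (bracket x y) v = act x (act y v) - act y (act x v).
Proof. by case: rep => _ _; apply. Qed.

End Rep.

Section FullRep.
Variables (V : lmodType K) (act : L -> V -> V).
Hypothesis rep : is_rep setT act.

Lemma act_linear x : linear (act x). Proof. exact: (rep_linear rep). Qed.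

Lemma act_linearl v : linear (act^~ v).
Proof. by move=> c x y; exact: (rep_actDl rep). Qed.

Lemma act_bracket x y v : act (bracket x y) v = act x (act y v) - act y (act x v).
Proof. exact: (rep_bracket rep). Qed.

(** The commutation rule that drives the normal ordering below. *)
Lemma act_swap x y v : act x (act y v) = act y (act x v) + act (bracket x y) v.
Proof. by rewrite act_bracket addrC subrK. Qed.

(** The action of the enveloping algebra, first of the free algebra that it is a
quotient of: a word acts letter by letter. *)
Definition free_act (p : free_alg L) (v : V) : V :=
  lext (fun w : {fmonom L} => foldr act v w) p.

Lemma free_act_linearl v : linear (free_act^~ v).
Proof. by move=> c p q; rewrite /free_act linearP. Qed.

Lemma foldr_act_linear (w : seq L) : linear (fun v => foldr act v w).
Proof. by move=> c u v; elim: w => //= x w ->; rewrite act_linear. Qed.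

Lemma free_act_linear p : linear (free_act p).
Proof. exact: (lext_param_linear p foldr_act_linear). Qed.

Lemma free_act1 v : free_act 1 v = v.
Proof. by rewrite /free_act lextU fm1. Qed.

Lemma malgUU (w1 w2 : {fmonom L}) :
  << w1 >> * << w2 >> = << mmul w1 w2 >> :> {malg K[{fmonom L}]}.
Proof. by rewrite malgM_def fgmulUU mulr1. Qed.

Lemma free_alg_ind (P : free_alg L -> Prop) :
  P 0 -> (forall c (p q : free_alg L), P p -> P q -> P (c *: p + q)) ->
  (forall w : {fmonom L}, P << w >>) -> forall p, P p.
Proof. exact: malg_ind. Qed.

Lemma free_act0l v : free_act 0 v = 0.
Proof. exact: (lin_zero (free_act_linearl v)). Qed.

Lemma free_actDl c (p q : free_alg L) v :
  free_act (c *: p + q) v = c *: free_act p v + free_act q v.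
Proof. exact: free_act_linearl. Qed.

Lemma free_actBl (p q : free_alg L) v :
  free_act (p - q) v = free_act p v - free_act q v.
Proof. exact: (lin_sub (free_act_linearl v)). Qed.

Lemma free_actM p q v : free_act (p * q) v = free_act p (free_act q v).
Proof.
have lD c (p1 p2 p3 : free_alg L) : (c *: p1 + p2) * p3 = c *: (p1 * p3) + p2 * p3.
  by rewrite mulrDl -scalerAl.
have rD c (p1 p2 p3 : free_alg L) : p1 * (c *: p2 + p3) = c *: (p1 * p2) + p1 * p3.
  by rewrite mulrDr -scalerAr.
elim/free_alg_ind: p => [|c p p' IH IH'|w].
- by rewrite mul0r !free_act0l.
- rewrite lD; apply: etrans (free_actDl _ _ _ _) (esym _).
  by apply: etrans (free_actDl _ _ _ _) _; congr (c *: _ + _); exact/esym.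
elim/free_alg_ind: q => [|c q q' IH IH'|w'].
- by rewrite mulr0 !free_act0l (lin_zero (free_act_linear _)).
- rewrite rD; apply: etrans (free_actDl _ _ _ _) _.
  rewrite (free_actDl c q q' v) free_act_linear.
  by congr (c *: _ + _).
by rewrite malgUU /free_act !lextU fmM foldr_cat.
Qed.

Lemma free_act_gen x v : free_act (free_gen x) v = act x v.
Proof. by rewrite /free_act lextU fmU. Qed.

Lemma free_act_rel p v : p \in ideal (@env_rel K L) -> free_act p v = 0.
Proof.
move=> pI; move: p pI v; apply: span_ind => [|c p q IHp IHq|_ [p [r [q [rE ->]]]]] v.
- exact: free_act0l.
- by rewrite free_actDl IHp IHq scaler0 addr0.
rewrite 2!free_actM; set u := free_act q v.
suff -> : free_act r u = 0 by exact: (lin_zero (free_act_linear p)).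
case: rE => [[c [x [y ->]]]|[x [y ->]]].
  by rewrite free_actBl (free_actDl c (free_gen x)) 3!free_act_gen (act_linearl u) subrr.
transitivity (act x (act y u) - act y (act x u) - act (bracket x y) u).
  have genM z t : free_act (free_gen z * free_gen t) u = act z (act t u).
    by rewrite free_actM 2!free_act_gen.
  apply: etrans (free_actBl _ _ _) _; congr (_ - _); last exact: free_act_gen.
  by apply: etrans (free_actBl _ _ _) _; congr (_ - _).
by rewrite act_bracket subrr.
Qed.

Definition env_act (p : U L) (v : V) : V := free_act (repr p) v.

Lemma env_actE p v : env_act (\pi_(U L) p) v = free_act p v.
Proof.
apply/eqP; rewrite -subr_eq0 -free_actBl.
by apply/eqP/free_act_rel/lquot_repr.
Qed.

Lemma env_act_linearl v : linear (env_act^~ v).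
Proof.
move=> c p q; rewrite -[p]reprK -[q]reprK.
rewrite -(@lquot_pi_linear K (free_alg L) (ideal (@env_rel K L))) !env_actE.
exact: free_actDl.
Qed.

Lemma env_act_linear p : linear (env_act p).
Proof. exact: free_act_linear. Qed.

Lemma env_act1 v : env_act 1 v = v.
Proof. by rewrite env_actE free_act1. Qed.

Lemma env_actM p q v : env_act (p * q) v = env_act p (env_act q v).
Proof.
rewrite -[p]reprK -[q]reprK.
by rewrite [_ * _](@pi_mul K _ (@env_rel K L)) !env_actE free_actM.
Qed.

Lemma env_act_iota x v : env_act (iota x) v = act x v.
Proof. by rewrite env_actE free_act_gen. Qed.

End FullRep.

Lemma ideal_gen (T : algType K) (A : set T) a : A a -> a \in ideal A.
Proof.
move=> Aa; apply: sub_span.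
by exists 1, a, 1; rewrite mul1r mulr1.
Qed.

Lemma iota_linear : linear (@iota K L).
Proof.
move=> c x y; rewrite -(@lquot_pi_linear K (free_alg L) (ideal (@env_rel K L))).
apply/eqP; rewrite lquot_eq; apply: (@ideal_gen (free_alg L) (@env_rel K L)).
by left; exists c, x, y.
Qed.

Lemma iota_bracket x y :
  iota (bracket x y) = iota x * iota y - iota y * iota x :> U L.
Proof.
rewrite ![iota _ * iota _](@pi_mul K _ (@env_rel K L)).
rewrite -(lin_sub (@lquot_pi_linear K (free_alg L) (ideal (@env_rel K L)))).
apply/eqP; rewrite eq_sym lquot_eq; apply: (@ideal_gen (free_alg L) (@env_rel K L)).
by right; exists x, y.
Qed.

Lemma env_pi_linear : linear \pi_(U L).
Proof. exact: (@lquot_pi_linear K (free_alg L) (ideal (@env_rel K L))). Qed.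

Lemma env_piM p q : \pi_(U L) p * \pi_(U L) q = \pi_(U L) (p * q).
Proof. exact: (@pi_mul K _ (@env_rel K L)). Qed.

Lemma env_mulZr c (p q : U L) : p * (c *: q) = c *: (p * q).
Proof.
rewrite -[p]reprK -[q]reprK -(lin_scale env_pi_linear) !env_piM -(lin_scale env_pi_linear).
by congr (\pi_(U L) _); rewrite -scalerAr.
Qed.

Lemma env_mulZl c (p q : U L) : (c *: p) * q = c *: (p * q).
Proof.
rewrite -[p]reprK -[q]reprK -(lin_scale env_pi_linear) !env_piM -(lin_scale env_pi_linear).
by congr (\pi_(U L) _); rewrite -scalerAl.
Qed.

(** The universal enveloping algebra is generated by the Lie algebra, because it is
a quotient of the free algebra on it. *)
Lemma env_ind (P : U L -> Prop) :
  P 0 -> (forall c p q, P p -> P q -> P (c *: p + q)) -> P 1 ->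
  (forall x p, P p -> P (iota x * p)) -> forall p, P p.
Proof.
move=> P0 PD P1 PM p; rewrite -[p]reprK.
elim/free_alg_ind: (repr p) => [|c q r Pq Pr|w].
- by rewrite (lin_zero (@lquot_pi_linear K (free_alg L) (ideal (@env_rel K L)))).
- by rewrite (@lquot_pi_linear K (free_alg L) (ideal (@env_rel K L))); exact: PD.
case: w => s; elim: s => [|x s IH].
  suff <- : \pi_(U L) 1 = \pi_(U L) << FMonom [::] >> by [].
  by congr (\pi_(U L) << _ >>); rewrite -fmoneE.
suff -> : << FMonom (x :: s) >> = free_gen x * << FMonom s >> :> free_alg L.
  by rewrite -(@pi_mul K _ (@env_rel K L)); exact: PM.
by rewrite malgUU; congr << _ >>; rewrite [RHS]fmmulE fmuE.
Qed.

(** * Induced modules *)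

Section InducedModule.
Variables (l u : set L) (S : lmodType K) (act : L -> S -> S).

Local Notation M := (induced l u act).
Local Notation iact := (@induced_act K L l u S act).

Definition tens (a : U L) (s : S) : M := \pi_M << (a, s) >>.

Lemma tens_rel t : induced_rel l u act t -> \pi_M t = 0.
Proof. by move=> tR; apply/lquot_eq0; apply: sub_span. Qed.

Lemma induced_pi_linear : linear \pi_M.
Proof. exact: (@lquot_pi_linear K _ (span (induced_rel l u act))). Qed.

Lemma tens_linearl s : linear (tens^~ s).
Proof.
move=> c a b; apply/eqP; rewrite /tens -induced_pi_linear -subr_eq0.
rewrite -(lin_sub induced_pi_linear); apply/eqP/tens_rel.
by constructor 1; exists c, a, b, s.
Qed.

Lemma tens_linearr a : linear (tens a).
Proof.
move=> c s s'; apply/eqP; rewrite /tens -induced_pi_linear -subr_eq0.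
rewrite -(lin_sub induced_pi_linear); apply/eqP/tens_rel.
by constructor 2; exists c, a, s, s'.
Qed.

Lemma tens_balanced a x y s : l x -> u y ->
  tens (a * iota (x + y)) s = tens a (act x s).
Proof.
move=> lx uy; apply/eqP; rewrite /tens -subr_eq0.
rewrite -(lin_sub induced_pi_linear); apply/eqP/tens_rel.
by constructor 3; exists a, x, y, s.
Qed.

Lemma induced_ind (P : M -> Prop) :
  P 0 -> (forall c m n, P m -> P n -> P (c *: m + n)) ->
  (forall a s, P (tens a s)) -> forall m, P m.
Proof.
move=> P0 PD PT m; rewrite -[m]reprK.
elim/malg_ind: (repr m) => [|c q r Pq Pr|[a s]]; last exact: PT.
- by rewrite (lin_zero induced_pi_linear).
- by rewrite induced_pi_linear; exact: PD.
Qed.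

Local Notation mul_act x := (lext (fun t : U L * S =>
  << (iota x * t.1, t.2) >> : {malg K[(U L * S)%type]})).

Lemma mul_act_rel x v : v \in span (induced_rel l u act) ->
  mul_act x v \in span (induced_rel l u act).
Proof.
move: v; apply: span_ind => [|c v w vN wN|v vR].
- by rewrite raddf0 rpred0.
- by rewrite lext_is_linear; exact: (span_submod_closed _).2.
(* Only linearity and the values on basis elements are used of the extension. *)
have [F [lF FE FU]] : exists F, [/\ linear F, F = mul_act x
    & forall a s, F << (a, s) >> = << (iota x * a, s) >> ].
  by exists (mul_act x); split=> [||a s]; [exact: lext_is_linear| |rewrite lextU].
have FB c p q r p' q' r' : F p = p' -> F q = q' -> F r = r' ->
    F (p - (c *: q + r)) = p' - (c *: q' + r').
  by move=> <- <- <-; rewrite (lin_sub lF) lF.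
rewrite -FE; case: vR => [[c [a [b [s ->]]]]|[c [a [s [s' ->]]]]|].
- apply: sub_span; constructor 1; exists c, (iota x * a), (iota x * b), s.
  apply: etrans (FB _ _ _ _ _ _ _ (FU _ _) (FU _ _) (FU _ _)) _.
  have -> : iota x * (c *: a + b) = c *: (iota x * a) + iota x * b.
    by rewrite mulrDr env_mulZr.
  by [].
- apply: sub_span; constructor 2; exists c, (iota x * a), s, s'.
  exact: FB (FU _ _) (FU _ _) (FU _ _).
- move=> [a [y [z [s [ly uz ->]]]]]; apply: sub_span; constructor 3.
  exists (iota x * a), y, z, s; split=> //.
  rewrite (lin_sub lF) -mulrA.
  exact: (congr2 (fun p q => p - q) (FU _ _) (FU _ _)).
Qed.

Lemma induced_actE x a s :
  iact x (tens a s) = tens (iota x * a) s.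
Proof.
rewrite /induced_act /tens.
rewrite (@quot_mapE K _ (span (induced_rel l u act)) _ (lext_is_linear _)).
  by rewrite lextU.
exact: mul_act_rel.
Qed.

Lemma induced_act_linear x : linear (iact x).
Proof.
move=> c; elim/quot_ind => v; elim/quot_ind => w.
rewrite /induced_act -(@lquot_pi_linear K _ (span (induced_rel l u act))).
rewrite 3?(@quot_mapE K _ (span (induced_rel l u act)) _ (lext_is_linear _)).
- by rewrite lext_is_linear lquot_pi_linear.
all: exact: mul_act_rel.
Qed.

Lemma induced_is_rep : is_rep setT iact.
Proof.
split=> [x _|c x y v _ _|x y v _ _].
- exact: induced_act_linear.
- move: v; apply: induced_ind => [|d m n IHm IHn|a s].
  + by rewrite !(lin_zero (induced_act_linear _)) scaler0 addr0.
  + rewrite (induced_act_linear _ d) IHm IHn.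
    rewrite [iact x (d *: m + n)]induced_act_linear [iact y (d *: m + n)]induced_act_linear.
    exact: regroup_lin.
  + rewrite !induced_actE -tens_linearl; congr (tens _ s).
    by rewrite iota_linear mulrDl env_mulZl.
- move: v; apply: induced_ind => [|d m n IHm IHn|a s].
  + by rewrite !(lin_zero (induced_act_linear _)) subr0.
  + rewrite !(induced_act_linear _ d) IHm IHn; exact: regroup_sub.
  + have E z t : iact z (iact t (tens a s)) = tens (iota z * (iota t * a)) s.
      by apply: etrans (induced_actE _ _ _); congr (iact z _); exact: induced_actE.
    transitivity (tens (iota x * (iota y * a)) s - tens (iota y * (iota x * a)) s).
      rewrite -(lin_sub (tens_linearl s)); apply: etrans (induced_actE _ _ _) _.
      by congr (tens _ s); rewrite iota_bracket mulrBl !mulrA.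
    by congr (_ - _); exact/esym/E.
Qed.

(** This is what makes the image of S nonzero in every nonzero quotient. *)
Lemma induced_gen (N : submodClosed M) :
  submodule setT iact N -> (forall s, tens 1 s \in N) ->
  forall m, m \in N.
Proof.
move=> Nsub N1; apply: induced_ind => [|c m n mN nN|a s].
- exact: rpred0.
- by rewrite rpredD// rpredZ.
elim/env_ind: a => [|c a b aN bN||x a aN].
- by rewrite (lin_zero (tens_linearl s)) rpred0.
- have -> : tens (c *: a + b) s = c *: tens a s + tens b s by exact: tens_linearl.
  exact: submod_lin aN bN.
- exact: N1.
- rewrite -(induced_actE x a s); exact: Nsub.
Qed.

(** Frobenius reciprocity: it suffices that f intertwines l and that u kills its
image, since l + u generates the enveloping algebra over which one tensors. *)
Lemma induced_univ (X : lmodType K) (actX : L -> X -> X) (f : S -> X) :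
  is_rep setT actX -> linear f ->
  (forall x s, l x -> f (act x s) = actX x (f s)) ->
  (forall y s, u y -> actX y (f s) = 0) ->
  exists phi : {linear M -> X},
    (forall x m, phi (iact x m) = actX x (phi m)) /\ (forall s, phi (tens 1 s) = f s).
Proof.
move=> rep lf fl fu.
have [g [lg gE]] : exists g : {malg K[(U L * S)%type]} -> X,
    linear g /\ forall a s, g << (a, s) >> = env_act actX a (f s).
  exists (lext (fun t : U L * S => env_act actX t.1 (f t.2))).
  by split=> [|a s]; [exact: lext_is_linear|rewrite lextU].
have g0 v : v \in span (induced_rel l u act) -> g v = 0.
  move: v; apply: span_ind => [|c v w gv gw|v vR]; first by rewrite (lin_zero lg).
    by rewrite lg gv gw scaler0 addr0.
  have gB c p q r p' q' r' : g p = p' -> g q = q' -> g r = r' ->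
      p' = c *: q' + r' -> g (p - (c *: q + r)) = 0.
    by move=> <- <- <- E; rewrite (lin_sub lg) lg E subrr.
  have gB1 p q : g p = g q -> g (p - q) = 0.
    by move=> E; rewrite (lin_sub lg) E subrr.
  case: vR => [[c [a [b [s ->]]]]|[c [a [s [s' ->]]]]|[a [x [y [s [lx uy ->]]]]]].
  - by apply: gB (gE _ _) (gE _ _) (gE _ _) _; exact: env_act_linearl.
  - apply: gB (gE _ _) (gE _ _) (gE _ _) _.
    by rewrite lf (env_act_linear rep a).
  - apply/gB1/(etrans (gE _ _))/esym/(etrans (gE _ _)).
    rewrite (env_actM rep) (env_act_iota rep) fl//; congr (env_act actX a _).
    have -> : actX (x + y) (f s) = actX x (f s) + actX y (f s).
      exact: (lin_add (act_linearl rep (f s))).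
    by rewrite (fu y)// addr0.
have [phi phiE] := lquot_lift lg g0.
have phiT a s : phi (tens a s) = env_act actX a (f s) by rewrite phiE.
exists phi; split=> [x|s]; last by rewrite phiT (env_act1 rep).
apply: induced_ind => [|c m n IHm IHn|a s].
- by rewrite (lin_zero (induced_act_linear x)) !linear0 (lin_zero (act_linear rep x)).
- by rewrite induced_act_linear !linearP IHm IHn (act_linear rep).
- apply: etrans (congr1 phi (induced_actE x a s)) _; apply: etrans (phiT _ _) _.
  by rewrite (env_actM rep) (env_act_iota rep); congr (actX x _); exact/esym/phiT.
Qed.

End InducedModule.

End LieModules.

(** * Admissible orders on the signed indices *)

Section Orders.
Variable prec : int -> int -> Prop.
Hypothesis prec_order : strict_order prec.
Hypothesis prec_admissible : admissible prec.
Hypothesis prec_Z2 : Z2_linear prec.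

Lemma prec_irr i : ~ prec i i. Proof. by case: prec_order => + _; apply. Qed.

Lemma prec_trans i j k : prec i j -> prec j k -> prec i k.
Proof. by case: prec_order => _; apply. Qed.

Lemma prec_asym i j : prec i j -> ~ prec j i.
Proof. by move=> ij /(prec_trans ij); exact: prec_irr. Qed.

Lemma cls_refl i : cls prec i i. Proof. by left. Qed.

Lemma clsP i j : cls prec i j <-> ~ prec i j /\ ~ prec j i.
Proof.
split=> [[->|/not_orP//]|/not_orP]; last by right.
by split; exact: prec_irr.
Qed.

(** Admissibility enters only here: incomparability is an equivalence. *)
Lemma cls_eq i j : cls prec i j -> cls prec j = cls prec i.
Proof.
move=> ij; apply: contrapT => ne.
have : (cls prec j `&` cls prec i) j by split; [exact: cls_refl|].
by rewrite prec_admissible.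
Qed.

Lemma cls_sym i j : cls prec i j -> cls prec j i.
Proof. by move=> /cls_eq ->; exact: cls_refl. Qed.

Lemma cls_precl i j k : cls prec i j -> prec i k -> prec j k.
Proof.
move=> ij ik; apply: contrapT => jk; have [ij1 ij2] := (clsP i j).1 ij.
have kj : ~ prec k j by move=> /(prec_trans ik).
have : cls prec j k by apply/clsP.
by rewrite (cls_eq ij) => /clsP[].
Qed.

Lemma cls_precr i j k : cls prec i j -> prec k i -> prec k j.
Proof.
move=> ij ki; apply: contrapT => kj; have [ij1 ij2] := (clsP i j).1 ij.
have jk : ~ prec j k by move=> jk; apply/ij2/(prec_trans jk).
have : cls prec j k by apply/clsP.
by rewrite (cls_eq ij) => /clsP[].
Qed.

Lemma prec_opp0 i : prec i 0 -> prec 0 (- i).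
Proof. by move=> /prec_Z2; rewrite oppr0. Qed.

Lemma cls_opp i j : cls prec i j -> cls prec (- i) (- j).
Proof.
by move=> /clsP[ij ji]; apply/clsP; split=> /prec_Z2; rewrite !opprK.
Qed.

(** So the long roots fit into the pattern of the short ones: in both cases the root
eps_a - eps_b lies in P^+ when a precedes b, with eps_-i = - eps_i. *)
Lemma prec_opp_self i : prec i (- i) <-> prec i 0.
Proof.
split=> [ii|i0]; last by apply: (prec_trans i0); exact: prec_opp0.
apply: contrapT => i0.
have [i0'|i0'] := pselect (prec 0 i).
  have := prec_Z2 i0'; rewrite oppr0 => /(prec_trans ii) //.
have c0 : cls prec 0 i by apply/clsP.
have : cls prec i (- i) by rewrite (cls_eq c0) -oppr0; exact: cls_opp.
by move=> /clsP[].
Qed.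

Definition signed (a : idx) : int :=
  match a with inl i => pos i | inr i => - pos i end.

Lemma signed_opp a : signed (opp a) = - signed a.
Proof. by case: a => i //=; rewrite opprK. Qed.

Lemma oppK : involutive opp. Proof. by case. Qed.

Definition below (a b : idx) : Prop := prec (signed a) (signed b).

Lemma below_irr a : ~ below a a. Proof. exact: prec_irr. Qed.

Lemma below_trans b a c : below a b -> below b c -> below a c.
Proof. exact: prec_trans. Qed.

Lemma below_opp a b : below a b -> below (opp b) (opp a).
Proof. by rewrite /below !signed_opp; exact: prec_Z2. Qed.

Definition level (a b : idx) : Prop := ~ below a b /\ ~ below b a.

Lemma level_cls a b : level a b <-> cls prec (signed a) (signed b).
Proof. by rewrite clsP. Qed.

Lemma level_sym a b : level a b -> level b a. Proof. by case. Qed.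

Lemma level_refl a : level a a. Proof. by split; exact: below_irr. Qed.

Lemma level_belowl a b c : level a b -> below a c -> below b c.
Proof. by move=> /level_cls; exact: cls_precl. Qed.

Lemma level_belowr a b c : level a b -> below c a -> below c b.
Proof. by move=> /level_cls; exact: cls_precr. Qed.

Definition supp_idx (a : idx) : nat := match a with inl i => i | inr i => i end.

Lemma supp_idx_neq a b : a <> b -> a <> opp b -> supp_idx a <> supp_idx b.
Proof.
by case: a b => i [] j /= h1 h2 E; first [by apply: h1; rewrite E|by apply: h2; rewrite E].
Qed.

Definition cmp (a c : idx) : int := `[< below a c >]%:Z - `[< below c a >]%:Z.
(** The rank is constant on classes, changes sign with the index, and is strictly
monotone in the order on the indices below [N]. A function with these properties
for all indices at once need not exist with integer values. *)
Definition rank (N : nat) (a : idx) : int :=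
  \sum_(i < N) (cmp a (inl (i : nat)) + cmp a (inr (i : nat))).

Lemma cmp_opp a c : cmp (opp a) c = - cmp a (opp c).
Proof.
rewrite /cmp opprB; congr ((nat_of_bool _)%:Z - (nat_of_bool _)%:Z); apply: asbool_equiv_eq; split=> /below_opp;
  by rewrite ?oppK.
Qed.

Lemma rank_opp N a : rank N (opp a) = - rank N a.
Proof.
rewrite /rank -sumrN; apply: eq_bigr => i _.
by rewrite !cmp_opp /= [RHS]opprD addrC.
Qed.

Lemma rank_level N a b : level a b -> rank N a = rank N b.
Proof.
move=> ab; have ba := level_sym ab.
have E c : cmp a c = cmp b c.
  by congr ((nat_of_bool _)%:Z - (nat_of_bool _)%:Z); apply: asbool_equiv_eq; split;
   by [apply: level_belowl|apply: level_belowr].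
by apply: eq_bigr => i _; rewrite !E.
Qed.

Lemma rank_below N a b : (supp_idx a < N)%N -> below a b -> (rank N b < rank N a)%R.
Proof.
move=> aN ab.
have le c : (cmp b c <= cmp a c)%R.
  have h1 : (`[< below b c >] <= `[< below a c >])%N.
    by case: asboolP => // bc; rewrite (asboolT (below_trans ab bc)).
  have h2 : (`[< below c a >] <= `[< below c b >])%N.
    by case: asboolP => // ca; rewrite (asboolT (below_trans ca ab)).
  by rewrite /cmp; lia.
have lt : (cmp b a < cmp a a)%R.
  rewrite /cmp (asboolF (@below_irr a)) (asboolT ab) asboolF//.
  by move=> /(below_trans ab); exact: below_irr.
rewrite /rank (bigD1 (Ordinal aN))//= [ltRHS](bigD1 (Ordinal aN))//=.
apply: ltr_leD; last by apply: ler_sum => i _; rewrite lerD.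
by case: a aN ab lt le => i aN ab lt le /=; [rewrite ltr_leD|rewrite ler_ltD].
Qed.

(** Classes are linearly ordered, so the rank also determines the order. *)
Lemma rank_inj_below N a b : (supp_idx a < N)%N -> (supp_idx b < N)%N ->
  (rank N b < rank N a)%R -> below a b.
Proof.
move=> aN bN rlt; apply: contrapT => nab.
have [ba|nba] := pselect (below b a).
  by have := rank_below bN ba; lia.
by have := @rank_level N a b (conj nab nba); lia.
Qed.

End Orders.

(** * Root vectors of the symplectic Lie algebra *)

Section RootVectors.
Variables (K : fieldType).
Hypothesis char0 : [pchar K] =i pred0.

Local Notation sp := (sp K).
Local Notation eps := (eps K).
Local Notation sgn := (sgn K).

Lemma two_neq0 : (2 : K) != 0.
Proof. by have -> := (pcharf0P K).1 char0 2. Qed.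

Lemma intr_inj0 (m : int) : m%:~R = 0 :> K -> m = 0.
Proof.
case: m => n /eqP.
  by rewrite -pmulrn ((pcharf0P K).1 char0) => /eqP ->.
by rewrite NegzE mulrNz oppr_eq0 -pmulrn ((pcharf0P K).1 char0).
Qed.

Lemma intr_inj (m n : int) : m%:~R = n%:~R :> K -> m = n.
Proof.
move=> /eqP; rewrite -subr_eq0 -rmorphB => /eqP /intr_inj0 /eqP.
by rewrite subr_eq0 => /eqP.
Qed.

(** The weight of the basis vector of the natural module with index a. *)
Definition seps (a : idx) : nat -> K :=
  match a with inl i => eps i | inr i => - eps i end.

Lemma seps_opp a : seps (opp a) = - seps a.
Proof. by case: a => i //=; rewrite opprK. Qed.

Lemma sgn_sq a : sgn a * sgn a = 1.
Proof. by case: a => i /=; rewrite ?mulrNN mul1r. Qed.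

Lemma sgn_opp a : sgn (opp a) = - sgn a.
Proof. by case: a => i /=; rewrite ?opprK. Qed.

(** The antisymmetrization of E_ab under the involution [star] below; it spans the
root space of seps a - seps b when a <> b, and the matrices for (a, b) and
(opp b, opp a) agree up to sign. *)
Definition root_mx (a b : idx) : finmx K idx :=
  elmx K a b - (sgn a * sgn b) *: elmx K (opp b) (opp a).

Fact root_mx_sp a b : root_mx a b \in @symplectic K.
Proof.
have E1 z : (a == opp z) = (z == opp a) by apply/eqP/eqP => ->; rewrite oppK.
have E2 z : (opp b == opp z) = (z == b).
  by rewrite (inj_eq (inv_inj oppK)) eq_sym.
have E3 z : (b == z) = (z == b) by exact: eq_sym.
have E4 z : (opp a == z) = (z == opp a) by exact: eq_sym.
apply/asboolP => x y; rewrite /root_mx !mcoeffB !mcoeffZ !mcoeffU !xpair_eqE.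
rewrite !E1 !E2 !E3 !E4.
have S z c (P : bool) : sgn z * (1 *+ ((z == c) && P)) = sgn c * (1 *+ ((z == c) && P)).
  by case: eqVneq => [->|]; rewrite // !mulr0.
rewrite !mulrBr !(mulrCA _ (sgn a * sgn b)) !S !sgn_opp [(y == b) && _]andbC
  [(y == opp a) && _]andbC.
set T := _ *+ _; set T' := _ *+ _.
have := sgn_sq a; have := sgn_sq b.
move: T T' (sgn a) (sgn b) => T T' sa sb sb2 sa2.
have -> : sa * sb * (sb * T) = sa * T by rewrite -mulrA (mulrA sb) sb2 mul1r.
have -> : sa * sb * (sb * T') = sa * T' by rewrite -mulrA (mulrA sb) sb2 mul1r.
ring.
Qed.


Definition root_vec (a b : idx) : sp := Sp (root_mx_sp a b).

(** The involution A |-> J^-1 A^T J, of which sp is the (-1)-eigenspace. *)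
Definition star (A : finmx K idx) : finmx K idx :=
  lext (fun x : idx * idx => (sgn x.1 * sgn x.2) *: elmx K (opp x.2) (opp x.1)) A.

Lemma starE A a b : (star A)@_(a, b) = sgn a * sgn b * A@_(opp b, opp a).
Proof.
have inv_opp := inv_eq oppK.
rewrite /star; elim/malg_ind: A => [|c C C' IH IH'|[x y]].
- by rewrite raddf0 !mcoeff0 mulr0.
- by rewrite lext_is_linear !(mcoeffD, mcoeffZ) IH IH'; ring.
- rewrite lextU/= mcoeffZ !mcoeffU !xpair_eqE !inv_opp andbC.
  by case: eqP => [->|_]; case: eqP => [->|_]; rewrite ?mulr0// !sgn_opp; ring.
Qed.

Lemma symplecticE (z : sp) a b :
  (spmx z)@_(opp b, opp a) = - (sgn a * sgn b) * (spmx z)@_(a, b).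
Proof.
have /asboolP/(_ b (opp a)) := valP z; rewrite oppK sgn_opp => E.
by rewrite -[LHS]mul1r -(sgn_sq b) -mulrA E; ring.
Qed.

(** The factor 1/2 is there because each root vector occurs twice. *)
Lemma root_decomp (z : sp) :
  z = \sum_(x <- msupp (spmx z)) (2^-1 * (spmx z)@_x) *: root_vec x.1 x.2.
Proof.
apply: val_inj; rewrite raddf_sum/=.
transitivity (2^-1 *: (spmx z - star (spmx z))).
  apply/malgP => -[a b]; rewrite mcoeffZ mcoeffB starE symplecticE.
  set y := (spmx z)@_(a, b).
  have -> : sgn a * sgn b * (- (sgn a * sgn b) * y) = - y.
    by rewrite mulrA mulrN mulrACA !sgn_sq mulr1 mulN1r.
  by rewrite opprK; field; exact: two_neq0.
rewrite /star lextE [X in X - _]monalgE -sumrB scaler_sumr.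
apply: eq_bigr => -[a b] _ /=; rewrite -[RHS]scalerA; congr (_ *: _).
rewrite /root_mx scalerBr; congr (_ - _).
by apply/malgP => k; rewrite mcoeffZ !mcoeffU mulr_natr.
Qed.

Lemma sp_ind_supp (P : sp -> Prop) (z : sp) :
  P 0 -> (forall c x y, P x -> P y -> P (c *: x + y)) ->
  (forall a b, (spmx z)@_(a, b) != 0 -> P (root_vec a b)) -> P z.
Proof.
move=> P0 PD PR; rewrite (root_decomp z) big_seq.
elim/big_rec: _ => // -[a b] y; rewrite -mcoeff_neq0 => ab Py.
by apply: PD => //; exact: PR.
Qed.

Lemma commfmx_H i (B : finmx K idx) a b :
  (commfmx (cartan_mx K i) B)@_(a, b) = (seps a i - seps b i) * B@_(a, b).
Proof.
elim/malg_ind: B => [|c B B' IH IH'|[x y]].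
- by rewrite (lin_zero (commfmx_linearr _)) !mcoeff0 mulr0.
- rewrite commfmx_linearr [LHS]mcoeffD [X in X + _]mcoeffZ IH IH'.
  by rewrite (mcoeffD _ (c *: B)) (mcoeffZ c B); ring.
have -> : commfmx (cartan_mx K i) << (x, y) >> =
    (seps x i - seps y i) *: elmx K x y.
  rewrite -/(elmx K x y) /commfmx /cartan_mx.
  rewrite (lin_sub (mulfmx_linearl _)) (lin_sub (mulfmx_linearr _)) !mul_elmx.
  have LL (j k : nat) : (inl j == inl k :> idx) = (j == k) by [].
  have RR (j k : nat) : (inr j == inr k :> idx) = (j == k) by [].
  have LR (j k : nat) : (inl j == inr k :> idx) = false by [].
  have RL (j k : nat) : (inr j == inl k :> idx) = false by [].
  have EL : (if inl i == x then elmx K (inl i) y else 0)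
      - (if inr i == x then elmx K (inr i) y else 0) = seps x i *: elmx K x y.
    case: x => k; rewrite !(LL, RR, LR, RL) ?subr0 ?sub0r /= ?fctE /eps;
      by case: eqVneq => [->|]; rewrite ?scaleN1r ?scale1r ?oppr0 ?scale0r.
  have ER : (if y == inl i then elmx K x (inl i) else 0)
      - (if y == inr i then elmx K x (inr i) else 0) = seps y i *: elmx K x y.
    case: y {EL} => k; rewrite !(LL, RR, LR, RL) ?subr0 ?sub0r /= ?fctE /eps eq_sym;
      by case: eqVneq => [->|]; rewrite ?scaleN1r ?scale1r ?oppr0 ?scale0r.
  by rewrite EL ER scalerBl.
rewrite mcoeffZ mcoeffU xpair_eqE; case: eqP => [->|_]; last by rewrite !mulr0.
by case: eqP => [->|_]; rewrite ?mulr0.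
Qed.

Lemma root_vecP a b : root_space (seps a - seps b) (root_vec a b).
Proof.
move=> i; apply: val_inj; rewrite linearZ/=; apply/malgP => -[x y].
rewrite commfmx_H mcoeffZ /root_mx mcoeffB mcoeffZ !mcoeffU !xpair_eqE.
rewrite !mulrBr; congr (_ - _).
  by case: eqP => [->|_]; case: eqP => [->|_]; rewrite ?mulr0.
rewrite !(mulrCA _ (sgn a * sgn b)); congr (_ * _).
case: eqP => [<-|_]; case: eqP => [<-|_]; rewrite ?mulr0// !seps_opp !fctE.
by rewrite opprK addrC.
Qed.

Lemma root_spaceP alpha (z : sp) a b : root_space alpha z ->
  (spmx z)@_(a, b) != 0 -> alpha = seps a - seps b.
Proof.
move=> za ab; apply/funext => i; have := congr1 val (za i); rewrite linearZ/=.
move=> /(congr1 (fun B : finmx K idx => B@_(a, b))); rewrite commfmx_H mcoeffZ.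
by move=> /(mulIf ab) <-.
Qed.

Lemma mulfmx_supp (A B : finmx K idx) a b : (mulfmx A B)@_(a, b) != 0 ->
  exists c, A@_(a, c) != 0 /\ B@_(c, b) != 0.
Proof.
move=> AB; apply: contrapT => no; move: AB; rewrite unlock lextE raddf_sum/=.
rewrite big1 ?eqxx// => -[x y] _; rewrite mcoeffZ lextE raddf_sum/=.
apply/eqP; rewrite mulf_eq0; apply/orP.
have [|nA] := boolP (A@_(x, y) == 0); [by left|right].
apply/eqP/big1 => -[x' y'] _; rewrite mcoeffZ/=.
case: eqP => [yx|_]; last by rewrite mcoeff0 mulr0.
rewrite mcoeffU xpair_eqE; case: eqP => [xa|_]; last by rewrite mulr0.
case: eqP => [yb|_]; last by rewrite mulr0.
rewrite mulr1; apply: contrapT => /eqP nB; apply: no.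
by exists y; rewrite -xa -yb yx; split=> //; rewrite -yx.
Qed.

(** With this, closure properties of l and u reduce to transitivity of the order on
indices. *)
Lemma bracket_supp (z t : sp) a b : (spmx (bracket z t))@_(a, b) != 0 ->
  exists c, (spmx z)@_(a, c) != 0 /\ (spmx t)@_(c, b) != 0 \/
            (spmx t)@_(a, c) != 0 /\ (spmx z)@_(c, b) != 0.
Proof.
rewrite /= /commfmx mcoeffB => h.
have [z0|/mulfmx_supp[c h1]] := eqVneq (mulfmx (spmx z) (spmx t))@_(a, b) 0.
  move: h; rewrite z0 sub0r oppr_eq0 => /mulfmx_supp[c h1].
  by exists c; right.
by exists c; left.
Qed.

End RootVectors.

(** * Root spaces of the parabolic subalgebra *)

Section Parabolic.
Variables (K : fieldType) (prec : int -> int -> Prop).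
Hypothesis char0 : [pchar K] =i pred0.
Hypothesis prec_order : strict_order prec.
Hypothesis prec_admissible : admissible prec.
Hypothesis prec_Z2 : Z2_linear prec.

Local Notation sp := (sp K).
Local Notation eps := (eps K).
Local Notation seps := (seps K).
Local Notation below := (below prec).
Local Notation level := (level prec).
Local Notation rank := (rank prec).

(** The pairing of a weight with [height_elt N]. *)
Definition rdot N (lam : nat -> K) : K :=
  \sum_(i < N) (rank N (inl (i : nat)))%:~R * lam i.

Definition height_elt N : sp :=
  \sum_(i < N) (rank N (inl (i : nat)))%:~R *: H K i.

Lemma rdotB N lam mu : rdot N (lam - mu) = rdot N lam - rdot N mu.
Proof.
by rewrite /rdot -sumrB; apply: eq_bigr => i _; rewrite !fctE mulrBr.
Qed.

Lemma rdotN N lam : rdot N (- lam) = - rdot N lam.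
Proof. by rewrite /rdot -sumrN; apply: eq_bigr => i _; rewrite fctE mulrN. Qed.

Lemma rdot_seps N a : (supp_idx a < N)%N -> rdot N (seps a) = (rank N a)%:~R.
Proof.
have L k : (k < N)%N -> rdot N (eps k) = (rank N (inl k))%:~R.
  move=> kN; rewrite /rdot (bigD1 (Ordinal kN))//= /eps eqxx mulr1.
  by rewrite big1 ?addr0// => i; rewrite -val_eqE /= => /negPf ->; rewrite mulr0.
case: a => k /= kN; first exact: L.
by rewrite rdotN L// -[inr k]/(opp (inl k)) (rank_opp prec_Z2) rmorphN.
Qed.

Lemma linear_height_elt (V : lmodType K) (f : sp -> V) lam v N : linear f ->
  (forall i, f (H K i) = lam i *: v) -> f (height_elt N) = rdot N lam *: v.
Proof.
move=> lf fH; rewrite (lin_sum lf) scaler_suml; apply: eq_bigr => i _.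
by rewrite (lin_scale lf) fH scalerA.
Qed.

Lemma bracket_height_elt N a b : (supp_idx a < N)%N -> (supp_idx b < N)%N ->
  bracket (height_elt N) (root_vec K a b) =
    (rank N a - rank N b)%:~R *: root_vec K a b.
Proof.
move=> aN bN; have lf : linear (bracket^~ (root_vec K a b)) := bracket_linearl _.
rewrite (linear_height_elt N lf (root_vecP K a b)) rdotB !rdot_seps//.
by rewrite rmorphB.
Qed.

Lemma Pplus_below alpha :
  Pplus prec alpha <-> exists a b, below a b /\ alpha = seps a - seps b.
Proof.
have opp_self := prec_opp_self prec_order prec_admissible prec_Z2.
split=> [|[a [b [ab ->]]]].
  case=> [[i [-> i0]]|[[i [-> i0]]|[i [j [ij [[-> p]|[-> p]|[-> p]]]]]]].
  - by exists (inl i), (inr i); split; [exact/opp_self|rewrite /= opprK].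
  - exists (inr i), (inl i); split; last by rewrite /= mulr2n opprD.
    by have /opp_self := i0; rewrite opprK.
  - by exists (inl i), (inl j).
  - by exists (inl i), (inr j); rewrite /= opprK.
  - by exists (inr i), (inl j).
case: a b ab => i [] j; rewrite /below/= => ab.
- right; right; exists i, j; split=> [ij|]; last by constructor.
  by move: ab; rewrite ij; exact: prec_irr.
- have [ij|ij] := pselect (i = j).
    by left; exists i; move: ab; rewrite -ij => /opp_self; rewrite opprK.
  by right; right; exists i, j; split=> //; constructor 2; rewrite opprK.
- have [ij|ij] := pselect (i = j).
    right; left; exists i; move: ab; rewrite -ij mulr2n opprD; split=> //.
    by apply/opp_self; rewrite opprK.
  by right; right; exists i, j; split=> //; constructor 3.
- right; right; exists j, i; split=> [ij|].
    by move: ab; rewrite ij; exact: prec_irr.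
  constructor; split; last by rewrite -[pos j]opprK -[pos i]opprK; exact: prec_Z2.
  by rewrite opprK addrC.
Qed.

Lemma seps_roots a b : a <> b -> roots (seps a - seps b).
Proof.
case: a b => i [] j ab /=.
- right; exists i, j; split=> [ij|]; first by rewrite ij in ab.
  by constructor.
- have [<-|ij] := pselect (i = j).
    by left; exists i; left; rewrite opprK mulr2n.
  by right; exists i, j; split=> //; constructor 2; rewrite opprK.
- have [<-|ij] := pselect (i = j).
    by left; exists i; right; rewrite mulr2n opprD.
  by right; exists i, j; split=> //; constructor 3.
- right; exists j, i; split=> [ij|]; first by rewrite ij in ab.
  by constructor; rewrite opprK addrC.
Qed.

(** A root may be written as a difference in two ways; pairing with a height that
sees all four indices shows that the order of the two indices does not depend on
the choice. *)
Lemma seps_below a b c d : seps a - seps b = seps c - seps d -> below a b -> below c d.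
Proof.
move=> E ab; pose N := (maxn (maxn (supp_idx a) (supp_idx b))
                            (maxn (supp_idx c) (supp_idx d))).+1.
have [aN bN cN dN] : [/\ (supp_idx a < N)%N, (supp_idx b < N)%N,
    (supp_idx c < N)%N & (supp_idx d < N)%N] by rewrite /N; split; lia.
apply: (rank_inj_below prec_order prec_admissible cN dN).
have := congr1 (rdot N) E; rewrite !rdotB !rdot_seps// -!rmorphB.
move=> /(intr_inj char0); have := rank_below prec_order aN ab; lia.
Qed.

Lemma spmx_lin c (x y : sp) : spmx (c *: x + y) = c *: spmx x + spmx y.
Proof. exact: (linearP (val : sp -> finmx K idx)). Qed.

Lemma entry_lin_neq0 c (x y : sp) a b : (spmx (c *: x + y))@_(a, b) != 0 ->
  (spmx x)@_(a, b) != 0 \/ (spmx y)@_(a, b) != 0.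
Proof.
rewrite spmx_lin mcoeffD mcoeffZ.
have [->|] := eqVneq (spmx x)@_(a, b) 0; last by left.
by rewrite mulr0 add0r; right.
Qed.

(** Membership in u and l is read off matrix entries, which makes their brackets easy
to control. *)
Lemma nilradicalP (z : sp) :
  z \in nilradical K prec <-> forall a b, (spmx z)@_(a, b) != 0 -> below a b.
Proof.
split=> [|zP].
  move: z; apply: span_ind => [|c x y IHx IHy|z [alpha aP za]] a b.
  - by rewrite /= mcoeff0 eqxx.
  - by case/entry_lin_neq0; [exact: IHx|exact: IHy].
  - move=> /(root_spaceP za); have [c [d [cd ->]]] := (Pplus_below alpha).1 aP.
    by move=> /seps_below; exact.
apply: (@sp_ind_supp K char0 (fun z => z \in nilradical K prec) z) => [|c x y|a b ab].
- exact: rpred0.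
- exact: submod_lin.
- apply: sub_span; exists (seps a - seps b); last exact: root_vecP.
  by apply/Pplus_below; exists a, b; split=> //; exact: zP.
Qed.

Lemma root_vec_diag a : root_vec K a a \in span (range (H K)).
Proof.
case: a => i.
  suff -> : root_vec K (inl i) (inl i) = H K i by apply: sub_span; exists i.
  by apply: val_inj; rewrite /= /root_mx /= mulr1 scale1r.
suff -> : root_vec K (inr i) (inr i) = - H K i.
  by rewrite rpredN; apply: sub_span; exists i.
by apply: val_inj; rewrite raddfN/= /root_mx/= mulrNN mulr1 scale1r opprB.
Qed.

Lemma cartan_mx_supp i a b : (cartan_mx K i)@_(a, b) != 0 -> a = b.
Proof.
move=> h; apply/eqP; apply: contraNT h => ab.
have F c : ((c, c) == (a, b)) = false by apply: contraNF ab => /eqP[<- <-].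
by rewrite /cartan_mx mcoeffB !mcoeffU !F subrr eqxx.
Qed.

Lemma leviP (z : sp) :
  z \in levi K prec <-> forall a b, (spmx z)@_(a, b) != 0 -> level a b.
Proof.
split=> [|zP].
  move: z; apply: span_ind => [|c x y IHx IHy|z [zc|[alpha [ar na nma] za]]] a b.
  - by rewrite /= mcoeff0 eqxx.
  - by case/entry_lin_neq0; [exact: IHx|exact: IHy].
  - suff E : (spmx z)@_(a, b) != 0 -> a = b.
      by move=> /E ->; exact: level_refl.
    move: z zc; apply: span_ind => [|c x y IHx IHy|_ [i _ <-]].
    + by rewrite /= mcoeff0 eqxx.
    + by case/entry_lin_neq0; [exact: IHx|exact: IHy].
    + exact: cartan_mx_supp.
  - move=> /(root_spaceP za) E; split=> ab.
      by apply: na; apply/Pplus_below; exists a, b.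
    by apply: nma; apply/Pplus_below; exists b, a; rewrite E opprB.
apply: (@sp_ind_supp K char0 (fun z => z \in levi K prec) z) => [|c x y|a b ab].
- exact: rpred0.
- exact: submod_lin.
- have [->|ne] := pselect (a = b).
    have := root_vec_diag b; move: (root_vec K b b); apply: span_ind => [|c x y|x [i _ <-]].
    + exact: rpred0.
    + exact: submod_lin.
    + by apply: sub_span; left; apply: sub_span; exists i.
  apply: sub_span; right; exists (seps a - seps b); last exact: root_vecP.
  have [nab nba] := zP _ _ ab.
  split; first exact: seps_roots.
  + by move=> /Pplus_below[c [d [cd E]]]; apply: nab; apply: seps_below cd; rewrite E.
  + move=> /Pplus_below[c [d [cd E]]]; apply: nba; apply: seps_below cd.
    by rewrite -E opprB.
Qed.

Lemma root_vec_supp a b c d : (spmx (root_vec K a b))@_(c, d) != 0 ->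
  seps c - seps d = seps a - seps b.
Proof. by move=> /(root_spaceP (root_vecP K a b)). Qed.

Lemma root_vec_levi a b : level a b -> root_vec K a b \in levi K prec.
Proof.
move=> [nab nba]; apply/leviP => c d /root_vec_supp E; split=> cd.
  exact/nab/(seps_below E).
by apply/nba/(seps_below _ cd); rewrite -opprB E opprB.
Qed.

Lemma root_vec_nilradical a b : below a b -> root_vec K a b \in nilradical K prec.
Proof. by move=> ab; apply/nilradicalP => c d /root_vec_supp/esym/seps_below; exact. Qed.

Lemma levi_bracket_nilradical x y :
  x \in levi K prec -> y \in nilradical K prec -> bracket y x \in nilradical K prec.
Proof.
move=> /leviP xl /nilradicalP yu; apply/nilradicalP => a b /bracket_supp[c].
case=> -[/[dup] ? h1 h2].
- have := level_belowr _ _ (xl _ _ h2) (yu _ _ h1); exact.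
- have := level_belowl _ _ (level_sym (xl _ _ h1)) (yu _ _ h2); exact.
Qed.

Lemma levi_H i : H K i \in levi K prec.
Proof. by apply: sub_span; left; apply: sub_span; exists i. Qed.

End Parabolic.

(** * Weight vectors *)

Section WeightVectors.
Variables (K : fieldType) (V : lmodType K) (h : nat -> V -> V).
Hypothesis hlin : forall i, linear (h i).

Definition is_weight (lam : nat -> K) (v : V) : Prop := forall i, h i v = lam i *: v.

Lemma is_weight_lin lam c u v :
  is_weight lam u -> is_weight lam v -> is_weight lam (c *: u + v).
Proof. by move=> hu hv i; rewrite hlin hu hv scalerDr !scalerA mulrC. Qed.

Lemma is_weight0 lam : is_weight lam 0.
Proof. by move=> i; rewrite (lin_zero (hlin i)) scaler0. Qed.

(** Induction on the number of weights: if lam and mu differ at i, the operator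
h_i - mu_i removes the component of weight mu and rescales that of weight lam by a
nonzero scalar. *)
Lemma weight_comp (N : submodClosed V) (d : seq (nat -> K)) (f : (nat -> K) -> V) :
  (forall i v, v \in N -> h i v \in N) -> uniq d ->
  (forall lam, is_weight lam (f lam)) ->
  \sum_(lam <- d) f lam \in N -> forall lam, lam \in d -> f lam \in N.
Proof.
move=> hN; elim: d f => // mu d IH f /= /andP[mud ud] fw; rewrite big_cons => sN.
have dN lam : lam \in d -> f lam \in N.
  move=> lamd; have [i lami] : exists i, lam i != mu i.
    apply: contrapT => no; case/negP: mud; suff <- : lam = mu by [].
    by apply/funext => i; apply/eqP/negPn/negP => ne; apply: no; exists i.
  have gw nu : is_weight nu ((nu i - mu i) *: f nu).
    by rewrite -[_ *: _]addr0; apply: is_weight_lin => //; exact: is_weight0.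
  have E : \sum_(nu <- d) (nu i - mu i) *: f nu =
      h i (f mu + \sum_(lam <- d) f lam) - mu i *: (f mu + \sum_(lam <- d) f lam).
    rewrite (lin_add (hlin i)) fw (lin_sum (hlin i)) scalerDr opprD addrACA subrr.
    rewrite add0r scaler_sumr -sumrB; apply: eq_bigr => nu _.
    by rewrite fw scalerBl.
  have EN : \sum_(nu <- d) (nu i - mu i) *: f nu \in N.
    by rewrite E; apply: submod_sub; [exact: hN|exact: rpredZ].
  have := IH (fun nu => (nu i - mu i) *: f nu) ud gw EN lam lamd.
  by move=> /(rpredZ (lam i - mu i)^-1); rewrite scalerA mulVf ?scale1r// subr_eq0.
move=> lam; rewrite inE => /orP[/eqP ->|]; last exact: dN.
have -> : f mu = (f mu + \sum_(lam <- d) f lam) - \sum_(lam <- d) f lam.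
  by rewrite addrK.
by apply: submod_sub => //; rewrite big_seq; exact: rpred_sum.
Qed.

Lemma weight_decomp v : v \in span (\bigcup_(lam in setT) [set w | is_weight lam w]) ->
  exists (d : seq (nat -> K)) (f : (nat -> K) -> V),
    [/\ uniq d, forall lam, is_weight lam (f lam) & v = \sum_(lam <- d) f lam].
Proof.
move=> vs; suff [d [f [fw f0 ->]]] : exists (d : {fset (nat -> K)}) (f : (nat -> K) -> V),
    [/\ forall lam, is_weight lam (f lam), forall lam, lam \notin d -> f lam = 0
      & v = \sum_(lam <- d) f lam].
  by exists d, f; split=> //; exact: fset_uniq.
move: v vs; apply: span_ind => [|c u v [d [f [fw f0 ->]]] [e [g [gw g0 ->]]]|w [lam _ lamw]].
- exists fset0, (fun=> 0); split=> //; first by move=> lam; exact: is_weight0.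
  by rewrite big_seq_fset0.
- exists (d `|` e)%fset, (fun lam => c *: f lam + g lam); split=> [lam|lam|].
  + exact: is_weight_lin.
  + by rewrite inE negb_or => /andP[/f0 -> /g0 ->]; rewrite scaler0 addr0.
  + rewrite big_split/= -scaler_sumr; congr (_ *: _ + _); apply: big_fset_incl.
    * exact: fsubsetUl.
    * by move=> lam _ /f0.
    * exact: fsubsetUr.
    * by move=> lam _ /g0.
- exists [fset lam]%fset, (fun nu => if nu == lam then w else 0); split=> [nu|nu|].
  + by case: eqP => [->//|_]; exact: is_weight0.
  + by rewrite inE => /negPf ->.
  + by rewrite big_seq_fset1 eqxx.
Qed.

Hypothesis Vw : forall v, v \in span (\bigcup_(lam in setT) [set w | is_weight lam w]).

Lemma weight_sub_ind (N : submodClosed V) (P : V -> Prop) :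
  (forall i v, v \in N -> h i v \in N) ->
  P 0 -> (forall c u v, P u -> P v -> P (c *: u + v)) ->
  (forall lam w, w \in N -> is_weight lam w -> P w) -> forall v, v \in N -> P v.
Proof.
move=> hN P0 PD Pw v; have [d [f [ud fw ->]]] := weight_decomp (Vw v).
move=> /(weight_comp hN ud fw); elim: d {ud} => [|lam d IH] fN; first by rewrite big_nil.
rewrite big_cons -[f lam]scale1r; apply: PD.
  by apply: Pw (fw lam); rewrite fN// mem_head.
by apply: IH => nu nud; rewrite fN// inE nud orbT.
Qed.

Lemma weight_exists (N : submodClosed V) :
  (forall i v, v \in N -> h i v \in N) -> (exists2 v, v \in N & v <> 0) ->
  exists lam w, [/\ w \in N, w <> 0 & is_weight lam w].
Proof.
move=> hN [v vN v0]; apply: contrapT => no; apply: v0.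
apply: (@weight_sub_ind N (fun v => v = 0) hN) vN => [//|c u w -> ->|lam w wN ww].
  by rewrite scaler0 addr0.
by apply: contrapT => w0; apply: no; exists lam, w.
Qed.

End WeightVectors.

(** * Heights and lowering *)

Section Triangular.
Variables (K : fieldType) (prec : int -> int -> Prop).
Hypothesis char0 : [pchar K] =i pred0.
Hypothesis prec_order : strict_order prec.
Hypothesis prec_admissible : admissible prec.
Hypothesis prec_Z2 : Z2_linear prec.

Local Notation sp := (sp K).
Local Notation below := (below prec).
Local Notation level := (level prec).
Local Notation rank := (rank prec).
Local Notation levi := (levi K prec).
Local Notation nilradical := (nilradical K prec).
Local Notation root_vec := (root_vec K).
Local Notation height_elt := (height_elt K prec).

Section Module.
Variables (V : lmodType K) (act : sp -> V -> V).
Hypothesis rep : is_rep setT act.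

Lemma act_root_vec_ind (N : submodClosed V) v :
  (forall a b, act (root_vec a b) v \in N) -> forall z, act z v \in N.
Proof.
move=> Nv z; apply: (@sp_ind_supp K char0 (fun z => act z v \in N)) => [|c x y|a b _].
- by rewrite (lin_zero (act_linearl rep v)) rpred0.
- by move=> xN yN; rewrite (act_linearl rep v); exact: submod_lin.
- exact: Nv.
Qed.

(** The height [height_elt N] sees only indices below N, so a scalar action can
be expected only for N large compared with the vector. *)
Definition eventually_height (chi : nat -> K) (v : V) : Prop :=
  exists N0, forall N, (N0 <= N)%N -> act (height_elt N) v = chi N *: v.

Lemma eventually_height_lin chi c u v : eventually_height chi u ->
  eventually_height chi v -> eventually_height chi (c *: u + v).
Proof.
move=> [N0 hu] [N1 hv]; exists (maxn N0 N1) => N; rewrite geq_max => /andP[h0 h1].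
by rewrite (act_linear rep) hu// hv// scalerDr !scalerA mulrC.
Qed.

Lemma eventually_height0 chi : eventually_height chi 0.
Proof. by exists 0%N => N _; rewrite (lin_zero (act_linear rep _)) scaler0. Qed.

Lemma eventually_height_weight lam v : weight_space act lam v ->
  eventually_height (rdot prec ^~ lam) v.
Proof.
move=> vw; exists 0%N => N _.
exact: (linear_height_elt prec N (act_linearl rep v) vw).
Qed.

Lemma act_height_elt N a b v : (supp_idx a < N)%N -> (supp_idx b < N)%N ->
  act (height_elt N) (act (root_vec a b) v) =
  act (root_vec a b) (act (height_elt N) v) +
    (rank N a - rank N b)%:~R *: act (root_vec a b) v.
Proof.
move=> aN bN; rewrite (act_swap rep) bracket_height_elt//.
by rewrite (lin_scale (act_linearl rep v)).
Qed.

(** Root vectors in l do not change the rank, hence commute with all large heights. *)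
Lemma eventually_height_level chi a b v : level a b -> eventually_height chi v ->
  eventually_height chi (act (root_vec a b) v).
Proof.
move=> ab [N0 hv]; exists (maxn N0 (maxn (supp_idx a) (supp_idx b)).+1) => N hN.
rewrite act_height_elt; [|lia|lia]; rewrite hv; last lia.
by rewrite (rank_level prec_order prec_admissible N ab) subrr scale0r addr0 (lin_scale (act_linear rep _)).
Qed.

Lemma levi_act_ind (N : submodClosed V) v :
  (forall a b, level a b -> act (root_vec a b) v \in N) ->
  forall z, z \in levi -> act z v \in N.
Proof.
move=> Nv z /(leviP char0 prec_order prec_admissible prec_Z2) zl.
apply: (@sp_ind_supp K char0 (fun z => act z v \in N)) => [|c x y|a b ab].
- by rewrite (lin_zero (act_linearl rep v)) rpred0.
- by move=> xN yN; rewrite (act_linearl rep v); exact: submod_lin.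
- exact/Nv/zl.
Qed.

Section Filtration.
Variables (T : submodClosed V) (chi : nat -> K).
Hypothesis T_levi : forall x v, x \in levi -> v \in T -> act x v \in T.
Hypothesis T_nil : forall x v, x \in nilradical -> v \in T -> act x v = 0.
Hypothesis T_height : forall v, v \in T -> eventually_height chi v.

(** The span of the products of at most n root vectors of the opposite nilradical,
applied to elements of T. *)
Inductive lowered : nat -> V -> Prop :=
| lowered_top n v : v \in T -> lowered n v
| lowered_lin n c u v : lowered n u -> lowered n v -> lowered n (c *: u + v)
| lowered_low n a b v : below b a -> lowered n v ->
    lowered n.+1 (act (root_vec a b) v).

Lemma lowered_mono n v : lowered n v -> lowered n.+1 v.
Proof.
elim=> {n v} [n v|n c u v _ IHu _ IHv|n a b v ba _ IH].
- exact: lowered_top.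
- exact: lowered_lin.
- exact: lowered_low.
Qed.

Lemma lowered_submod n : exists N : submodClosed V, forall v, v \in N <-> lowered n v.
Proof.
apply: submod_of_prop; last by move=> *; exact: lowered_lin.
by apply: lowered_top; rewrite rpred0.
Qed.

(** Normal ordering. A root vector of l + u is moved to the right past the lowering
operators; each commutator is again a combination of root vectors acting on a
vector with one lowering operator less, so the induction needs no information on
which brackets of root spaces vanish. *)
Lemma lowered_parabolic n v a b : lowered n v -> ~ below b a ->
  lowered n (act (root_vec a b) v).
Proof.
move=> nv; elim: nv a b => {n v} [n v vT|n c u v _ IHu _ IHv|n c d v dc nv IH] a b ba.
- apply: lowered_top; have [ab|nab] := pselect (below a b).
    by rewrite T_nil ?rpred0//; exact: root_vec_nilradical.
  by apply: T_levi => //; exact: root_vec_levi.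
- by rewrite (act_linear rep); apply: lowered_lin; [exact: IHu|exact: IHv].
rewrite (act_swap rep) -[act (root_vec c d) _]scale1r; apply: lowered_lin.
  exact/lowered_low/IH.
have [N NP] := lowered_submod n.+1; apply/NP; apply: act_root_vec_ind => e f.
apply/NP; have [fe|nfe] := pselect (below f e); first exact: lowered_low.
exact/lowered_mono/IH.
Qed.

Lemma lowered_all : (forall N : submodClosed V, submodule setT act N ->
    (forall v, v \in T -> v \in N) -> forall v, v \in N) ->
  forall v, exists n, lowered n v.
Proof.
move=> gen; have [||N NP] := @submod_of_prop K V (fun v => exists n, lowered n v).
- by exists 0%N; apply: lowered_top; rewrite rpred0.
- move=> c u v [n nu] [m mv]; exists (n + m)%N; apply: lowered_lin.
    by elim: m {mv} => [|m IH]; rewrite ?addn0// addnS; exact: lowered_mono.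
  by elim: n {nu} => [|n IH]; rewrite ?add0n// addSn; exact: lowered_mono.
move=> v; apply/NP; apply: gen => [x u _ /NP[n nu]|u uT].
  have [N' N'P] := lowered_submod n.+1.
  apply/NP; exists n.+1; apply/N'P; apply: act_root_vec_ind => e f; apply/N'P.
  have [fe|nfe] := pselect (below f e); first exact: lowered_low.
  exact/lowered_mono/lowered_parabolic.
by apply/NP; exists 0%N; exact: lowered_top.
Qed.

(** The product of the operators height - chi N + k, which annihilates vectors of
height chi N - k and acts on vectors of height chi N by the product of the k. *)
Definition drop_op N (ks : seq nat) (v : V) : V :=
  foldr (fun k u => act (height_elt N) u - (chi N - k%:R) *: u) v ks.

Lemma drop_op_linear N ks : linear (drop_op N ks).
Proof.
move=> c u v; elim: ks => //= k ks ->; rewrite (act_linear rep) scalerDr !scalerA.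
rewrite scalerBr scalerA [c * _]mulrC opprD addrACA.
by [].
Qed.

Lemma drop_op_cat N ks ks' v : drop_op N (ks ++ ks') v = drop_op N ks (drop_op N ks' v).
Proof. exact: foldr_cat. Qed.

Lemma drop_op_scalar N c ks v : act (height_elt N) v = c *: v ->
  drop_op N ks v = (\prod_(k <- ks) (c - chi N + k%:R)) *: v.
Proof.
move=> hv; elim: ks => [|k ks IH]; first by rewrite big_nil scale1r.
rewrite big_cons /= IH (lin_scale (act_linear rep _)) hv !scalerA -scalerBl.
by congr (_ *: _); ring.
Qed.

Lemma drop_op0 N ks : drop_op N ks 0 = 0.
Proof. exact: (lin_zero (drop_op_linear N ks)). Qed.

Lemma drop_op_act N ks v :
  drop_op N ks (act (height_elt N) v) = act (height_elt N) (drop_op N ks v).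
Proof.
elim: ks => //= k ks ->.
by rewrite (lin_sub (act_linear rep _)) (lin_scale (act_linear rep _)).
Qed.

Lemma drop_opC N ks ks' v : drop_op N ks (drop_op N ks' v) = drop_op N ks' (drop_op N ks v).
Proof.
elim: ks' => //= k ks' IH.
by rewrite (lin_sub (drop_op_linear N ks)) (lin_scale (drop_op_linear N ks)) drop_op_act IH.
Qed.

(** A lowering operator shifts the height by an integer d, and so transports an
annihilating product to one with all factors shifted. *)
Lemma drop_op_low N a b d ks v : (supp_idx a < N)%N -> (supp_idx b < N)%N ->
  rank N b - rank N a = d%:Z ->
  drop_op N [seq (k + d)%N | k <- ks] (act (root_vec a b) v) =
    act (root_vec a b) (drop_op N ks v).
Proof.
move=> aN bN hd; elim: ks => //= k ks ->.
rewrite act_height_elt// (lin_sub (act_linear rep _)) (lin_scale (act_linear rep _)).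
have -> : rank N a - rank N b = - d%:Z by lia.
rewrite -addrA; congr (_ + _); rewrite -scalerBl -scaleNr; congr (_ *: _).
by rewrite rmorphN/= -pmulrn natrD; ring.
Qed.

(** The lowered part v - t is detected by its heights chi N - k with k >= 1; the
list of the k depends on N since the ranks do. *)
Definition has_top (v : V) : Prop :=
  exists2 t, t \in T & exists N0, forall N, (N0 <= N)%N ->
    exists2 ks, all (leq 1) ks & drop_op N ks (v - t) = 0.

(** A lowered vector f v has no component in T: if t is the component of v, then f t
has height chi N - d, where d is the shift of f, and an annihilating product for
v - t becomes one for f (v - t) after shifting its factors by d. *)
Lemma lowered_has_top n v : lowered n v -> has_top v.
Proof.
elim=> {n v} [n v vT|n c u v _ [t tT [N0 h0]] _ [s sT [N1 h1]]|n a b v ba _ [t tT [N0 h0]]].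
- by exists v => //; exists 0%N => N _; exists [::] => //=; rewrite subrr.
- exists (c *: t + s); first exact: submod_lin.
  exists (maxn N0 N1) => N; rewrite geq_max => /andP[/h0[ks kp ks0] /h1[ls lp ls0]].
  exists (ks ++ ls); first by rewrite all_cat kp.
  have -> : c *: u + v - (c *: t + s) = c *: (u - t) + (v - s).
    by rewrite scalerBr opprD addrACA.
  have u0 : drop_op N (ks ++ ls) (u - t) = 0 by rewrite drop_op_cat drop_opC ks0 drop_op0.
  have v0 : drop_op N (ks ++ ls) (v - s) = 0 by rewrite drop_op_cat ls0 drop_op0.
  by rewrite drop_op_linear u0 v0 scaler0 addr0.
- exists 0; first by rewrite rpred0.
  have [N1 h1] := T_height tT.
  exists (maxn (maxn N0 N1) (maxn (supp_idx a) (supp_idx b)).+1) => N hN.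
  have [ks kp ks0] : exists2 ks, all (leq 1) ks & drop_op N ks (v - t) = 0.
    by apply: h0; lia.
  have ht := h1 N; have [aN bN] : (supp_idx a < N)%N /\ (supp_idx b < N)%N by lia.
  have rba := rank_below prec_order bN ba.
  pose d := `|rank N b - rank N a|%N; have hd : rank N b - rank N a = d%:Z.
    by rewrite /d; lia.
  (* The factor with k = 0 annihilates t; shifted by d, it annihilates f t. *)
  exists [seq (k + d)%N | k <- ks ++ [:: 0%N]].
    rewrite map_cat all_cat/= andbT; apply/andP; split; last by rewrite /d; lia.
    by apply/allP => _ /mapP[k /(allP kp) k1 ->]; rewrite (leq_trans k1)// leq_addr.
  rewrite subr0 (drop_op_low _ _ aN bN hd) -[v](subrK t) [_ - _ + _]addrC.
  have t0 : drop_op N (ks ++ [:: 0%N]) t = 0.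
    by rewrite drop_op_cat /= ht; [rewrite subr0 subrr drop_op0|lia].
  have v0 : drop_op N (ks ++ [:: 0%N]) (v - t) = 0.
    by rewrite drop_op_cat drop_opC ks0 drop_op0.
  rewrite (lin_add (drop_op_linear N _)) t0 v0 addr0.
  exact: (lin_zero (act_linear rep _)).
Qed.

End Filtration.
End Module.
End Triangular.

(** * Aligned modules and invariants of the nilradical *)

Section FiniteSpan.
Variables (K : fieldType) (V : lmodType K).

Lemma span_consP (x : V) (s : seq V) v :
  v \in span [set` x :: s] -> exists c, v - c *: x \in span [set` s].
Proof.
move: v; apply: span_ind => [|c u v [a ha] [b hb]|w].
- by exists 0; rewrite scale0r subr0 rpred0.
- exists (c * a + b).
  have -> : c *: u + v - (c * a + b) *: x = c *: (u - a *: x) + (v - b *: x).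
    by rewrite scalerDl scalerBr scalerA opprD addrACA.
  exact: submod_lin.
- rewrite /= inE => /orP[/eqP ->|ws]; first by exists 1; rewrite scale1r subrr rpred0.
  by exists 0; rewrite scale0r subr0; apply: sub_span.
Qed.

(** Subspaces of finite-dimensional spaces are finite-dimensional, by elimination
of one generator at a time. *)
Lemma span_sub (s : seq V) (W : submodClosed V) :
  (forall v, v \in W -> v \in span [set` s]) ->
  exists t : seq V, (forall w, w \in t -> w \in W) /\
    forall v, v \in W -> v \in span [set` t].
Proof.
elim: s W => [|x s IH] W Ws; first by exists [::].
have [[w0 [c0 [w0W c00 hw0]]]|no] := pselect (exists w0 c0,
    [/\ w0 \in W, c0 != 0 & w0 - c0 *: x \in span [set` s]]); last first.
  apply: IH => v vW; have [c hc] := span_consP (Ws _ vW).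
  have [c0|c0] := eqVneq c 0; first by rewrite c0 scale0r subr0 in hc.
  by case: no; exists v, c.
have [||W' W'P] := @submod_of_prop K V (fun v => v \in W /\ v \in span [set` s]).
- by split; exact: rpred0.
- by move=> c u v [? ?] [? ?]; split; exact: submod_lin.
have [v /W'P[]//|t [tW' ht]] := IH W'.
exists (w0 :: t); split=> [w|v vW].
  by rewrite inE => /orP[/eqP ->//|/tW' /W'P[]].
have [c hc] := span_consP (Ws _ vW).
have sub u : u \in span [set` t] -> u \in span [set` w0 :: t].
  move: u; apply: span_ind => [|d u u'|u ut]; [exact: rpred0|exact: submod_lin|].
  by apply: sub_span; rewrite /= inE; apply/orP; right.
rewrite -[v](subrK ((c / c0) *: w0)) addrC; apply: submod_lin.
  by apply: sub_span; rewrite /= inE eqxx.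
apply/sub/ht/W'P; split; first by apply: submod_sub => //; exact: rpredZ.
have -> : v - (c / c0) *: w0 = (v - c *: x) - (c / c0) *: (w0 - c0 *: x).
  by rewrite scalerBr scalerA mulfVK// opprB addrA subrK.
by apply: submod_sub => //; exact: rpredZ.
Qed.

End FiniteSpan.

Section SimpleQuotients.
Variables (K : fieldType) (L : lieAlgType K).

Lemma simple_of_iso (V W : lmodType K) (actV : L -> V -> V) (actW : L -> W -> W) :
  module_iso actV actW -> simple setT actW -> simple setT actV.
Proof.
move=> [f [[g gK fK] fact]] [[w w0] Wsimple]; split.
  by exists (g w) => gw0; apply: w0; rewrite -(fK w) gw0 linear0.
move=> N Nsub.
have [N' N'P] := image_submod N (linearP f).
have [x w' _ /N'P[v vN <-]|N0|Nall] := Wsimple N'.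
- by apply/N'P; exists (actV x v); [exact: Nsub|rewrite fact].
- left=> v vN; have /N0 fv : f v \in N' by apply/N'P; exists v.
  by rewrite -(gK v) fv -(linear0 f) gK.
- right=> v; have /N'P[u uN fu] := Nall (f v).
  by rewrite -(gK v) -fu gK.
Qed.

Variables (M : lmodType K) (act : L -> M -> M).
Hypothesis rep : is_rep setT act.

Lemma quot_actE (N : submodClosed M) x m : submodule setT act N ->
  quot_map (N := N) (act x) (\pi_(lquot N) m) = \pi_(lquot N) (act x m).
Proof.
by move=> Nsub; apply: quot_mapE => [|v vN]; [exact: act_linear|exact: Nsub].
Qed.

(** Simplicity of M / N as maximality of N. *)
Lemma simple_quotient_max (N N' : submodClosed M) :
  submodule setT act N -> simple setT (fun x => quot_map (N := N) (act x)) ->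
  submodule setT act N' -> (forall m, m \in N -> m \in N') ->
  (forall m, m \in N' -> m \in N) \/ (forall m, m \in N').
Proof.
move=> Nsub [_ Nsimple] N'sub NN'.
have [Q QP] := image_submod N' (@lquot_pi_linear K M N).
have [x q _ /QP[m mN' <-]|Q0|Qall] := Nsimple Q.
- by apply/QP; exists (act x m); [exact: N'sub|rewrite quot_actE].
- left=> m mN'; apply/lquot_eq0/Q0/QP; by exists m.
- right=> m; have /QP[n nN' /eqP] := Qall (\pi_(lquot N) m).
  by rewrite eq_sym lquot_eq => /NN' mn; rewrite -(subrK n m) rpredD.
Qed.

Lemma simple_quotient_proper (N : submodClosed M) :
  simple setT (fun x => quot_map (N := N) (act x)) -> ~ forall m, m \in N.
Proof.
move=> [[q q0] _] Nall; apply: q0; move: q; apply: quot_ind => m.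
exact/lquot_eq0/Nall.
Qed.

End SimpleQuotients.

Section Aligned.
Variables (K : fieldType) (prec : int -> int -> Prop).
Hypothesis char0 : [pchar K] =i pred0.
Hypothesis prec_order : strict_order prec.
Hypothesis prec_admissible : admissible prec.
Hypothesis prec_Z2 : Z2_linear prec.

Local Notation sp := (sp K).
Local Notation below := (below prec).
Local Notation levi := (levi K prec).
Local Notation nilradical := (nilradical K prec).
Local Notation height_elt := (height_elt K prec).
Local Notation rdot := (rdot prec).

Variables (X : lmodType K) (act : sp -> X -> X).
Hypothesis X_swm : simple_weight_module setT act.

Let rep : is_rep setT act. Proof. by case: X_swm. Qed.

Lemma X_generated (N : submodClosed X) : submodule setT act N ->
  (exists2 v, v \in N & v <> 0) -> forall v, v \in N.
Proof.
case: X_swm => _ _ [_ Xs] /Xs[N0|//] [v vN v0].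
by case: v0; exact: N0.
Qed.

(** The image of 1 tensor S in the simple quotient: some vector of it is nonzero,
because 1 tensor S generates. *)
Lemma aligned_nil_invariant : aligned [set` levi] [set` nilradical] act ->
  exists v, v <> 0 /\ forall x, x \in nilradical -> act x v = 0.
Proof.
move=> [_ [S [actS [[repS _ _] [N [[Nsub Nsimple] _ [f [fbij fact]]]]]]]].
have repM := induced_is_rep [set` levi] [set` nilradical] actS.
have [s sN] : exists s, tens [set` levi] [set` nilradical] actS 1 s \notin N.
  apply: contrapT => no; apply: (simple_quotient_proper Nsimple).
  apply: induced_gen => // s; apply/negPn/negP => sN; apply: no; by exists s.
exists (f (\pi_(lquot N) (tens [set` levi] [set` nilradical] actS 1 s))); split.
  move=> f0; case/negP: sN; apply/lquot_eq0; apply: (bij_inj fbij).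
  by rewrite f0 linear0.
move=> x xu; rewrite -fact.
have -> : quot_map (N := N) (@induced_act K _ [set` levi] [set` nilradical] S actS x)
     (\pi_(lquot N) (tens [set` levi] [set` nilradical] actS 1 s)) = 0.
  apply: etrans (quot_actE repM x _ Nsub) _; apply/lquot_eq0.
  suff -> : @induced_act K _ [set` levi] [set` nilradical] S actS x
      (tens [set` levi] [set` nilradical] actS 1 s) = 0 by exact: rpred0.
  apply: etrans (induced_actE _ _ _ _ _ _) _.
  have -> : iota x * 1 = 1 * iota (0 + x) :> U sp by rewrite add0r mulr1 mul1r.
  have l0 : [set` levi] 0 by exact: rpred0.
  apply: etrans (tens_balanced actS 1 s l0 xu) _.
  suff -> : actS 0 s = 0.
    exact: (lin_zero (tens_linearr [set` levi] [set` nilradical] actS 1)).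
  have := rep_actDl repS 1 s l0 l0; rewrite scale1r addr0 scale1r => E.
  by apply: (addrI (actS 0 s)); rewrite addr0 -E.
exact: linear0.
Qed.

Lemma natprod_neq0 (ks : seq nat) : all (leq 1) ks ->
  \prod_(k <- ks) (k%:R : K) != 0.
Proof.
elim: ks => [|k ks IH]; first by rewrite big_nil oner_eq0.
rewrite big_cons mulf_eq0 negb_or => /andP[k1 /IH ->]; rewrite andbT.
by rewrite ((pcharf0P K).1 char0) -lt0n.
Qed.

Section Invariants.
Variable Inv : submodClosed X.
Hypothesis InvP : forall v, v \in Inv <-> forall x, x \in nilradical -> act x v = 0.

Lemma Inv_levi x v : x \in levi -> v \in Inv -> act x v \in Inv.
Proof.
move=> xl /InvP vI; apply/InvP => y yu; rewrite (act_swap rep) vI//.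
rewrite (lin_zero (act_linear rep x)) add0r vI//.
exact: levi_bracket_nilradical.
Qed.

(** Every weight vector w of [X] lies below v: either it is in the l-module N that
contains v and has the heights of v, or its heights are smaller by positive
integers. *)
Lemma height_compare (N : submodClosed X) lam mu v w :
  (forall u, u \in N -> u \in Inv) ->
  (forall x u, x \in levi -> u \in N -> act x u \in N) ->
  v \in N -> v <> 0 -> w <> 0 -> weight_space act lam v -> weight_space act mu w ->
  (w \in N /\ exists N0, forall n, (N0 <= n)%N -> rdot n mu = rdot n lam) \/
  exists N0, forall n, (N0 <= n)%N ->
    exists2 k, (0 < k)%N & rdot n mu - rdot n lam + k%:R = 0.
Proof.
move=> NI Nl vN v0 w0 vlam wmu.
pose chi n := rdot n lam.
have [||T TP] := @submod_of_prop K X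
    (fun u => u \in N /\ eventually_height prec act chi u).
- by split; [exact: rpred0|exact: eventually_height0].
- move=> c a b [? ?] [? ?]; split; first exact: submod_lin.
  exact: eventually_height_lin.
have Tl x u : x \in levi -> u \in T -> act x u \in T.
  move=> xl uT; apply: (levi_act_ind char0) xl => // a b ab.
  have [uN uh] := (TP _).1 uT; apply/TP; split; first by apply: Nl => //; exact: root_vec_levi.
  exact: eventually_height_level.
have Tn x u : x \in nilradical -> u \in T -> act x u = 0.
  by move=> xu /TP[/NI /InvP uI _]; exact: uI.
have Th u : u \in T -> eventually_height prec act chi u by move=> /TP[].
have vT : v \in T.
  by apply/TP; split=> //; exact: eventually_height_weight.
have [n nw] : exists n, lowered prec act T n w.
  apply: lowered_all => // N' N'sub TN'; apply: X_generated => //.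
  by exists v => //; exact: TN'.
have [t tT [N0 h0]] : has_top prec act T chi w by apply: lowered_has_top nw.
have [N1 h1] := Th _ tT.
have hw m : act (height_elt m) w = rdot m mu *: w.
  exact: (linear_height_elt prec m (act_linearl rep w) wmu).
have E m : (maxn N0 N1 <= m)%N -> exists2 ks, all (leq 1) ks &
    (\prod_(k <- ks) (rdot m mu - chi m + k%:R)) *: w =
    (\prod_(k <- ks) k%:R) *: t.
  rewrite geq_max => /andP[/h0[ks kp ks0] /h1 ht]; exists ks => //.
  move: ks0; rewrite (lin_sub (drop_op_linear prec rep chi m ks)) => /eqP.
  rewrite subr_eq0 => /eqP.
  rewrite (drop_op_scalar rep chi ks (hw m)) (drop_op_scalar rep chi ks ht) => ->.
  by congr (_ *: _); apply: eq_bigr => k _; rewrite subrr add0r.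
have [t0|t0] := pselect (t = 0).
  right; exists (maxn N0 N1) => m /E[ks kp]; rewrite t0 scaler0 => /eqP.
  rewrite scaler_eq0 => /orP[|/eqP//]; rewrite prodf_seq_eq0 => /hasP[k kks /=].
  by move=> /eqP hk; exists k => //; exact: (allP kp).
left; have tw m : (maxn N0 N1 <= m)%N -> exists2 c, c != 0 & t = c *: w.
  move=> /E[ks kp Et]; have k0 := natprod_neq0 kp.
  have Ew : t = ((\prod_(k <- ks) k%:R)^-1 * \prod_(k <- ks) (rdot m mu - chi m + k%:R)) *: w.
    by rewrite -scalerA Et scalerA mulVf// scale1r.
  exists ((\prod_(k <- ks) k%:R)^-1 * \prod_(k <- ks) (rdot m mu - chi m + k%:R)) => //.
  by apply/negP => /eqP c0; apply: t0; rewrite Ew c0 scale0r.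
have [c c0 tE] := tw _ (leqnn _); split.
  have -> : w = c^-1 *: t by rewrite tE scalerA mulVf// scale1r.
  by rewrite rpredZ//; have [] := (TP t).1 tT.
exists N1 => m /h1; rewrite tE (lin_scale (act_linear rep _)) hw !scalerA.
move=> /eqP; rewrite -subr_eq0 -scalerBl scaler_eq0 => /orP[|/eqP//].
by rewrite mulrC -mulrBl mulf_eq0 (negPf c0) orbF subr_eq0 => /eqP.
Qed.

Lemma H_stable (N : submodClosed X) :
  (forall x u, x \in levi -> u \in N -> act x u \in N) ->
  forall i v, v \in N -> act (H K i) v \in N.
Proof. by move=> Nl i v; apply: Nl; exact: levi_H. Qed.

Lemma X_weights v : v \in span (\bigcup_(lam in setT) [set w | is_weight (fun i => act (H K i)) lam w]).
Proof. by case: X_swm => _ [+ _] _; exact. Qed.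

Let Hlin i : linear (act (H K i)). Proof. exact: act_linear. Qed.

(** If w and v are weight vectors of X^u and w is not in the l-module N containing v,
then w is strictly lower than v; exchanging the roles, v is at most as high as w,
which is impossible in characteristic 0. *)
Lemma Inv_simple (N : submodClosed X) :
  (forall u, u \in N -> u \in Inv) ->
  (forall x u, x \in levi -> u \in N -> act x u \in N) ->
  (exists2 v, v \in N & v <> 0) -> forall w, w \in Inv -> w \in N.
Proof.
move=> NI Nl Nv; have [lam [v [vN v0 vlam]]] := weight_exists Hlin X_weights (H_stable Nl) Nv.
apply: (@weight_sub_ind K X _ Hlin X_weights Inv (fun w => w \in N) (H_stable Inv_levi)).
- exact: rpred0.
- by move=> *; exact: submod_lin.
move=> mu w wI wmu; have [->|w0] := pselect (w = 0); first exact: rpred0.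
have [[]//|[N1 h1]] := height_compare NI Nl vN v0 w0 vlam wmu.
have [[_ [N2 h2]]|[N2 h2]] :=
  height_compare (fun u uI => uI) Inv_levi wI w0 v0 wmu vlam.
  have [k k0] := h1 _ (leq_maxl N1 N2); rewrite h2 ?leq_maxr// subrr add0r.
  by move=> /eqP; rewrite ((pcharf0P K).1 char0) => /eqP kk; rewrite kk in k0.
have [k k0 hk] := h1 _ (leq_maxl N1 N2); have [j j0 hj] := h2 _ (leq_maxr N1 N2).
have : (k + j)%:R == 0 :> K.
  have -> : (k + j)%:R = (rdot (maxn N1 N2) mu - rdot (maxn N1 N2) lam + k%:R) +
      (rdot (maxn N1 N2) lam - rdot (maxn N1 N2) mu + j%:R) :> K.
    by rewrite natrD; ring.
  by rewrite hk hj addr0.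
by rewrite ((pcharf0P K).1 char0) addn_eq0 => /andP[/eqP kk _]; rewrite kk in k0.
Qed.

Section Socle.

Local Notation S := (subm Inv).

(** The function has to be total on the Lie algebra, but only elements of l preserve
X^u; the default value s is never used for those. *)
Definition Inv_act (x : sp) (s : S) : S := insubd s (act x (val s)).

Lemma Inv_actE x s : x \in levi -> val (Inv_act x s) = act x (val s).
Proof. by move=> xl; rewrite insubdK//; apply: Inv_levi => //; exact: valP. Qed.

Lemma val_S_lin : linear (val : S -> X). Proof. exact: linearP. Qed.

Lemma Inv_rep : is_rep [set` levi] Inv_act.
Proof.
split=> [x xl c s t|c x y s xl yl|x y s xl yl]; apply: val_inj.
- by rewrite /= !(Inv_actE, val_S_lin)// (act_linear rep).
- by rewrite val_S_lin !Inv_actE//; [exact: (act_linearl rep)|exact: submod_lin].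
have e : act (bracket x y) (val s) = val (Inv_act x (Inv_act y s) - Inv_act y (Inv_act x s)).
  by rewrite (lin_sub val_S_lin) !Inv_actE// (act_bracket rep).
by rewrite -e insubdK// e; exact: valP.
Qed.

Lemma Inv_weight lam s : is_weight (fun i => act (H K i)) lam (val s) ->
  weight_space Inv_act lam s.
Proof.
by move=> sw i; apply: val_inj; rewrite Inv_actE ?levi_H// (lin_scale val_S_lin) sw.
Qed.

Lemma weight_Inv lam s : weight_space Inv_act lam s ->
  is_weight (fun i => act (H K i)) lam (val s).
Proof. by move=> sw i; rewrite -Inv_actE ?levi_H// sw (lin_scale val_S_lin). Qed.

Lemma Inv_weight_module : weight_module Inv_act.
Proof.
split=> [s|lam].
  suff [t tw /val_inj <- //] : exists2 t : S,
    t \in span (\bigcup_(lam in setT) weight_space Inv_act lam) & val t = val s.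
  apply: (@weight_sub_ind K X _ Hlin X_weights Inv (fun w => exists2 t : S,
    t \in span (\bigcup_(lam in setT) weight_space Inv_act lam) & val t = w)
    (H_stable Inv_levi) _ _ _ (val s) (valP s)).
  - by exists 0; [exact: rpred0|exact: (lin_zero val_S_lin)].
  - move=> c _ _ [u us <-] [v vs <-]; exists (c *: u + v); last exact: val_S_lin.
    exact: submod_lin.
  - move=> lam w wI ww; exists (Subm wI) => //; apply: sub_span.
    by exists lam => //; exact: Inv_weight.
have [_ [_ /(_ lam)[s sP]] _] := X_swm.
have [||W WP] := @submod_of_prop K X
    (fun v => v \in Inv /\ is_weight (fun i => act (H K i)) lam v).
- by split; [exact: rpred0|exact: is_weight0].
- by move=> c u v [? ?] [? ?]; split; [exact: submod_lin|exact: is_weight_lin].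
have [v /WP[_ vw]|t [tW tP]] := span_sub (W := W) (s := s); first exact: sP.
exists (pmap insub t) => v vw.
have : val v \in span [set` t].
  by apply: tP; apply/WP; split; [exact: valP|exact: weight_Inv].
suff H u : u \in span [set` t] ->
    exists2 u' : S, u' \in span [set` pmap insub t] & val u' = u.
  by move=> /H[u' u't /val_inj <-].
move: u; apply: span_ind => [|c x y [x' x't <-] [y' y't <-]|w wt].
- by exists 0; [exact: rpred0|exact: (lin_zero val_S_lin)].
- by exists (c *: x' + y'); [exact: submod_lin|exact: val_S_lin].
- have [wI _] := (WP w).1 (tW _ wt); exists (Subm wI) => //; apply: sub_span.
  by rewrite /= mem_pmap_sub.
Qed.

Hypothesis Inv_neq0 : exists2 v, v \in Inv & v <> 0.

Lemma Inv_swm : simple_weight_module [set` levi] Inv_act.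
Proof.
split; [exact: Inv_rep|exact: Inv_weight_module|split].
  have [v vI v0] := Inv_neq0; exists (Subm vI) => E; apply: v0.
  by have := congr1 val E; rewrite (lin_zero val_S_lin).
move=> N Nsub.
have [N' N'P] := image_submod N val_S_lin.
have [N0|] := pselect (forall v, v \in N -> v = 0); [by left|move=> nN0; right].
move=> s; suff /N'P[t tN /val_inj <- //] : val s \in N'.
apply: Inv_simple (valP s).
- by move=> _ /N'P[t _ <-]; exact: valP.
- move=> x _ xl /N'P[t tN <-]; apply/N'P; exists (Inv_act x t); last exact: Inv_actE.
  exact: Nsub.
apply: contrapT => no; apply: nN0 => v vN; apply: contrapT => v0; apply: no.
exists (val v); first by apply/N'P; exists v.
by move=> E; apply: v0; apply: val_inj; rewrite E (lin_zero val_S_lin).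
Qed.

(** The vectors with the height of a given weight vector form an l-submodule of X^u. *)
Lemma Inv_height : exists chi, forall v, v \in Inv -> eventually_height prec act chi v.
Proof.
have [lam [v [vI v0 vlam]]] := weight_exists Hlin X_weights (H_stable Inv_levi) Inv_neq0.
pose chi n := rdot n lam; exists chi.
have [||T TP] := @submod_of_prop K X
    (fun u => u \in Inv /\ eventually_height prec act chi u).
- by split; [exact: rpred0|exact: eventually_height0].
- move=> c a b [? ?] [? ?]; split; first exact: submod_lin.
  exact: eventually_height_lin.
move=> w wI; suff /TP[] : w \in T by [].
apply: Inv_simple wI => [u /TP[]//|x u xl uT|].
  apply: (levi_act_ind char0) xl => // a b ab.
  have [uN uh] := (TP _).1 uT; apply/TP; split.
    by apply: Inv_levi => //; exact: root_vec_levi.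
  exact: eventually_height_level.
by exists v => //; apply/TP; split=> //; exact: eventually_height_weight.
Qed.

Local Notation M := (induced [set` levi] [set` nilradical] Inv_act).
Local Notation actM := (@induced_act K sp [set` levi] [set` nilradical] S Inv_act).
Local Notation top := (tens [set` levi] [set` nilradical] Inv_act 1).

Let repM : is_rep setT actM. Proof. exact: induced_is_rep. Qed.

Lemma top_lin : linear top. Proof. exact: tens_linearr. Qed.

Lemma top_parabolic x y s : x \in levi -> y \in nilradical ->
  actM (x + y) (top s) = top (Inv_act x s).
Proof.
move=> xl yu; apply: etrans (induced_actE _ _ _ _ _ _) _.
have -> : iota (x + y) * 1 = 1 * iota (x + y) :> U sp by rewrite mulr1 mul1r.
exact: tens_balanced.
Qed.

Lemma top_levi x s : x \in levi -> actM x (top s) = top (Inv_act x s).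
Proof. by move=> xl; rewrite -{1}[x]addr0; apply: top_parabolic => //; exact: rpred0. Qed.

Lemma top_nilradical x s : x \in nilradical -> actM x (top s) = 0.
Proof.
have l0 : 0 \in levi by exact: rpred0.
move=> xu; rewrite -{1}[x]add0r; apply: etrans (top_parabolic _ _ _) _ => //.
have -> : Inv_act 0 s = 0; last exact: (lin_zero top_lin).
apply: val_inj; rewrite Inv_actE// (lin_zero val_S_lin).
exact: (lin_zero (act_linearl rep _)).
Qed.

Lemma M_has_top chi : (forall v, v \in Inv -> eventually_height prec act chi v) ->
  forall m, exists s, exists N0, forall N, (N0 <= N)%N ->
    exists2 ks, all (leq 1) ks & drop_op prec actM chi N ks (m - top s) = 0.
Proof.
move=> hchi m.
have [||T TP] := @submod_of_prop K M (fun m => exists s, m = top s).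
- by exists 0; exact/esym/(lin_zero top_lin).
- by move=> c _ _ [s ->] [t ->]; exists (c *: s + t); exact/esym/top_lin.
have Tl x u : x \in levi -> u \in T -> actM x u \in T.
  by move=> xl /TP[s ->]; apply/TP; exists (Inv_act x s); exact: top_levi.
have Tn x u : x \in nilradical -> u \in T -> actM x u = 0.
  by move=> xu /TP[s ->]; exact: top_nilradical.
have Th u : u \in T -> eventually_height prec actM chi u.
  move=> /TP[s ->]; have [N0 h0] := hchi _ (valP s); exists N0 => N /h0 hN.
  have hl : height_elt N \in levi.
    by apply: rpred_sum => i _; apply: rpredZ; exact: levi_H.
  apply: etrans (top_levi _ hl) _; rewrite -(lin_scale top_lin); congr (top _).
  by apply: val_inj; rewrite Inv_actE// hN (lin_scale val_S_lin).
have [n nm] : exists n, lowered prec actM T n m.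
  apply: lowered_all => // N Nsub TN; apply: induced_gen => // s.
  by apply: TN; apply/TP; exists s.
have [t /TP[s ->] [N0 h0]] : has_top prec actM T chi m by apply: lowered_has_top nm.
by exists s, N0.
Qed.

(** Uniqueness of the simple quotient: if the map phi to [X] does not vanish on a
submodule N', then phi maps N' onto [X] and some n in N' is sent to a nonzero w in
X^u. The top component of n has the same image, so it is 1 tensor w; as it is
obtained from n by operators of the Lie algebra, it lies in N', and simplicity of
X^u gives all of 1 tensor X^u, which generates. *)
Lemma invariant_aligned : aligned [set` levi] [set` nilradical] act.
Proof.
split=> //; exists S, Inv_act; split; first exact: Inv_swm.
have [||phi [phiact phitop]] := @induced_univ K sp [set` levi] [set` nilradical]
    S Inv_act X act val rep val_S_lin.
- by move=> x s xl; exact: Inv_actE.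
- by move=> y s yu; have /InvP := valP s; exact.
have [||N NP] := @submod_of_prop K M (fun m => phi m = 0).
- exact: linear0.
- by move=> c u v hu hv; rewrite linearP hu hv scaler0 addr0.
have Nsub : submodule setT actM N.
  by move=> x m _ /NP m0; apply/NP; rewrite phiact m0 (lin_zero (act_linear rep x)).
have phisurj v : exists m, phi m = v.
  have [||Y YP] := @submod_of_prop K X (fun v => exists m, phi m = v).
  - by exists 0; exact: linear0.
  - by move=> c _ _ [u <-] [w <-]; exists (c *: u + w); rewrite linearP.
  apply/YP; apply: X_generated => [x _ _ /YP[m <-]|].
    by apply/YP; exists (actM x m); exact: phiact.
  have [w wI w0] := Inv_neq0; exists w => //; apply/YP.
  by exists (top (Subm wI)); exact: phitop.
have [g gE] := @lquot_lift K M X N phi (linearP phi) (fun v vN => (NP v).1 vN).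
have giso : module_iso (fun x => quot_map (N := N) (actM x)) act.
  have ginj : injective g.
    elim/quot_ind=> u; elim/quot_ind=> w; rewrite !gE => uw.
    by apply/eqP; rewrite lquot_eq; apply/NP; rewrite linearB uw subrr.
  have [|k gk] := @choice X (lquot N) (fun v q => g q = v).
    by move=> v; have [m <-] := phisurj v; exists (\pi_(lquot N) m).
  exists g; split; first by exists k => // q; apply: ginj; rewrite gk.
  move=> x; apply: quot_ind => m.
  by rewrite (quot_actE repM)// !gE phiact.
have Nsimple : simple setT (fun x => quot_map (N := N) (actM x)).
  by apply: simple_of_iso giso _; case: X_swm.
exists N; split=> // N' [N'sub N'simple].
suff N'N m : m \in N' -> m \in N.
  have [NN'|Nall] := simple_quotient_max repM N'sub N'simple Nsub N'N.
    by move=> m; apply/idP/idP => [/N'N|/NN'].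
  by case: (simple_quotient_proper Nsimple).
move=> mN'; apply: contrapT => mN; apply: (simple_quotient_proper N'simple).
have [w wI w0] := Inv_neq0; pose s := Subm wI.
have [Y YP] := image_submod N' (linearP phi).
have /YP[n nN' phin] : w \in Y.
  apply: X_generated => [x _ _ /YP[v vN <-]|].
    by apply/YP; exists (actM x v); [exact: N'sub|exact: phiact].
  by exists (phi m); [apply/YP; exists m|move=> /NP].
have [chi hchi] := Inv_height.
have [t [N0 h0]] := M_has_top hchi n.
have [N1 h1] := hchi _ (valP t); have [N2 h2] := hchi _ wI.
have [r [r0 r1 r2]] : exists r, [/\ (N0 <= r)%N, (N1 <= r)%N & (N2 <= r)%N].
  by exists (maxn N0 (maxn N1 N2)); rewrite !leq_max !leqnn ?orbT.
have {h0} [ks kp ks0] := h0 r r0; have {h1} h1 := h1 r r1; have {h2} h2 := h2 r r2.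
have k0 := natprod_neq0 kp.
have phi_drop u : phi (drop_op prec actM chi r ks u) = drop_op prec act chi r ks (phi u).
  elim: (ks) => //= k ls IH.
  by rewrite linearB linearZ/= phiact IH.
have drop_chi (V : lmodType K) (actV : sp -> V -> V) v : is_rep setT actV ->
    actV (height_elt r) v = chi r *: v ->
    drop_op prec actV chi r ks v = (\prod_(k <- ks) k%:R) *: v.
  move=> repV /(drop_op_scalar repV chi ks) ->; congr (_ *: _).
  by apply: eq_bigr => k _; rewrite subrr add0r.
(* The difference w - t has constant height chi, where the annihilating product is
   a nonzero scalar. *)
have tw : val t = w.
  have := congr1 phi ks0; rewrite phi_drop linear0 linearB phin phitop.
  rewrite drop_chi//; last first.
    by rewrite (lin_sub (act_linear rep _)) h1 h2 scalerBr.
  move=> /eqP; rewrite scaler_eq0 (negPf k0) subr_eq0 => /eqP ->; by [].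
have hl : height_elt r \in levi.
  by apply: rpred_sum => i _; apply: rpredZ; exact: levi_H.
have topN' : top t \in N'.
  have : drop_op prec actM chi r ks n \in N'.
    elim: (ks) => //= k ls IH; apply: submod_sub; last exact: rpredZ.
    exact: N'sub.
  have -> : drop_op prec actM chi r ks n = (\prod_(k <- ks) k%:R) *: top t.
    have -> : drop_op prec actM chi r ks n = drop_op prec actM chi r ks (top t).
      move: ks0; rewrite (lin_sub (drop_op_linear prec repM chi r ks)) => /eqP.
      by rewrite subr_eq0 => /eqP.
    apply: drop_chi => //.
    apply: etrans (top_levi _ hl) _; rewrite -(lin_scale top_lin); congr (top _).
    by apply: val_inj; rewrite Inv_actE// h1 (lin_scale val_S_lin).
  by move=> /(rpredZ (\prod_(k <- ks) k%:R)^-1); rewrite scalerA mulVf// scale1r.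
have [_ _ [_ /(_ _)]] := Inv_swm.
have [||Q QP] := @submod_of_prop K S (fun s => top s \in N').
- by have -> : top 0 = 0 by [exact: (lin_zero top_lin)]; exact: rpred0.
- move=> c u v uN vN; have -> : top (c *: u + v) = c *: top u + top v by exact: top_lin.
  exact: submod_lin uN vN.
move=> /(_ Q)[x u xl /QP uQ|Q0|Qall].
- by apply/QP; have <- := top_levi u xl; exact: N'sub.
- have t0 : t = 0 by apply/Q0/QP.
  by case: w0; rewrite -tw t0 (lin_zero val_S_lin).
- by apply: (induced_gen N'sub) => u; exact: (QP u).1 (Qall u).
Qed.

End Socle.
End Invariants.

(** The module S of the definition of aligned can always be taken to be the space of
all vectors killed by the nilradical. *)
Theorem aligned_iff_invariant : aligned [set` levi] [set` nilradical] act <->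
  exists v, v <> 0 /\ forall x, x \in nilradical -> act x v = 0.
Proof.
split=> [|[v [v0 vu]]]; first exact: aligned_nil_invariant.
have [||Inv InvP] := @submod_of_prop K X (fun v => forall x, x \in nilradical -> act x v = 0).
- by move=> x _; exact: (lin_zero (act_linear rep x)).
- by move=> c u w uu wu x xu; rewrite (act_linear rep) uu// wu// scaler0 addr0.
apply: (invariant_aligned InvP); by exists v => //; apply/InvP.
Qed.

End Aligned.

(** * The oscillator representation *)

Section Weyl.
Variables (K : fieldType).
Hypothesis char0 : [pchar K] =i pred0.

Local Notation sp := (sp K).
(* The free module on the exponents, of which mons K is another name. *)
Local Notation mons := {malg K[nat -> K]}.
Local Notation seps := (seps K).
Local Notation sgn := (sgn K).
Local Notation root_mx := (root_mx K).
Implicit Types f : mons.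

Let two0 : (2 : K) != 0. Proof. exact: two_neq0. Qed.

Lemma regroup2 (V : lmodType K) (p q : K) (g1 g2 g3 g4 : V) :
  g1 + (p *: g4 + q *: g3) + (g2 + (q *: g3 + p *: g4)) =
  g1 + g2 + (2 * q) *: g3 + (2 * p) *: g4.
Proof.
have E (k : K) : 2 * k = k + k by ring.
by rewrite addrACA [p *: g4 + _]addrC [X in _ + X]addrACA -!scalerDl -!E addrA.
Qed.

Lemma scale_sum4 (V : lmodType K) (r p1 p2 p3 p4 : K) (u1 u2 u3 u4 : V) :
  r *: (p1 *: u1 + p2 *: u2 + (p3 *: u3 + p4 *: u4)) =
  (r * p1) *: u1 + (r * p2) *: u2 + ((r * p3) *: u3 + (r * p4) *: u4).
Proof. by rewrite !scalerDr !scalerA. Qed.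

Lemma regroup4 (V : zmodType) (u v x1 x2 x3 x4 y1 y2 y3 y4 : V) :
  u + (x1 + x2 + (x3 + x4)) + (v + (y3 + y4 + (y1 + y2))) - (u + v) =
  x1 + y1 + (x2 + y2) + (x3 + y3 + (x4 + y4)).
Proof.
rewrite addrACA [u + v + _]addrC addrK [y3 + y4 + _]addrC addrACA.
by congr (_ + _); rewrite addrACA.
Qed.

(** The multiplications x_i and derivations d_i as one family on the signed indices;
each shifts exponents by the weight seps a of its index. *)
Definition osc (a : idx) : mons -> mons :=
  match a with inl i => @x_ K i | inr i => @d_ K i end.

Lemma osc_linear a : linear (osc a).
Proof. by case: a => i; exact: lext_is_linear. Qed.

Definition osc_coef (a : idx) (lam : nat -> K) : K :=
  match a with inl _ => 1 | inr i => lam i end.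

Lemma osc_mon a lam : osc a (mon lam) = osc_coef a lam *: mon (lam + seps a).
Proof. by case: a => i /=; rewrite /x_ /d_ lextU ?scale1r. Qed.

(** The constants of the canonical commutation relations. *)
Definition ccr (a b : idx) : K := if b == opp a then - sgn a else 0.

Lemma osc_ccr a b f : osc a (osc b f) = osc b (osc a f) + ccr a b *: f.
Proof.
elim/malg_ind: f => [|c f g IHf IHg|lam].
- by rewrite !(lin_zero (osc_linear _)) scaler0 addr0.
- rewrite !(osc_linear _ c) IHf IHg; exact: regroup_scale.
rewrite -/(mon lam) !osc_mon !(lin_scale (osc_linear _)) !osc_mon !scalerA.
rewrite /ccr; case: eqP => [->|ne]; last first.
  rewrite scale0r addr0 addrAC; congr (_ *: _).
  case: a b ne => i [] j ne /=; rewrite ?mulr1 ?mul1r// /eps !fctE.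
  - by case: eqP => [ji|_]; rewrite ?addr0//; case: ne; rewrite ji.
  - by case: eqP => [ji|_]; rewrite ?addr0//; case: ne; rewrite ji.
  - by rewrite eq_sym; case: eqP => [->|_]; rewrite ?subr0; rewrite mulrC.
rewrite seps_opp addrK subrK -scalerDl; congr (_ *: _).
by case: a => i /=; rewrite /eps !fctE eqxx /= ?mulr1n; ring.
Qed.

Definition anticomm a b f : mons := osc a (osc b f) + osc b (osc a f).

Lemma anticomm_linear a b : linear (anticomm a b).
Proof.
move=> c f g; rewrite /anticomm !osc_linear scalerDr -!addrA; congr (_ + _).
by rewrite addrCA.
Qed.

Lemma anticomm_osc a b c f : anticomm a b (osc c f) =
  osc c (anticomm a b f) + (2 * ccr b c) *: osc a f + (2 * ccr a c) *: osc b f.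
Proof.
have E p q : osc p (osc q (osc c f)) =
    osc c (osc p (osc q f)) + (ccr p c *: osc q f + ccr q c *: osc p f).
  rewrite (osc_ccr q c) (lin_add (osc_linear p)) (lin_scale (osc_linear p)).
  by rewrite (osc_ccr p c) addrA.
rewrite /anticomm !E (lin_add (osc_linear c)).
exact: regroup2.
Qed.

Lemma anticomm_bracket a b c d f :
  anticomm a b (anticomm c d f) - anticomm c d (anticomm a b f) =
  (2 * ccr b d) *: anticomm c a f + (2 * ccr a d) *: anticomm c b f +
  ((2 * ccr b c) *: anticomm a d f + (2 * ccr a c) *: anticomm b d f).
Proof.
have E p q : anticomm a b (osc p (osc q f)) = osc p (osc q (anticomm a b f)) +
    ((2 * ccr b q) *: osc p (osc a f) + (2 * ccr a q) *: osc p (osc b f) +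
     ((2 * ccr b p) *: osc a (osc q f) + (2 * ccr a p) *: osc b (osc q f))).
  rewrite anticomm_osc anticomm_osc !(lin_add (osc_linear p)).
  by rewrite !(lin_scale (osc_linear p)) !addrA.
have -> : anticomm a b (anticomm c d f) =
    anticomm a b (osc c (osc d f)) + anticomm a b (osc d (osc c f)).
  exact: (lin_add (anticomm_linear a b)).
rewrite !E; move: (anticomm a b f) => g; rewrite /anticomm.
rewrite !scalerDr; exact: regroup4.
Qed.

(** In symmetrized form the operators of sp are quadratic without constant terms;
in particular the 1/2 added to x_i d_i disappears. *)
Definition quad a b f : mons := (2^-1 * sgn a) *: anticomm a (opp b) f.

Lemma weyl_root a b f : weyl (root_mx a b) f = quad a b f.
Proof.
have -> : weyl (root_mx a b) f =
    weyl_elmx (a, b) f - (sgn a * sgn b) *: weyl_elmx (opp b, opp a) f.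
  rewrite /weyl /root_mx (lin_sub (lext_is_linear _)) (lin_scale (lext_is_linear _)).
  by rewrite !lextU.
have cE i j : ccr (inr i) (inl j) = (i == j)%:R :> K.
  rewrite /ccr /= -[inl j == inl i]/(j == i) eq_sym opprK.
  by case: eqP.
rewrite /quad /anticomm; case: a b => i [] j /=.
- have /= -> := osc_ccr (inr j) (inl i) f.
  rewrite mul1r mulr1 scaler0 subr0 cE; move: (x_ i (d_ j f)) => g.
  apply/malgP => k; rewrite eq_sym.
  by case: eqP => _; rewrite !(mcoeffD, mcoeffZ, mcoeff0) /= ?mulr1n ?mulr0n; field.
- by rewrite mulr1 mul1r scaleN1r opprK -scalerDr.
- by rewrite mulr1 !mulrN1 !scaleN1r scaleNr scalerDr opprD opprK.
- have /= -> := osc_ccr (inr i) (inl j) f.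
  rewrite mulrNN mulr1 scale1r sub0r cE; move: (x_ j (d_ i f)) => g.
  apply/malgP => k; rewrite eq_sym.
  by case: eqP => _; rewrite !(mcoeffD, mcoeffN, mcoeffZ, mcoeff0) /= ?mulr1n ?mulr0n; field.
Qed.

Definition quad_mx (B : finmx K idx) f : mons := lext (fun cd => quad cd.1 cd.2 f) B.

Lemma quad_linear a b : linear (quad a b).
Proof.
move=> c f g; rewrite /quad anticomm_linear scalerDr !scalerA.
by rewrite [_ * c]mulrC.
Qed.

Lemma weyl_linear A : linear (@weyl K A : mons -> mons).
Proof.
have lw ab : linear (@weyl_elmx K ab : mons -> mons).
  have lx i c f g : x_ i (c *: f + g) = c *: x_ i f + x_ i g := osc_linear (inl i) c f g.
  have ld i c f g : d_ i (c *: f + g) = c *: d_ i f + d_ i g := osc_linear (inr i) c f g.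
  case: ab => [[i|i] [j|j]] c f g; rewrite /weyl_elmx.
  - rewrite (ld j c f g) (lx i c (d_ j f)).
    move: (x_ i (d_ j f)) (x_ i (d_ j g)) => p q.
    case: eqP => _; last by rewrite !addr0.
    by rewrite !scalerDr !scalerA [2^-1 * c]mulrC addrACA.
  - rewrite (lx j c f g) (lx i c (x_ j f)).
    by rewrite scalerDr !scalerA mulrC.
  - rewrite (ld j c f g) (ld i c (d_ j f)).
    by rewrite scalerDr opprD scalerN !scalerA mulrC.
  - by rewrite scaler0 addr0.
exact: (lext_param_linear A lw).
Qed.

Lemma weyl_linearl f : linear (fun x : sp => weyl (spmx x) f).
Proof. by move=> c x y; rewrite spmx_lin /weyl lext_is_linear. Qed.

(** The right-hand side makes sense for all finitary matrices, so that the bracket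
with a root vector can be checked on the elementary matrices. *)
Lemma weyl_quad_mx (x : sp) f : weyl (spmx x) f = 2^-1 *: quad_mx (spmx x) f.
Proof.
rewrite {1}(root_decomp char0 x) (lin_sum (weyl_linearl f)) /quad_mx lextE scaler_sumr.
apply: eq_bigr => -[a b] _; rewrite (lin_scale (weyl_linearl f)) /= weyl_root.
exact/esym/scalerA.
Qed.

Lemma commfmx_root_elmx a b c d : commfmx (root_mx a b) (elmx K c d) =
  (b == c)%:R *: elmx K a d - (sgn a * sgn b * (opp a == c)%:R) *: elmx K (opp b) d
  - ((d == a)%:R *: elmx K c b - (sgn a * sgn b * (d == opp b)%:R) *: elmx K c (opp a)).
Proof.
have E p q r s : mulfmx (elmx K p q) (elmx K r s) = (q == r)%:R *: elmx K p s.
  by rewrite mul_elmx; case: eqP; rewrite ?scale1r ?scale0r.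
rewrite /commfmx /root_mx (lin_sub (mulfmx_linearl _)) (lin_sub (mulfmx_linearr _)).
by rewrite mulfmxZl mulfmxZr !E !scalerA.
Qed.

(** For B = E_cd both sides have four terms, one for each way in which an index of
the first operator can be contracted with one of the second. *)
Lemma quad_bracket a b B f :
  quad_mx (commfmx (root_mx a b) B) f = quad a b (quad_mx B f) - quad_mx B (quad a b f).
Proof.
elim/malg_ind: B => [|k A B IHA IHB|[c d]].
- rewrite (lin_zero (commfmx_linearr _)) /quad_mx !(lin_zero (lext_is_linear _)).
  by rewrite (lin_zero (quad_linear a b)) subrr.
- rewrite commfmx_linearr /quad_mx !lext_is_linear -!/(quad_mx _ _) IHA IHB.
  rewrite quad_linear scalerBr opprD !addrA; congr (_ + _).
  by rewrite addrAC.
have QE p q g : quad_mx (elmx K p q) g = quad p q g by rewrite /quad_mx lextU.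
have [Q [QL QE']] : exists Q : finmx K idx -> mons, linear Q /\ forall A, quad_mx A f = Q A.
  by exists (quad_mx^~ f); split=> // k A B; exact: lext_is_linear.
have QB k1 k2 A1 A2 : Q (k1 *: A1 - k2 *: A2) = k1 *: Q A1 - k2 *: Q A2.
  by rewrite (lin_sub QL) (lin_scale QL k1) (lin_scale QL k2).
have Q4 k1 k2 k3 k4 A1 A2 A3 A4 : Q (k1 *: A1 - k2 *: A2 - (k3 *: A3 - k4 *: A4)) =
    k1 *: Q A1 - k2 *: Q A2 - (k3 *: Q A3 - k4 *: Q A4).
  by rewrite (lin_sub QL); congr (_ - _); exact: QB.
have Qelmx p q : Q (elmx K p q) = quad p q f by rewrite -QE' QE.
apply: etrans (QE' _) _; apply: etrans (congr1 Q (commfmx_root_elmx a b c d)) _.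
apply: etrans (Q4 _ _ _ _ _ _ _ _) _; rewrite !Qelmx.
apply: etrans _ (esym (congr2 (fun g h => quad a b g - h) (QE c d f) (QE c d _))).
have eqO p q : (opp p == opp q) = (p == q) by rewrite (inj_eq (inv_inj oppK)).
(* The scalars of the four contractions. *)
pose r : K := 2^-1 * sgn a * (2^-1 * sgn c).
have Ebd : r * (2 * ccr (opp b) (opp d)) =
    sgn a * sgn b * (d == opp b)%:R * (2^-1 * sgn c).
  rewrite /r /ccr eqO sgn_opp opprK.
  case: eqP => _; last by rewrite !mulr0 mul0r.
  by move: (sgn a) (sgn b) (sgn c) => x y z /=; rewrite mulr1; field.
have Ead : r * (2 * ccr a (opp d)) = - ((d == a)%:R * (2^-1 * sgn c)).
  rewrite /r /ccr eqO; case: eqP => _; last by rewrite !mulr0 mul0r oppr0.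
  have := sgn_sq K a; move: (sgn a) (sgn c) => x y xx.
  have -> : 2^-1 * x * (2^-1 * y) * (2 * - x) = - (x * x * (2^-1 * y)) by field.
  by rewrite xx.
have Ebc : r * (2 * ccr (opp b) c) = (b == c)%:R * (2^-1 * sgn a).
  rewrite /r /ccr oppK sgn_opp opprK eq_sym.
  case: eqP => [<-|_]; last by rewrite !mulr0 mul0r.
  have := sgn_sq K b; move: (sgn a) (sgn b) => x y yy.
  have -> : 2^-1 * x * (2^-1 * y) * (2 * y) = y * y * (2^-1 * x) by field.
  by rewrite yy.
have Eac : r * (2 * ccr a c) =
    - (sgn a * sgn b * (opp a == c)%:R * (2^-1 * sgn (opp b))).
  rewrite /r /ccr eq_sym; case: eqP => [<-|_]; last by rewrite !mulr0 mul0r oppr0.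
  rewrite !sgn_opp; have := sgn_sq K a; have := sgn_sq K b.
  move: (sgn a) (sgn b) => x y yy xx /=.
  have -> : 2^-1 * x * (2^-1 * - x) * (2 * - x) = 2^-1 * (x * x * x) by field.
  have -> : - (x * y * 1%:R * (2^-1 * - y)) = 2^-1 * (y * y * x) by rewrite mulr1; ring.
  by rewrite xx yy.
transitivity (r *: (anticomm a (opp b) (anticomm c (opp d) f) -
                    anticomm c (opp d) (anticomm a (opp b) f))).
  rewrite anticomm_bracket; apply: etrans _ (esym (scale_sum4 _ _ _ _ _ _ _ _ _)).
  by rewrite Ebd Ead Ebc Eac /quad !oppK !scalerA opprB [LHS]addrC -!scaleNr.
apply: etrans (scalerBr _ _ _) _; rewrite /r.
rewrite /quad (lin_scale (anticomm_linear a (opp b))) (lin_scale (anticomm_linear c (opp d))).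
by rewrite !scalerA [X in _ - X *: _]mulrC.
Qed.

Lemma weyl_bracket (x y : sp) f :
  weyl (spmx (bracket x y)) f =
  weyl (spmx x) (weyl (spmx y) f) - weyl (spmx y) (weyl (spmx x) f).
Proof.
apply: (@sp_ind_supp K char0 (fun x => weyl (spmx (bracket x y)) f =
  weyl (spmx x) (weyl (spmx y) f) - weyl (spmx y) (weyl (spmx x) f)) x).
- rewrite (lin_zero (bracket_linearl y)) !(lin_zero (weyl_linearl _)).
  by rewrite (lin_zero (weyl_linear _)) subrr.
- move=> c z t IHz IHt; rewrite bracket_linearl !weyl_linearl IHz IHt weyl_linear.
  by rewrite scalerBr opprD addrACA.
move=> a b _; rewrite (weyl_quad_mx (bracket _ _)) (weyl_quad_mx y f).
rewrite (lin_scale (weyl_linear _)) (weyl_quad_mx y (weyl _ f)) -scalerBr.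
by rewrite !weyl_root quad_bracket.
Qed.

End Weyl.
Section QuotientRep.
Variables (K : fieldType) (L : lieAlgType K) (M : lmodType K) (act : L -> M -> M).
Hypothesis rep : is_rep setT act.

Lemma quot_rep (N : submodClosed M) : submodule setT act N ->
  is_rep setT (fun x => quot_map (N := N) (act x)).
Proof.
move=> Nsub; have E x m := quot_actE rep x m Nsub.
split=> [x _ c|c x y q _ _|x y q _ _].
- apply: quot_ind => u; apply: quot_ind => v.
  by rewrite -lquot_pi_linear !E (act_linear rep) lquot_pi_linear.
- move: q; apply: quot_ind => u; rewrite !E.
  by rewrite (act_linearl rep u) lquot_pi_linear.
- move: q; apply: quot_ind => u; rewrite !E (act_bracket rep).
  by rewrite (lin_sub (@lquot_pi_linear K M N)).
Qed.

End QuotientRep.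

(** * Unit steps and the sets of integral positions *)

Section Signs.
Variables (K : fieldType).
Hypothesis char0 : [pchar K] =i pred0.
Local Notation seps := (seps K).
Implicit Types lam mu : nat -> K.

(** The exponent seen from the signed index a: exchanging x_i and d_i (up to sign) is
a symmetry of the oscillator representation that maps lam_i to -1 - lam_i. Raising
lam at a changes Int^+ exactly when nu lam a = -1. *)
Definition nu lam (a : idx) : K :=
  match a with inl i => lam i | inr i => -1 - lam i end.

Lemma nu_opp lam a : nu lam (opp a) = -1 - nu lam a.
Proof. by case: a => i //=; rewrite opprB addrCA subrr addr0. Qed.

Lemma nu_eq lam lam' a : lam (supp_idx a) = lam' (supp_idx a) -> nu lam a = nu lam' a.
Proof. by case: a => i /= ->. Qed.

Lemma seps_ne a i : i <> supp_idx a -> seps a i = 0.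
Proof. by case: a => j /= /eqP ij; rewrite ?fctE /eps (negPf ij) ?oppr0. Qed.

Lemma nu_step lam a : nu (lam + seps a) a = nu lam a + 1.
Proof.
case: a => i /=; rewrite ?fctE /eps eqxx //=.
by rewrite mulr1n opprD opprK addrA.
Qed.

Lemma nu_step_ne lam a c : supp_idx c <> supp_idx a -> nu (lam + seps a) c = nu lam c.
Proof. by move=> ca; apply: nu_eq; rewrite fctE seps_ne// addr0. Qed.

Lemma natr_inj (m n : nat) : m%:R = n%:R :> K -> m = n.
Proof.
rewrite -[m%:R]/(m%:Z%:~R) -[n%:R]/(n%:Z%:~R) => /(intr_inj char0).
by case.
Qed.

Lemma nat_not_neg (m n : nat) : n%:R <> - m.+1%:R :> K.
Proof.
move=> /eqP; rewrite -subr_eq0 opprK -natrD -[0](mulr0n 1) => /eqP /natr_inj.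
by rewrite addnS.
Qed.

Lemma IntP_step lam a : nu lam a <> -1 -> IntP (lam + seps a) = IntP lam.
Proof.
move=> nua; apply/seteqP; split=> k [n kn]; rewrite /IntP/=; move: kn.
  have [->|ka] := pselect (k = supp_idx a); last first.
    by rewrite fctE seps_ne// addr0 => ->; exists n.
  case: a nua => i /= nua; rewrite !fctE /eps eqxx /= => kn; last first.
    by exists n.+1; rewrite -natr1 -kn subrK.
  case: n kn => [|n] kn; last by exists n; apply: (addIr 1); rewrite kn natr1.
  by case: nua; apply: (addIr 1); rewrite kn addNr.
have [->|ka] := pselect (k = supp_idx a); last first.
  by move=> kn; rewrite fctE seps_ne// addr0; exists n.
case: a nua => i /= nua kn; rewrite !fctE /eps eqxx /= kn.
  by exists n.+1; rewrite natr1.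
case: n kn => [|n] kn; last by exists n; rewrite -natr1 addrK.
by case: nua; rewrite kn subr0.
Qed.

Lemma IntP_cross lam lam' a (m n : nat) :
  nu lam a = - m.+1%:R -> nu lam' a = n%:R -> IntP lam <> IntP lam'.
Proof.
case: a => i /= lami lami' E.
  have : IntP lam i by rewrite E; exists n.
  by case=> k; rewrite lami => /esym; exact: nat_not_neg.
have : IntP lam' i.
  rewrite -E; exists m; apply: oppr_inj; apply: (addrI (-1)).
  by rewrite lami -opprD nat1r.
case=> k lamk; apply: (@nat_not_neg k n); rewrite -lami' lamk.
by rewrite -opprD nat1r.
Qed.

Lemma parity_step lam mu a b : int_seq_parity b (lam - mu) ->
  int_seq_parity (~~ b) (lam + seps a - mu).
Proof.
case: a => i; [apply: (@int_seq_parity_shift K b _ _ i 1)|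
               apply: (@int_seq_parity_shift K b _ _ i (-1))] => // k;
  by rewrite !fctE ?mulrN ?mulr1 addrAC.
Qed.

(** A single step changes the parity, hence steps come in pairs. *)
Lemma sim_step2 lam mu a c : sim lam mu -> nu lam c <> -1 ->
  nu (lam + seps c) a <> -1 -> sim (lam + seps c + seps a) mu.
Proof.
move=> [lp lI] nc na; split; first exact: (parity_step a (parity_step c lp)).
by rewrite IntP_step// IntP_step.
Qed.

Lemma int_seq_parityN b lam : int_seq_parity b lam -> int_seq_parity b (- lam).
Proof.
move=> [m [n [m0 lamE odd_m]]]; exists (fun i => - m i), n; split=> [i /m0 ->|i|].
- by rewrite oppr0.
- by rewrite fctE lamE rmorphN.
- by rewrite sumrN abszN.
Qed.

Lemma sim_sym lam mu : sim lam mu -> sim mu lam.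
Proof.
move=> [p E]; split; last exact/esym.
by have := int_seq_parityN p; rewrite opprB.
Qed.

(** The integer sequence underlying seps a. *)
Definition dirz (a : idx) (k : nat) : int :=
  match a with inl i => (k == i)%:Z | inr i => - (k == i)%:Z end.

Lemma dirzE a k : (dirz a k)%:~R = seps a k.
Proof. by case: a => i /=; rewrite ?fctE ?rmorphN /eps; case: eqP. Qed.

(** If lam and lam' have the same Int^+, then at each position both are on the same
side of the gap between -1 and 0, and a unit step towards lam' does not cross it.
The last condition says that the step goes in the direction of the difference m. *)
Lemma step_toward lam lam' n (m : nat -> int) : IntP lam = IntP lam' ->
  (forall i, lam' i - lam i = (m i)%:~R) -> (forall i, (n <= i)%N -> m i = 0) ->
  (\sum_(i < n) `|m i| != 0)%N -> exists a,
  [/\ nu lam a <> -1, (supp_idx a < n)%N,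
      (\sum_(i < n) `|m i - dirz a i| < \sum_(i < n) `|m i|)%N
    & (0 < m (supp_idx a) * dirz a (supp_idx a))%R].
Proof.
move=> E mE m0 sm; have [i mi] : exists i : 'I_n, m i != 0.
  apply: contrapT => no; case/negP: sm; rewrite sum_nat_eq0; apply/forallP => i /=.
  by apply/negPn/negP => mi; apply: no; exists i; rewrite absz_eq0 in mi.
have dec a : supp_idx a = i :> nat -> (`|m i - dirz a i| < `|m i|)%N ->
    (\sum_(i < n) `|m i - dirz a i| < \sum_(i < n) `|m i|)%N.
  move=> ai lt; rewrite (bigD1 i)//= [X in (_ < X)%N](bigD1 i)//= -addSn leq_add//.
  apply: leq_sum => k ki; suff -> : dirz a k = 0 by rewrite subr0.
  have : (k == i :> nat) = false by apply: negbTE; rewrite -val_eqE in ki.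
  by case: a ai {lt} => j /= <- ->.
have lamE : lam' i = lam i + (m i)%:~R by rewrite -mE addrC subrK.
have [mpos|mneg] : (0 < m i)%R \/ (m i < 0)%R by lia.
- exists (inl (i : nat)); split; first 1 last; [exact: ltn_ord| | |].
  + by apply: dec; rewrite //= eqxx; lia.
  + by rewrite /= eqxx mulr1.
  + move=> /= lami; have : IntP lam' i.
      have [k Ek] : exists k : nat, m i = k%:Z + 1 by exists `|m i - 1|%N; lia.
      by exists k; rewrite lamE lami Ek rmorphD rmorph1 addrC addrK.
    by rewrite -E => -[k]; rewrite lami => /esym /(@nat_not_neg 0 k).
- exists (inr (i : nat)); split; first 1 last; [exact: ltn_ord| | |].
  + by apply: dec; rewrite //= eqxx; lia.
  + by rewrite /= eqxx; lia.
  + move=> /= lami; have lami0 : lam i = 0.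
      by apply: oppr_inj; apply: (addrI (-1)); rewrite lami oppr0 addr0.
    have : IntP lam i by exists 0%N; rewrite lami0.
    rewrite E => -[k]; rewrite lamE lami0 add0r => /esym.
    have -> : m i = - `|m i|.-1.+1%:Z by lia.
    by rewrite rmorphN; exact: nat_not_neg.
Qed.

Lemma odd_abs_sum n (m : nat -> int) :
  odd `|\sum_(i < n) m i| = odd (\sum_(i < n) `|m i|)%N.
Proof.
elim: n => [|n IH]; first by rewrite !big_ord0.
rewrite !big_ord_recr/= oddD -IH; move: (\sum_(i < n) m i) (m n) => s x; lia.
Qed.

Lemma big_ord_ext (m : nat -> int) n N : (n <= N)%N ->
  (forall i, (n <= i)%N -> m i = 0) -> \sum_(i < N) m i = \sum_(i < n) m i.
Proof.
move=> nN m0; rewrite -!(big_mkord xpredT m) (big_cat_nat _ nN)//=.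
by rewrite [X in _ + X]big_nat_cond [X in _ + X]big1 ?addr0// => k /andP[/andP[/m0]].
Qed.

Lemma parityD b b' lam lam' : int_seq_parity b lam -> int_seq_parity b' lam' ->
  int_seq_parity (b (+) b') (lam + lam').
Proof.
move=> [m [n [m0 mE mo]]] [m' [n' [m0' mE' mo']]].
exists (fun i => m i + m' i), (maxn n n'); split=> [i|i|].
- by rewrite geq_max => /andP[/m0 -> /m0' ->].
- by rewrite fctE mE mE' rmorphD.
rewrite big_split/= (big_ord_ext (leq_maxl n n') m0) (big_ord_ext (leq_maxr n n') m0').
rewrite -mo -mo'; move: (\sum_(i < n) m i) (\sum_(i < n') m' i) => x y; lia.
Qed.

Lemma sim_root_lattice lam lam' mu : sim lam mu -> sim lam' mu -> root_lattice (lam' - lam).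
Proof.
move=> [p _] [p' _]; have := parityD p' (int_seq_parityN p).
by rewrite opprB addrA subrK.
Qed.

Lemma dirz_sum n a : (supp_idx a < n)%N -> odd `|\sum_(i < n) dirz a i|.
Proof.
move=> an; rewrite (bigD1 (Ordinal an))//= big1 => [|i].
  by rewrite addr0; case: a {an} => i; rewrite /= eqxx.
rewrite -val_eqE /= => /negPf ia.
by case: a an ia => j an /= ->.
Qed.

Lemma dirz_step_odd n (m : nat -> int) a : (supp_idx a < n)%N ->
  odd (\sum_(i < n) `|(m i - dirz a i)%R|)%N = ~~ odd (\sum_(i < n) `|m i|)%N.
Proof.
move=> an; rewrite -(odd_abs_sum n (fun i => m i - dirz a i)) -odd_abs_sum sumrB.
have := dirz_sum an; move: (\sum_(i < n) m i) (\sum_(i < n) dirz a i) => x y; lia.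
Qed.

End Signs.

(** * The module X_sp(mu) *)

Section Xmodule.
Variables (K : fieldType) (mu : nat -> K).
Hypothesis char0 : [pchar K] =i pred0.

Local Notation mons := (mons K).
Local Notation seps := (seps K).
Local Notation sgn := (sgn K).
Local Notation root_vec := (root_vec K).
Local Notation Vmod := (Vmod mu).
Local Notation Xsp := (Xsp mu).
Local Notation Xact := (@Xsp_act K mu).
Local Notation Vact := (@Vmod_act K mu).
Implicit Types lam : nat -> K.

Lemma Vsp_supp mu' (f : mons) lam : f \in Vsp mu' -> f@_lam != 0 ->
  root_lattice (lam - mu') /\ IntP mu' `<=` IntP lam.
Proof.
move: f; apply: span_ind => [|c f g IHf IHg|_ [nu' nuP <-]].
- by rewrite mcoeff0 eqxx.
- rewrite mcoeffD mcoeffZ; case: (eqVneq (f@_lam) 0) => [f0|fn _]; last exact: IHf.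
  by rewrite f0 mulr0 add0r.
- by rewrite mcoeffU; case: (eqVneq nu' lam) => [<- //|_]; rewrite eqxx.
Qed.

Lemma Vsp_plus_supp (f : mons) lam : f \in Vsp_plus mu -> IntP lam = IntP mu -> f@_lam = 0.
Proof.
move=> fV E; move: f fV; apply: span_ind => [|c f g IHf IHg|f [_ [mu' [_ sub fV]]]].
- by rewrite mcoeff0.
- by rewrite mcoeffD mcoeffZ IHf IHg mulr0 addr0.
apply/eqP/negPn/negP => /(Vsp_supp fV)[_]; rewrite E => sub'.
by case: sub => _; exact.
Qed.

(** A position k gained by lam was a negative integer for mu, so Int^-(mu) is not
empty and V^+ is the sum of the V(mu') rather than 0. *)
Lemma mon_Vsp_plus lam : root_lattice (lam - mu) -> IntP mu `<=` IntP lam ->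
  IntP lam <> IntP mu -> mon lam \in Vsp_plus mu.
Proof.
move=> lp sub ne; apply: sub_span; split.
  have [k klam kmu] : exists2 k, IntP lam k & ~ IntP mu k.
    apply: contrapT => no; apply: ne; apply/seteqP; split=> // k klam.
    by apply: contrapT => kmu; apply: no; exists k.
  have [m [_ [_ mE _]]] := lp; have [n lamk] := klam.
  have muk : mu k = (n%:Z - m k)%:~R.
    by rewrite rmorphB/= -mE !fctE lamk opprB addrC subrK.
  have [neg|pos] : (n%:Z - m k < 0)%R \/ (0 <= n%:Z - m k)%R by lia.
    move=> IN; suff : IntN mu k by rewrite IN.
    exists `|n%:Z - m k|.-1; rewrite muk.
    have {1}-> : n%:Z - m k = - `|n%:Z - m k|.-1.+1%:Z by lia.
    by rewrite rmorphN.
  case: kmu; exists `|n%:Z - m k|%N; rewrite muk.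
  by have {1}-> : n%:Z - m k = `|n%:Z - m k|%N%:Z by lia.
exists lam; split.
- by have := int_seq_parityN lp; rewrite opprB.
- by split=> // sub'; apply: ne; apply/seteqP.
- by apply: sub_span; exists lam => //; split=> //; rewrite subrr; exists (fun=> 0), 0%N;
    split=> //; rewrite big_ord0.
Qed.

Lemma Vsp_plusP (f : mons) : f \in Vsp mu ->
  (forall lam, IntP lam = IntP mu -> f@_lam = 0) -> f \in Vsp_plus mu.
Proof.
move=> fV f0; rewrite [f]monalgE big_seq; apply: rpred_sum => lam.
rewrite -mcoeff_neq0 => flam; have [lp sub] := Vsp_supp fV flam.
have -> : << f@_lam *g lam >> = f@_lam *: mon lam.
  by apply/malgP => k; rewrite mcoeffZ !mcoeffU mulr_natr.
apply/rpredZ/mon_Vsp_plus => // E.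
by move: flam; rewrite f0// eqxx.
Qed.

Lemma weyl_lin x c (f g : mons) :
  weyl (spmx x) (c *: f + g) = c *: weyl (spmx x) f + weyl (spmx x) g.
Proof. exact: weyl_linear. Qed.

Lemma weyl_Vsp_plus x (f : mons) : f \in Vsp_plus mu -> weyl (spmx x) f \in Vsp_plus mu.
Proof.
move: f; apply: span_ind => [|c f g fV gV|f [ne [mu' [lp sub fV]]]].
- have -> : weyl (spmx x) 0 = 0 by exact: (lin_zero (weyl_linear (spmx x))).
  exact: rpred0.
- rewrite weyl_lin; exact: (span_submod_closed _).2 c _ _ fV gV.
- apply: sub_span; split=> //; exists mu'; split=> //; exact: weyl_Vsp.
Qed.

Lemma Vmod_is_rep : is_rep setT Vact.
Proof.
have valD c (u v : Vmod) : val (c *: u + v) = c *: val u + val v by exact: linearP.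
have valB (u v : Vmod) : val (u - v) = val u - val v by exact: linearB.
split=> [x _ c u v|c x y v _ _|x y v _ _]; apply: val_inj.
- by rewrite [RHS]valD -[LHS]/(weyl (spmx x) (val (c *: u + v))) valD weyl_lin.
- by rewrite [RHS]valD; exact: (weyl_linearl (val v) c x y).
- by rewrite [RHS]valB; exact: (weyl_bracket char0 x y (val v)).
Qed.

Lemma Vmod_plus_sub : submodule setT Vact (@Vmod_plus K mu : submodClosed Vmod).
Proof. by move=> x v _; exact: weyl_Vsp_plus. Qed.

Lemma Xsp_is_rep : is_rep setT Xact.
Proof. exact: (quot_rep Vmod_is_rep Vmod_plus_sub). Qed.

Lemma Xsp_actE x (v : Vmod) : Xact x (\pi_Xsp v) = \pi_Xsp (Vact x v).
Proof. exact: (quot_actE Vmod_is_rep x v Vmod_plus_sub). Qed.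

Lemma Xsp_pi_lin c (u v : Vmod) : \pi_Xsp (c *: u + v) = c *: \pi_Xsp u + \pi_Xsp v.
Proof. exact: (@lquot_pi_linear K Vmod (@Vmod_plus K mu)). Qed.

(** Coefficients of representatives; well defined on the quotient by V^+ for the lam
with Int^+(lam) = Int^+(mu), which do not occur in V^+. *)
Definition coef lam (q : Xsp) : K := (val (repr q))@_lam.

Lemma coefE lam (v : Vmod) : IntP lam = IntP mu -> coef lam (\pi_Xsp v) = (val v)@_lam.
Proof.
move=> E; have := lquot_repr (@Vmod_plus K mu : submodClosed Vmod) v.
move=> /Vsp_plus_supp /(_ E); rewrite linearB mcoeffB => /eqP.
by rewrite subr_eq0 => /eqP.
Qed.

Lemma coef_lin lam c (p q : Xsp) : IntP lam = IntP mu ->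
  coef lam (c *: p + q) = c * coef lam p + coef lam q.
Proof.
move=> E; move: p q; apply: quot_ind => u; apply: quot_ind => v.
rewrite -Xsp_pi_lin !coefE//.
have -> : val (c *: u + v) = c *: val u + val v by exact: linearP.
by rewrite mcoeffD mcoeffZ.
Qed.

Lemma coef0 lam : IntP lam = IntP mu -> coef lam 0 = 0.
Proof.
move=> E; have := @coef_lin lam 1 0 0 E; rewrite scale1r addr0 mul1r => H.
by apply: (addrI (coef lam 0)); rewrite addr0 -H.
Qed.

Lemma coef_eq0 (q : Xsp) : (forall lam, sim lam mu -> coef lam q = 0) -> q = 0.
Proof.
move: q; apply: quot_ind => v v0; apply/lquot_eq0.
apply: Vsp_plusP; first exact: valP.
move=> lam E; apply/eqP/negPn/negP => /[dup] vlam /(Vsp_supp (valP v))[lp _].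
by move: vlam; rewrite -coefE// v0 ?eqxx.
Qed.

Definition basis lam : Xsp := \pi_Xsp (insubd (0 : Vmod) (mon lam)).

Lemma mon_Vsp lam : sim lam mu -> mon lam \in Vsp mu.
Proof. by move=> [lp E]; apply: sub_span; exists lam => //; split=> //; rewrite E. Qed.

Lemma val_basis lam : sim lam mu -> val (insubd (0 : Vmod) (mon lam)) = mon lam.
Proof. by move=> s; rewrite insubdK//; exact: mon_Vsp. Qed.

Lemma coef_basis lam nu' : IntP nu' = IntP mu -> sim lam mu ->
  coef nu' (basis lam) = (lam == nu')%:R.
Proof. by move=> E s; rewrite coefE// val_basis// mcoeffU. Qed.

Lemma basis_neq0 lam : sim lam mu -> basis lam <> 0.
Proof.
move=> s e0; have := @coef_basis lam lam s.2 s; rewrite e0 coef0 ?s.2// eqxx => /esym/eqP.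
by rewrite oner_eq0.
Qed.

Lemma weyl_H_coef i (f : mons) lam :
  (weyl (spmx (H K i)) f)@_lam = (lam i + 2^-1) * f@_lam.
Proof.
have [W [WL WE Wm]] : exists W : {malg K[nat -> K]} -> {malg K[nat -> K]},
    [/\ linear W, forall g, W g = weyl (spmx (H K i)) g
      & forall nu', W << nu' >> = (nu' i + 2^-1) *: << nu' >>].
  by exists (weyl (spmx (H K i))); split=> // [|nu']; [exact: weyl_linear|exact: weyl_H].
rewrite -WE; elim/malg_ind: f => [|c f g IHf IHg|nu'].
- by rewrite (lin_zero WL) mcoeff0 mulr0.
- by rewrite WL !(mcoeffD, mcoeffZ) IHf IHg; ring.
- rewrite Wm mcoeffZ mcoeffU.
  by case: (eqVneq nu' lam) => [->//|_]; rewrite !mulr0.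
Qed.

Lemma coef_H lam i (q : Xsp) : IntP lam = IntP mu ->
  coef lam (Xact (H K i) q) = (lam i + 2^-1) * coef lam q.
Proof.
move=> E; move: q; apply: quot_ind => v.
by rewrite Xsp_actE !coefE// weyl_H_coef.
Qed.

(** The shift between exponents and weights. *)
Definition half : nat -> K := fun=> 2^-1.

Lemma coef_weight lam nu' (q : Xsp) : IntP nu' = IntP mu ->
  weight_space Xact lam q -> coef nu' q != 0 -> lam = nu' + half.
Proof.
move=> E qw q0; apply/funext => i; apply: (mulIf q0).
rewrite -coef_H// qw -[_ *: q]addr0 coef_lin// coef0// addr0.
by [].
Qed.

Lemma basis_weight lam : sim lam mu -> weight_space Xact (lam + half) (basis lam).
Proof.
move=> s i; rewrite /basis Xsp_actE -[_ *: _]addr0.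
have <- : \pi_Xsp 0 = 0 :> Xsp by apply/lquot_eq0; exact: rpred0.
rewrite -Xsp_pi_lin addr0; congr (\pi_Xsp _); apply: val_inj.
have -> c (v : Vmod) : val (c *: v) = c *: val v by exact: linearZ.
by rewrite /= val_basis// weyl_H.
Qed.

(** Distinct monomials have distinct weights, so weight spaces are lines. *)
Lemma weight_basis lam (q : Xsp) : weight_space Xact lam q -> q <> 0 ->
  exists nu' c, [/\ sim nu' mu, c != 0 & q = c *: basis nu'].
Proof.
move=> qw q0; have [nu' [s qnu]] : exists nu', sim nu' mu /\ coef nu' q != 0.
  apply: contrapT => no; apply: q0; apply: coef_eq0 => nu' s.
  by apply/eqP/negPn/negP => qnu; apply: no; exists nu'.
exists nu', (coef nu' q); split=> //.
apply/eqP; rewrite -subr_eq0; apply/eqP/coef_eq0 => lam' s'.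
rewrite addrC -scaleNr coef_lin; last exact: s'.2.
rewrite coef_basis//; last exact: s'.2.
case: eqP => [<-|ne]; first by rewrite mulr1 addNr.
rewrite mulr0 add0r; apply/eqP/negPn/negP => /(coef_weight s'.2 qw) E'.
apply: ne; apply: (addIr half); rewrite -E' -(coef_weight s.2 qw qnu).
by [].
Qed.

Lemma Xsp_weight_module : weight_module Xact.
Proof.
split=> [q|lam].
  move: q; apply: quot_ind => v; have : val v \in Vsp mu := valP v.
  suff Hf f : f \in Vsp mu -> exists2 v : Vmod, val v = f &
      \pi_Xsp v \in span (\bigcup_(lam in setT) weight_space Xact lam).
    by move=> /Hf[w /val_inj ->].
  move: f; apply: span_ind => [|c _ _ [u <- us] [w <- ws]|_ [nu' [lp sub] <-]].
  - exists 0; first exact: linear0.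
    have -> : \pi_Xsp 0 = 0 :> Xsp by apply/lquot_eq0; exact: rpred0.
    exact: rpred0.
  - exists (c *: u + w); first exact: linearP.
    by rewrite Xsp_pi_lin; exact: submod_lin.
  - have mV : mon nu' \in Vsp mu by apply: sub_span; exists nu'.
    have [E|ne] := pselect (IntP nu' = IntP mu).
      have s : sim nu' mu by [].
      exists (insubd (0 : Vmod) (mon nu')); first exact: val_basis.
      by apply: sub_span; exists (nu' + half) => //; exact: basis_weight.
    exists (VMod mV) => //.
    have -> : \pi_Xsp (VMod mV) = 0 by apply/lquot_eq0; exact: mon_Vsp_plus.
    exact: rpred0.
have [s|ns] := pselect (sim (lam - half) mu).
  exists [:: basis (lam - half)] => q qw.
  have [->|q0] := pselect (q = 0); first exact: rpred0.
  have [nu' [c [snu c0 qE]]] := weight_basis qw q0.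
  have En : lam = nu' + half.
    apply: (coef_weight snu.2 qw); rewrite qE -[_ *: _]addr0 coef_lin ?snu.2//.
    by rewrite coef0 ?snu.2// addr0 coef_basis ?snu.2// eqxx mulr1.
  rewrite qE; apply/rpredZ/sub_span; rewrite /= inE; apply/eqP.
  by congr basis; rewrite En addrK.
exists [::] => q qw; have [->|q0] := pselect (q = 0); first exact: rpred0.
have [nu' [c [snu c0 qE]]] := weight_basis qw q0.
case: ns; have -> // : lam - half = nu'.
have -> : lam = nu' + half; last by rewrite addrK.
apply: (coef_weight snu.2 qw); rewrite qE -[_ *: _]addr0 coef_lin ?snu.2//.
by rewrite coef0 ?snu.2// addr0 coef_basis ?snu.2// eqxx mulr1.
Qed.

Lemma osc_coef_neq0 lam a : nu lam a <> -1 -> osc_coef a lam != 0.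
Proof.
case: a => i /= h; first by rewrite oner_eq0.
by apply/eqP => l0; apply: h; rewrite l0 subr0.
Qed.

(** A root vector acts by two unit steps, and the coefficient produced by each of
them vanishes only if the step leaves Int^+. *)
Lemma root_vec_basis lam a b : sim lam mu -> a <> b ->
  nu lam (opp b) <> -1 -> nu (lam + seps (opp b)) a <> -1 ->
  exists2 c, c != 0 & Xact (root_vec a b) (basis lam) =
    c *: basis (lam + seps (opp b) + seps a).
Proof.
move=> s ab nb na; have s' := sim_step2 s nb na.
exists (sgn a * (osc_coef (opp b) lam * osc_coef a (lam + seps (opp b)))).
  apply: mulf_neq0; last by apply: mulf_neq0; exact: osc_coef_neq0.
  by case: (a) => i; rewrite /= ?oppr_eq0 oner_neq0.
rewrite /basis Xsp_actE -[_ *: _]addr0.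
have <- : \pi_Xsp 0 = 0 :> Xsp by apply/lquot_eq0; exact: rpred0.
rewrite -Xsp_pi_lin addr0; congr (\pi_Xsp _); apply: val_inj.
have -> c (v : Vmod) : val (c *: v) = c *: val v by exact: linearZ.
rewrite val_basis// [LHS]/= val_basis// (weyl_root char0) /quad /anticomm.
have c0 : ccr K a (opp b) = 0.
  by rewrite /ccr (inj_eq (inv_inj oppK)); case: eqP => // ba; case: ab.
have -> : osc a (osc (opp b) (mon lam)) = osc (opp b) (osc a (mon lam)).
  by apply: etrans (osc_ccr _ _ _) _; rewrite c0 scale0r addr0.
have E : osc (opp b) (osc a (mon lam)) =
    (osc_coef (opp b) lam * osc_coef a (lam + seps (opp b))) *:
      mon (lam + seps (opp b) + seps a).
  transitivity (osc a (osc (opp b) (mon lam))).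
    by apply: esym; apply: etrans (osc_ccr _ _ _) _; rewrite c0 scale0r addr0.
  by rewrite osc_mon (lin_scale (osc_linear a)) osc_mon scalerA.
rewrite E; apply/malgP => k; rewrite !(mcoeffD, mcoeffZ).
by move: (two_neq0 char0) => two0; field.
Qed.

(** Induction on the distance from lam to lam'. After a step towards lam' the distance
is odd by parity, so a second step towards lam' is possible; it is not the inverse
of the first, so together they are the action of a root vector. *)
Lemma basis_connected (N : submodClosed Xsp) lam lam' : submodule setT Xact N ->
  sim lam mu -> sim lam' mu -> basis lam \in N -> basis lam' \in N.
Proof.
move=> Nsub s s'; have [m [n [m0 mE mo]]] := sim_root_lattice s s'.
rewrite odd_abs_sum in mo.
have {mE} mE i : lam' i - lam i = (m i)%:~R by rewrite -mE.
have [d dE] : exists d, (\sum_(i < n) `|m i| < d)%N by exists (\sum_(i < n) `|m i|).+1.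
elim: d lam m s m0 mE mo dE => // d IH lam m s m0 mE mo dE lamN.
have E : IntP lam = IntP lam' by rewrite s.2 s'.2.
have [/eqP|sm] := boolP (\sum_(i < n) `|m i| == 0)%N.
  move=> /eqP; rewrite sum_nat_eq0 => /forallP m0'.
  suff <- : lam = lam' by [].
  apply/funext => i; apply/esym/eqP; rewrite -subr_eq0 mE.
  have [ni|ni] := leqP n i; first by rewrite m0.
  by have := m0' (Ordinal ni); rewrite /= absz_eq0 => /eqP ->.
have [a [na an lta posa]] := step_toward char0 E mE m0 sm.
pose m1 i := m i - dirz a i; pose lam1 := lam + seps a.
have m1E i : lam' i - lam1 i = (m1 i)%:~R.
  by rewrite rmorphB/= dirzE -mE /lam1 fctE opprD addrA.
have dirz0 c i : (supp_idx c < n)%N -> (n <= i)%N -> dirz c i = 0.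
  by case: c => j /= jn ni; rewrite (_ : (i == j) = false)//; lia.
have m10 i : (n <= i)%N -> m1 i = 0 by move=> ni; rewrite /m1 m0// dirz0// subr0.
have E1 : IntP lam1 = IntP lam' by rewrite IntP_step.
have o1 := dirz_step_odd m an; rewrite mo /= in o1.
have sm1 : (\sum_(i < n) `|m1 i| != 0)%N by apply/negP => /eqP z; rewrite z in o1.
have [c [nc cn ltc posc]] := step_toward char0 E1 m1E m10 sm1.
have ca : c <> opp a.
  move=> ca; move: posa posc; rewrite ca /m1.
  by case: (a) => i /=; rewrite eqxx /=; lia.
have [k k0 kE] : exists2 k, k != 0 & Xact (root_vec c (opp a)) (basis lam) =
    k *: basis (lam1 + seps c).
  by have := @root_vec_basis lam c (opp a) s ca; rewrite oppK; exact.
apply: (IH (lam1 + seps c) (fun i => m1 i - dirz c i)).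
- exact: sim_step2.
- by move=> i ni; rewrite m10// dirz0// subr0.
- by move=> i; rewrite rmorphB/= dirzE -m1E fctE opprD addrA.
- by rewrite (dirz_step_odd m1 cn) o1.
- exact: leq_trans ltc (leq_trans (ltnW lta) dE).
have -> : basis (lam1 + seps c) = k^-1 *: Xact (root_vec c (opp a)) (basis lam).
  by rewrite kE scalerA mulVf// scale1r.
by apply: rpredZ; exact: Nsub.
Qed.

Lemma sim_refl lam : sim lam lam.
Proof.
split=> //; rewrite subrr; exists (fun=> 0), 0%N; split=> //.
by rewrite big_ord0.
Qed.

Let Hlin i : linear (Xact (H K i)). Proof. exact: (act_linear Xsp_is_rep). Qed.

Let Hw : forall q : Xsp, q \in span (\bigcup_(lam in setT)
  [set w | is_weight (fun i => Xact (H K i)) lam w]).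
Proof. by case: Xsp_weight_module. Qed.

Lemma Xsp_simple : simple setT Xact.
Proof.
split; first by exists (basis mu); apply/basis_neq0/sim_refl.
move=> N Nsub; have [N0|nN0] := pselect (forall q, q \in N -> q = 0); [by left|right].
have HN i q : q \in N -> Xact (H K i) q \in N by exact: Nsub.
have [lam [w [wN w0 ww]]] : exists lam w,
    [/\ w \in N, w <> 0 & is_weight (fun i => Xact (H K i)) lam w].
  apply: weight_exists => //; apply: contrapT => no; apply: nN0 => q qN.
  by apply: contrapT => q0; apply: no; exists q.
have [nu' [c [s c0 wE]]] := weight_basis ww w0.
have bN : basis nu' \in N.
  have -> : basis nu' = c^-1 *: w by rewrite wE scalerA mulVf// scale1r.
  exact: rpredZ.
move=> q; have [||F FP] := @submod_of_prop K Xsp (fun=> True); rewrite //.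
apply: (@weight_sub_ind K Xsp _ Hlin Hw F (fun q => q \in N)).
- by move=> i v _; apply/FP.
- exact: rpred0.
- by move=> *; exact: submod_lin.
- move=> lam' v _ vw; have [->|v0] := pselect (v = 0); first exact: rpred0.
  have [nu2 [c2 [s2 _ ->]]] := weight_basis vw v0.
  by apply: rpredZ; exact: basis_connected bN.
- exact/FP.
Qed.

Lemma Xsp_swm : simple_weight_module setT Xact.
Proof. by split; [exact: Xsp_is_rep|exact: Xsp_weight_module|exact: Xsp_simple]. Qed.

Section Invariant.
Variable prec : int -> int -> Prop.
Hypothesis prec_order : strict_order prec.
Hypothesis prec_admissible : admissible prec.
Hypothesis prec_Z2 : Z2_linear prec.

(** The positive root eps_a - eps_b takes lam out of its class: for b = opp a it
raises lam twice at a, otherwise it raises lam at the two distinct positions of a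
and opp b. *)
Definition primitive lam : Prop := forall a b, below prec a b ->
  (b = opp a -> nu lam a = -1 \/ nu lam a = - 2) /\
  (b <> opp a -> nu lam a = -1 \/ nu lam b = 0).

Lemma supp_idx_ne a b : below prec a b -> b <> opp a -> supp_idx a <> supp_idx b.
Proof.
move=> ab ba; apply: supp_idx_neq => h; last by apply: ba; rewrite h oppK.
by move: ab; rewrite h; exact: below_irr.
Qed.

Lemma primitive_killed lam : sim lam mu -> primitive lam ->
  forall x, x \in nilradical K prec -> Xact x (basis lam) = 0.
Proof.
move=> s prim; apply: span_ind => [|c x y IHx IHy|x [alpha aP xa]].
- exact: (lin_zero (act_linearl Xsp_is_rep (basis lam))).
- by rewrite (act_linearl Xsp_is_rep (basis lam)) IHx IHy scaler0 addr0.
apply: coef_eq0 => nu' s'; apply/eqP/negPn/negP => h.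
have xw : weight_space Xact (lam + half + alpha) (Xact x (basis lam)).
  move=> i; rewrite (act_swap Xsp_is_rep) (basis_weight s) (xa i).
  rewrite (lin_scale (act_linear Xsp_is_rep x)).
  rewrite (lin_scale (act_linearl Xsp_is_rep (basis lam))) -scalerDl.
  by [].
have /esym E := coef_weight s'.2 xw h.
have {E} E : nu' = lam + alpha by apply: (addIr half); rewrite E addrAC.
have EI : IntP lam = IntP nu' by rewrite s.2 s'.2.
have [a [b [ab aE]]] := (Pplus_below prec_order prec_admissible prec_Z2 alpha).1 aP.
have {E aE} E : nu' = lam + seps (opp b) + seps a.
  by rewrite E aE seps_opp addrAC addrA.
have [p1 p2] := prim _ _ ab; have [ba|ba] := pselect (b = opp a).
  have nE : nu nu' a = nu lam a + 2.
    by rewrite E ba oppK !nu_step -addrA.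
  by have [na|na] := p1 ba; move: EI;
    [apply: (@IntP_cross K char0 lam nu' a 0 1)|apply: (@IntP_cross K char0 lam nu' a 1 0)];
    rewrite // nE na /= ?addNr//; ring.
have ne := supp_idx_ne ab ba; have [na|nb] := p2 ba; move: EI.
  apply: (@IntP_cross K char0 lam nu' a 0 0) => //.
  rewrite E nu_step nu_step_ne ?na ?addNr//.
  by case: (b) ne.
have opb : supp_idx (opp b) = supp_idx b by case: (b).
apply: (@IntP_cross K char0 lam nu' (opp b) 0 0).
  by rewrite nu_opp nb subr0.
rewrite E nu_step_ne; first by rewrite nu_step nu_opp nb subr0 addNr.
by rewrite opb => /esym.
Qed.

(** The space of vectors killed by u is spanned by weight vectors, that is by basis
elements. *)
Lemma invariant_primitive :
  (exists q, q <> 0 /\ forall x, x \in nilradical K prec -> Xact x q = 0) <->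
  exists lam, sim lam mu /\ primitive lam.
Proof.
split=> [[q [q0 qu]]|[lam [s prim]]]; last first.
  by exists (basis lam); split; [exact: basis_neq0|exact: primitive_killed].
have [||Inv InvP] := @submod_of_prop K Xsp
    (fun v => forall x, x \in nilradical K prec -> Xact x v = 0).
- by move=> x _; exact: (lin_zero (act_linear Xsp_is_rep x)).
- by move=> c u w uu wu x xu; rewrite (act_linear Xsp_is_rep) uu// wu// scaler0 addr0.
have HI i v : v \in Inv -> Xact (H K i) v \in Inv.
  by apply: (Inv_levi char0 prec_order prec_admissible prec_Z2 Xsp_swm InvP); exact: levi_H.
have [lam [w [wI w0 ww]]] : exists lam w,
    [/\ w \in Inv, w <> 0 & is_weight (fun i => Xact (H K i)) lam w].
  by apply: weight_exists => //; exists q => //; apply/InvP.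
have [nu' [c [s c0 wE]]] := weight_basis ww w0.
exists nu'; split=> // a b ab.
have killed : Xact (root_vec a b) (basis nu') = 0.
  have -> : basis nu' = c^-1 *: w by rewrite wE scalerA mulVf// scale1r.
  rewrite (lin_scale (act_linear Xsp_is_rep _)) (InvP w).1 ?scaler0//.
  exact: root_vec_nilradical.
have abne : a <> b by move=> h; move: ab; rewrite h; exact: below_irr.
have step2 : nu nu' (opp b) <> -1 -> nu (nu' + seps (opp b)) a <> -1 -> False.
  move=> h1 h2; have [k k0] := root_vec_basis s abne h1 h2.
  rewrite killed => /esym/eqP; rewrite scaler_eq0 (negPf k0) => /eqP.
  exact/basis_neq0/sim_step2.
split=> ba.
  apply: contrapT => /not_orP[n1 n2]; apply: step2; rewrite ba oppK// nu_step => h.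
  by apply: n2; apply: (addIr 1); rewrite h; ring.
apply: contrapT => /not_orP[n1 n2]; apply: step2.
  rewrite nu_opp => h; apply: n2; apply: oppr_inj; apply: (addrI (-1)).
  by rewrite h oppr0 addr0.
rewrite nu_step_ne//; have := supp_idx_ne ab ba; by case: (b).
Qed.

End Invariant.
End Xmodule.

(** * Primitive sequences *)

Section Combinatorics.
Variables (K : fieldType) (mu : nat -> K) (prec : int -> int -> Prop).
Hypothesis prec_order : strict_order prec.
Hypothesis prec_admissible : admissible prec.
Hypothesis prec_Z2 : Z2_linear prec.

Local Notation seps := (seps K).
Local Notation eps := (eps K).
Local Notation below := (below prec).
Local Notation cls := (cls prec).
Local Notation neg a := (prec (signed a) 0).
Local Notation primitive := (@primitive K prec).
Implicit Types lam om : nat -> K.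

Lemma cls_prec_mem A B i j : cls_prec prec A B -> A i -> B j -> prec i j.
Proof.
move=> [i' [j' [-> -> ij]]] ii jj.
exact: (cls_precr prec_order prec_admissible jj (cls_precl prec_order prec_admissible ii ij)).
Qed.

Lemma mem_cls_eq A i j : A = cls i -> A j -> A = cls j.
Proof. by move=> -> /(cls_eq prec_admissible). Qed.

Lemma below0_prec A i : below0 prec A -> A i -> prec i 0.
Proof. by move=> [_ /cls_prec_mem h] Ai; apply: h => //; exact: cls_refl. Qed.

Lemma above0_prec A i : above0 prec A -> A i -> prec 0 i.
Proof. by move=> [_ /cls_prec_mem h] Ai; apply: h => //; exact: cls_refl. Qed.

Lemma prec_below0 i : prec i 0 -> below0 prec (cls i).
Proof. by move=> i0; split; [exists i|exists i, 0]. Qed.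

Lemma prec_above0 i : prec 0 i -> above0 prec (cls i).
Proof. by move=> i0; split; [exists i|exists 0, i]. Qed.

Lemma neg_opp a : neg (opp a) <-> prec 0 (signed a).
Proof.
rewrite signed_opp; split=> /prec_Z2; rewrite oppr0 ?opprK//.
Qed.

Lemma signed_cases a : [\/ neg a, neg (opp a) | cls 0 (signed a)].
Proof.
have [?|n1] := pselect (neg a); first by constructor 1.
have [/neg_opp ?|n2] := pselect (prec 0 (signed a)); first by constructor 2.
by constructor 3; apply/clsP.
Qed.

Lemma neg_neq_opp a b : neg a -> neg b -> a <> opp b.
Proof.
move=> na nb E; move: na; rewrite E => /neg_opp.
exact: prec_asym.
Qed.

Lemma neg_below_opp a b : neg a -> neg b -> below a (opp b).
Proof.
move=> na nb; apply: (prec_trans prec_order na).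
by rewrite signed_opp; exact: (prec_opp0 prec_Z2).
Qed.

Lemma signed_surj (j : int) : j <> 0 -> exists a, signed a = j.
Proof.
case: j => [[|k]|k] // _; first by exists (inl k).
by exists (inr k).
Qed.

Lemma nu_opp0 lam a : nu lam (opp a) = -1 <-> nu lam a = 0.
Proof.
rewrite nu_opp; split=> [h|->]; last by rewrite subr0.
by apply: oppr_inj; apply: (addrI (-1)); rewrite h oppr0 addr0.
Qed.

Lemma neg1_neq0 : -1 <> 0 :> K.
Proof. by move=> /eqP; rewrite oppr_eq0 oner_eq0. Qed.

Lemma neg2_neq_neg1 : - 2 <> -1 :> K.
Proof.
move=> /oppr_inj/eqP; rewrite -subr_eq0 (_ : 2 - 1 = 1) ?oner_eq0//.
ring.
Qed.

(** The conditions on the classes above and below 0 are the same condition on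
signed indices. *)
Lemma RsetP om : Rset prec om <-> forall a, neg a -> nu om a = -1.
Proof.
split=> [Rom [k|k] ka|Rom A].
- by apply: (Rom (cls (pos k))).1; [exact: prec_below0|exact: cls_refl].
- rewrite /= (_ : om k = 0) ?subr0//; apply: (Rom (cls (pos k))).2; last exact: cls_refl.
  by apply: prec_above0; apply/(neg_opp (inl k)).
split=> Ab k Ak; first exact: (Rom (inl k) (below0_prec Ab Ak)).
apply/(nu_opp0 om (inl k))/Rom/neg_opp.
exact: (above0_prec Ab Ak).
Qed.

Lemma below_not_neg a b : below a b -> ~ neg a -> neg (opp b).
Proof.
move=> ab na; apply/neg_opp; have [//|/neg_opp h|h] := signed_cases a.
  exact: (prec_trans prec_order h).
exact: (cls_precl prec_order prec_admissible (cls_sym prec_admissible h)).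
Qed.

Lemma below_opp_neg a : below a (opp a) -> neg a.
Proof. by rewrite /below signed_opp => /(prec_opp_self prec_order prec_admissible prec_Z2). Qed.

Lemma Rset_primitive om : Rset prec om -> primitive om.
Proof.
move=> /RsetP Rom a b ab; have [na|na] := pselect (neg a).
  by split=> _; left; exact: Rom.
split=> [ba|_]; first by rewrite ba in ab; case: na; exact: below_opp_neg.
by right; apply/nu_opp0/Rom; exact: below_not_neg na.
Qed.

(** In terms of positive positions, i is in the maximal class below 0 or in the minimal
class above 0, according to the sign of a. *)
Definition topmost a : Prop := neg a /\ forall b, neg b -> ~ below a b.

Lemma topmost_maximal a : topmost a -> maximal_below0 prec (cls (signed a)).
Proof.
move=> [na amax]; split; first exact: prec_below0.
move=> B B0 /[dup] aB [_ [j [_ BE _]]].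
have Bj : B j by rewrite BE; exact: cls_refl.
have j0 := below0_prec B0 Bj; have aj := cls_prec_mem aB (cls_refl prec _) Bj.
have [|b bE] := @signed_surj j; first by move=> h; move: j0; rewrite h; exact: prec_irr.
by apply: (amax b); rewrite /below bE.
Qed.

Lemma topmost_minimal k : topmost (inr k) -> minimal_above0 prec (cls (pos k)).
Proof.
move=> [na amax]; split.
  by apply: prec_above0; apply/(neg_opp (inl k)).
move=> B B0 /[dup] Bk [j [_ [BE _ _]]].
have Bj : B j by rewrite BE; exact: cls_refl.
have j0 := above0_prec B0 Bj; have jk := cls_prec_mem Bk Bj (cls_refl prec _).
have [|b bE] := @signed_surj (- j).
  by move=> /eqP; rewrite oppr_eq0 => /eqP h; move: j0; rewrite h; exact: prec_irr.
apply: (amax b); rewrite ?/below bE; last exact: prec_Z2.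
by have := prec_Z2 j0; rewrite oppr0.
Qed.

Lemma maximal_topmost A k : maximal_below0 prec A -> A (pos k) -> topmost (inl k).
Proof.
move=> [A0 Amax] Ak; split=> [|b nb kb]; first exact: (below0_prec A0 Ak).
apply: (Amax _ (prec_below0 nb)); have [[i AE] _] := A0.
by exists (pos k), (signed b); split=> //; exact: (mem_cls_eq AE Ak).
Qed.

Lemma minimal_topmost A k : minimal_above0 prec A -> A (pos k) -> topmost (inr k).
Proof.
move=> [A0 Amin] Ak; split=> [|b nb kb].
  by apply/(neg_opp (inl k)); exact: (above0_prec A0 Ak).
have nb0 : prec 0 (- signed b) by exact: (prec_opp0 prec_Z2).
apply: (Amin _ (prec_above0 nb0)); have [[i AE] _] := A0.
exists (- signed b), (pos k); split=> //; first exact: (mem_cls_eq AE Ak).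
by have := prec_Z2 kb; rewrite opprK.
Qed.

(** If nu_a = -2 for some a below 0, primitivity for the pairs (a, b) gives nu_b = 0 for
all b above a except opp a. Applied to both b and opp b, this excludes any b with
0 in its class; and it excludes any b below 0 above a, where nu_b < 0. *)
Lemma primitive_cases lam : primitive lam -> Rset prec lam \/
  exists a, [/\ topmost a, Rset prec (lam + seps a)
              & forall c, ~ cls 0 (signed c)].
Proof.
move=> prim; have [Rlam|nR] := pselect (Rset prec lam); [by left|right].
have [a [na nua]] : exists a, neg a /\ nu lam a <> -1.
  apply: contrapT => no; apply: nR; apply/RsetP => a na.
  by apply: contrapT => h; apply: no; exists a.
have {nua} nua : nu lam a = - 2.
  by have [/(_ erefl)[]] := prim _ _ (neg_below_opp na na).
have other b : below a b -> b <> opp a -> nu lam b = 0.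
  by move=> /prim[_ h] /h[|//]; rewrite nua => /neg2_neq_neg1.
have neg_nu b : neg b -> b <> a -> nu lam b = -1.
  move=> nb ba; rewrite -[b]oppK; apply/nu_opp0/other; first exact: neg_below_opp.
  by move=> /(inv_inj oppK).
exists a; split.
- split=> // b nb ab; have ba : b <> a by move=> h; move: ab; rewrite h; exact: below_irr.
  have := neg_nu _ nb ba; rewrite other// => [/esym/neg1_neq0//|].
  exact: neg_neq_opp.
- apply/RsetP => b nb; have [->|ba] := pselect (b = a).
    by rewrite nu_step nua; ring.
  rewrite nu_step_ne ?neg_nu//; apply: supp_idx_neq => //; exact: neg_neq_opp.
- move=> c c0; have acl d : cls 0 (signed d) -> nu lam d = 0.
    move=> d0; apply: other.
      exact: (cls_precr prec_order prec_admissible d0).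
    move=> dE; move: d0; rewrite dE => /(clsP prec_order)[+ _]; apply.
    by rewrite signed_opp; exact: (prec_opp0 prec_Z2).
  have oc : cls 0 (signed (opp c)).
    by rewrite signed_opp -[0]oppr0; exact: (cls_opp prec_order prec_Z2).
  have := acl _ oc; rewrite nu_opp (acl _ c0) subr0.
  exact: neg1_neq0.
Qed.

Lemma special_primitive om a : Rset prec om -> topmost a ->
  (forall c, ~ cls 0 (signed c)) -> primitive (om + seps (opp a)).
Proof.
move=> /RsetP Rom [na amax] no0; pose lam := om + seps (opp a).
have nua : nu lam a = - 2.
  rewrite -[a]oppK nu_opp nu_step nu_opp Rom//; ring.
have neg_nu b : neg b -> b <> a -> nu lam b = -1.
  move=> nb ba; rewrite nu_step_ne ?Rom//; apply: supp_idx_neq.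
    exact: neg_neq_opp.
  by rewrite oppK.
move=> c b cb; rewrite -/lam; have [nc|nc] := pselect (neg c).
  have [ca|ca] := pselect (c = a); last by split=> _; left; exact: neg_nu.
  rewrite ca in cb *; split=> [_|ba]; first by right.
  right; apply/nu_opp0/neg_nu; last by move=> h; apply: ba; rewrite -h oppK.
  by case: (signed_cases b) => [nb|//|/no0[]]; have := amax _ nb cb.
have nb := below_not_neg cb nc; split=> [bc|_].
  by rewrite bc in cb; case: nc; exact: below_opp_neg.
right; apply/nu_opp0/neg_nu => // ba.
have nc' : neg (opp c) by case: (signed_cases c) => [|//|/no0[]].
by apply: (amax _ nc'); rewrite -ba; exact: (below_opp prec_Z2).
Qed.

(** If the class of 0 contains a position d, the sequence om - seps a is equivalent to
om + seps d, which is again in R; otherwise it is primitive itself. *)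
Lemma special_exists om a : Rset prec om -> topmost a -> sim (om + seps (opp a)) mu ->
  (forall c, cls 0 (signed c) -> exists d, cls 0 (signed d) /\ nu om d = 0) ->
  exists lam, sim lam mu /\ primitive lam.
Proof.
move=> Rom atop s hc; have [[c c0]|no0] := pselect (exists c, cls 0 (signed c)); last first.
  exists (om + seps (opp a)); split=> //; apply: special_primitive => // c c0.
  by apply: no0; exists c.
have [d [d0 nud]] := hc _ c0; have [na _] := atop; have /RsetP Rom' := Rom.
exists (om + seps d); split.
  have -> : om + seps d = om + seps (opp a) + seps a + seps d.
    by rewrite seps_opp subrK.
  apply: (sim_step2 s).
    rewrite -[a in nu _ a]oppK nu_opp nu_step nu_opp Rom'//.
    have -> : -1 - (-1 - -1 + 1) = - 2 :> K by ring.
    exact: neg2_neq_neg1.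
  by rewrite seps_opp subrK nud => /esym; exact: neg1_neq0.
apply: Rset_primitive; apply/RsetP => b nb.
have [z1 z2] := (clsP prec_order _ _).1 d0.
rewrite nu_step_ne ?Rom'//; apply: supp_idx_neq => bd.
  by apply: z2; rewrite -bd.
by apply: z1; apply/neg_opp; rewrite -bd.
Qed.

Lemma primitive_iff : (exists lam, sim lam mu /\ primitive lam) <->
  [\/ exists om, Rset_mu prec mu om /\ sim mu om,
      exists A, maximal_below0 prec A /\ (exists om i0,
        [/\ omega_plus prec om, A (pos i0) & sim mu (om - eps i0)])
    | exists A, minimal_above0 prec A /\ (exists om i0,
        [/\ omega_minus prec om, A (pos i0) & sim mu (om + eps i0)])].
Proof.
split=> [[lam [s /primitive_cases[Rlam|[[k|k] [ktop Rom no0]]]]]|].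
- by constructor 1; exists lam; split; [split|exact: sim_sym].
- constructor 2; exists (cls (pos k)); split; first exact: (topmost_maximal ktop).
  exists (lam + eps k), k; split; [|exact: cls_refl|by rewrite addrK; exact: sim_sym].
  by split=> // j /(no0 (inl j)).
- constructor 3; exists (cls (pos k)); split; first exact: topmost_minimal.
  exists (lam - eps k), k; split; [|exact: cls_refl|by rewrite subrK; exact: sim_sym].
  by split=> // j /(no0 (inl j)).
have cls_pos c : cls 0 (signed c) -> cls 0 (pos (supp_idx c)).
  case: c => // k /(cls_opp prec_order prec_Z2).
  by rewrite oppr0 opprK.
case=> [[om [[Rom s] _]]|[A [Amax [om [i0 [[Rom om0] Ai s]]]]]|
        [A [Amin [om [i0 [[Rom om0] Ai s]]]]]].
- by exists om; split=> //; exact: Rset_primitive.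
- apply: (special_exists Rom (maximal_topmost Amax Ai)); first exact: sim_sym.
  move=> c /cls_pos c0; exists (inl (supp_idx c)); split=> //; exact: om0.
- apply: (special_exists Rom (minimal_topmost Amin Ai)); first exact: sim_sym.
  move=> c /cls_pos c0; exists (inr (supp_idx c)); split.
    by rewrite -oppr0; exact: (cls_opp prec_order prec_Z2).
  by rewrite /= om0// subrr.
Qed.

End Combinatorics.

Theorem proposition4p20 (R : realType) (mu : nat -> R[i])
    (prec : int -> int -> Prop)
    (prec_order : strict_order prec) (prec_admissible : admissible prec)
    (prec_Z2 : Z2_linear prec) :
  aligned [set` levi R[i] prec] [set` nilradical R[i] prec] (@Xsp_act R[i] mu)
  <->
  [\/ [/\ ~ (exists A, maximal_below0 prec A),
          ~ (exists A, minimal_above0 prec A)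
        & exists om, Rset_mu prec mu om /\ sim mu om],
      exists A,
        [/\ maximal_below0 prec A,
            ~ (exists B, minimal_above0 prec B)
          & (exists om i0, [/\ omega_plus prec om, A (pos i0)
               & sim mu (om - eps R[i] i0)]) \/
            (exists om, Rset_mu prec mu om /\ sim mu om)],
      exists A,
        [/\ minimal_above0 prec A,
            ~ (exists B, maximal_below0 prec B)
          & (exists om i0, [/\ omega_minus prec om, A (pos i0)
               & sim mu (om + eps R[i] i0)]) \/
            (exists om, Rset_mu prec mu om /\ sim mu om)]
    | exists A1 A2,
        [/\ maximal_below0 prec A1, minimal_above0 prec A2
          & [\/ exists om i0, [/\ omega_plus prec om, A1 (pos i0)
                  & sim mu (om - eps R[i] i0)],
                exists om i0, [/\ omega_minus prec om, A2 (pos i0)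
                  & sim mu (om + eps R[i] i0)]
              | exists om, Rset_mu prec mu om /\ sim mu om]]].
Proof.
have char0 : [pchar R[i]] =i pred0 := pchar_num _.
rewrite (aligned_iff_invariant char0 prec_order prec_admissible prec_Z2 (Xsp_swm mu char0)).
rewrite (invariant_primitive mu char0 prec_order prec_admissible prec_Z2).
rewrite (primitive_iff mu prec_order prec_admissible prec_Z2).
split=> [h|].
  have [[A Amax]|nomax] := pselect (exists A, maximal_below0 prec A);
    have [[B Bmin]|nomin] := pselect (exists A, minimal_above0 prec A).
  - constructor 4; case: h => [h|[A' [A'max h]]|[B' [B'min h]]].
    + by exists A, B; split=> //; constructor 3.
    + by exists A', B; split=> //; constructor 1.
    + by exists A, B'; split=> //; constructor 2.
  - constructor 2; case: h => [h|[A' [A'max h]]|[B' [B'min h]]].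
    + by exists A; split=> //; right.
    + by exists A'; split=> //; left.
    + by case: nomin; exists B'.
  - constructor 3; case: h => [h|[A' [A'max h]]|[B' [B'min h]]].
    + by exists B; split=> //; right.
    + by case: nomax; exists A'.
    + by exists B'; split=> //; left.
  - constructor 1; case: h => [h|[A' [A'max h]]|[B' [B'min h]]] //.
    + by case: nomax; exists A'.
    + by case: nomin; exists B'.
case=> [[_ _ h]|[A [Amax _ [h|h]]]|[B [Bmin _ [h|h]]]|[A [B [Amax Bmin [h|h|h]]]]].
- by constructor 1.
- by constructor 2; exists A.
- by constructor 1.
- by constructor 3; exists B.
- by constructor 1.
- by constructor 2; exists A.
- by constructor 3; exists B.
- by constructor 1.
Qed.
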